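(* A random sup-measure $X$ on $E$ that is a.s. not the zero sup-measure is a CRSM if and only if $X\overset{d}{=}\bigvee_{i\ge1}\Gamma_i^{-1}Y_i$ (as processes indexed by $\mathcal K$), where $\{\Gamma_i\}$ are the successive points of a unit intensity Poisson process on $(0,\infty)$ and $\{Y_i\}$ are i.i.d. copies, independent of $\{\Gamma_i\}$, of an integrable random sup-measure $Y$ whose distribution is supported by the family of non-zero scaled indicator sup-measures $K\mapsto c\,\mathbf 1_{F\cap K\neq\emptyset}$ with $c>0$ and $F$ a non-empty closed subset of $E$. In this case the extremal coefficient functional of $X$ is $\theta(K)=\mathbb E\,Y(K)$, $K\in\mathcal K$.
   Context: $E$ is a locally compact Hausdorff second countable space; $\mathcal K$ its compact subsets. A sup-measure on $E$ is a Choquet capacity $\varphi$ (non-decreasing, $\varphi(\emptyset)=0$, $\varphi(A_n)\uparrow\varphi(A)$ if $A_n\uparrow A$, $\varphi(K_n)\downarrow\varphi(K)$ for compact $K_n\downarrow K$), finite on compacts, with $\varphi(\bigcup_j G_j)=\sup_j\varphi(G_j)$ for all families of open sets; a random sup-measure is a random element of the space of sup-measures (Borel $\sigma$-algebra of the sup-vague topology); it is integrable if $\mathbb E\,Y(K)<\infty$ for all $K\in\mathcal K$. $\mathrm{USC}$: bounded non-negative upper semicontinuous functions with relatively compact support. Extremal integral $\int^e f\,d\varphi=\sup\{\varphi(K)\inf_{x\in K}f(x):K\in\mathcal K\}$. Unit Fréchet with scale $a\ge0$: distribution function $\exp(-a/t)$, $t>0$. $X$ is max-stable if $\bigvee_iu_iX(K_i)$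 is unit Fréchet for all $K_i\in\mathcal K$, $u_i\ge0$; tail dependence functional $\ell(f)$ = scale of $\int^e f\,dX$; extremal coefficient functional $\theta(K)=\ell(\mathbf 1_K)$. $X$ is a CRSM if it is max-stable and $\ell(f+g)=\ell(f)+\ell(g)$ for all $f,g\in\mathrm{USC}$ with $(f(x)-f(y))(g(x)-g(y))\ge0$ for all $x,y$. *)

(* Defs.v *)
From HB Require Import structures.
From mathcomp Require Import all_boot all_order all_algebra.
From mathcomp Require Import all_classical all_reals all_analysis.
From mathcomp Require Import lebesgue_measure measurable_realfun.
Set Implicit Arguments. Unset Strict Implicit. Unset Printing Implicit Defensive.
Import Order.TTheory GRing.Theory Num.Theory.
Local Open Scope classical_set_scope.
Local Open Scope ring_scope.
Local Open Scope ereal_scope.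

Definition is_supmeasure {R : realType} {E : topologicalType}
    (phi : set E -> \bar R) : Prop :=
  [/\
      (forall A B : set E, A `<=` B -> phi A <= phi B),
      phi set0 = 0,
      (forall A : nat -> set E, (forall n, A n `<=` A n.+1) ->
         ((fun n => phi (A n)) @ \oo --> phi (\bigcup_i A i))),
      (forall K : nat -> set E, (forall n, compact (K n)) ->
         (forall n, K n.+1 `<=` K n) ->
         ((fun n => phi (K n)) @ \oo --> phi (\bigcap_i K i))) &
      (
      (forall K : set E, compact K -> phi K \is a fin_num) /\
      (* sup-property on arbitrary families of open sets
         (the empty family is covered by the convention sup {} = 0) *)
      (forall G : set (set E), (forall U, G U -> open U) ->
         phi (\bigcup_(U in G) U) = ereal_sup ((phi @` G) `|` [set 0])))].

Definition zero_supmeasure {R : realType} {E : topologicalType} :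
  set E -> \bar R := fun _ => 0.

(* X is a random sup-measure: every realisation is a sup-measure and,
   for every compact K, omega |-> X omega K is measurable (these
   evaluation maps generate the Borel sigma-algebra of the sup-vague
   topology). *)
Definition is_random_supmeasure {d : measure_display} {Om : measurableType d}
    {R : realType} {E : topologicalType} (X : Om -> set E -> \bar R) : Prop :=
  (forall w, is_supmeasure (X w)) /\
  (forall K : set E, compact K -> measurable_fun setT (fun w => X w K)).

Definition rsm_integrable {d : measure_display} {Om : measurableType d}
    {R : realType} (P : probability Om R) {E : topologicalType}
    (Y : Om -> set E -> \bar R) : Prop :=
  forall K : set E, compact K -> \int[P]_w Y w K < +oo.

Definition fdd_eq {d1 d2 : measure_display} {Om1 : measurableType d1}
    {Om2 : measurableType d2} {R : realType} {E : topologicalType}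
    (P1 : probability Om1 R) (X1 : Om1 -> set E -> \bar R)
    (P2 : probability Om2 R) (X2 : Om2 -> set E -> \bar R) : Prop :=
  forall (n : nat) (K : 'I_n -> set E) (t : 'I_n -> \bar R),
    (forall i, compact (K i)) ->
    P1 [set w | forall i, X1 w (K i) <= t i] =
    P2 [set w | forall i, X2 w (K i) <= t i].

Definition frechet_scale {d : measure_display} {Om : measurableType d}
    {R : realType} (P : probability Om R) (Z : Om -> \bar R) (a : R) : Prop :=
  (0 <= a)%R /\
  forall t : R, (0 < t)%R -> P [set w | Z w <= t%:E] = (expR (- (a / t)))%:E.

Definition USC {R : realType} {E : topologicalType} (f : E -> R) : Prop :=
  [/\ (exists M : R, forall x, (f x <= M)%R),
      (forall x, (0 <= f x)%R),
      (forall t : R, open [set x | (f x < t)%R]) &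
      compact (closure [set x | f x != 0%R])].

Definition ext_int {R : realType} {E : topologicalType}
    (f : E -> R) (phi : set E -> \bar R) : \bar R :=
  ereal_sup [set phi K * ereal_inf [set (f x)%:E | x in K] | K in compact].

Definition max_stable {d : measure_display} {Om : measurableType d}
    {R : realType} (P : probability Om R) {E : topologicalType}
    (X : Om -> set E -> \bar R) : Prop :=
  forall (n : nat) (K : 'I_n -> set E) (u : 'I_n -> R),
    (forall i, compact (K i)) -> (forall i, (0 <= u i)%R) ->
    exists a : R,
      frechet_scale P (fun w => \big[maxe/0]_(i < n) ((u i)%:E * X w (K i))) a.

Definition tail_dep {d : measure_display} {Om : measurableType d}
    {R : realType} (P : probability Om R) {E : topologicalType}
    (X : Om -> set E -> \bar R) (f : E -> R) (a : R) : Prop :=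
  frechet_scale P (fun w => ext_int f (X w)) a.

Definition comonotone {R : realType} {E : topologicalType} (f g : E -> R) :=
  forall x y : E, (0 <= (f x - f y) * (g x - g y))%R.

Definition is_CRSM {d : measure_display} {Om : measurableType d}
    {R : realType} (P : probability Om R) {E : topologicalType}
    (X : Om -> set E -> \bar R) : Prop :=
  max_stable P X /\
  forall f g : E -> R, USC f -> USC g -> comonotone f g ->
    exists a b : R, [/\ tail_dep P X f a, tail_dep P X g b &
                        tail_dep P X (fun x => f x + g x)%R (a + b)%R].

Definition gen_sigma {d : measure_display} {Om : measurableType d}
    {R : realType} (fs : set (Om -> \bar R)) : set (set Om) :=
  <<s [set A | exists f (B : set (\bar R)), [/\ fs f, measurable B &
                                              A = f @^-1` B]] >>.

Definition mutually_independent {d : measure_display} {Om : measurableType d}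
    {R : realType} (P : probability Om R) {I : eqType}
    (F : I -> set (set Om)) : Prop :=
  forall (J : seq I) (A : I -> set Om), uniq J ->
    (forall i, i \in J -> F i (A i)) ->
    fine (P (\bigcap_(i in [set i | i \in J]) A i)) =
    (\prod_(i <- J) fine (P (A i)))%R.

Definition std_exponential {d : measure_display} {Om : measurableType d}
    {R : realType} (P : probability Om R) (Z : Om -> R) : Prop :=
  measurable_fun setT Z /\
  forall t : R, P [set w | (Z w <= t)%R] =
                (if (0 <= t)%R then 1 - expR (- t) else 0)%:E.

(* Gamma_i = Ex_0 + ... + Ex_i : successive points (i = 0, 1, ...) of a
   unit intensity Poisson process on (0, oo) *)
Definition poisson_points {d : measure_display} {Om : measurableType d}
    {R : realType} (Ex : nat -> Om -> R) : nat -> Om -> R :=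
  fun i w => (\sum_(j < i.+1) Ex j w)%R.

Definition lepage_sup {d : measure_display} {Om : measurableType d}
    {R : realType} {E : topologicalType}
    (Ex : nat -> Om -> R) (Y : nat -> Om -> set E -> \bar R) :
    Om -> set E -> \bar R :=
  fun w A => ereal_sup (range (fun i => ((poisson_points Ex i w)^-1)%:E * Y i w A)).

(* phi is a non-zero scaled indicator sup-measure K |-> c 1_{F cap K <> 0}
   (checked on compacts, which determines the sup-measure) *)
Definition scaled_indicator {R : realType} {E : topologicalType}
    (phi : set E -> \bar R) : Prop :=
  exists (c : R) (F : set E), [/\ (0 < c)%R, closed F, F !=set0 &
    forall K : set E, compact K ->
      phi K = (if `[< F `&` K !=set0 >] then c%:E else 0)].

(* The representation: Ex i.i.d. standard exponential (so that
   Gamma_i = poisson_points Ex i are the points of a unit Poisson process),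
   Y i.i.d. integrable random sup-measures concentrated on scaled
   indicators, the whole family {Ex_i} u {Y_i} mutually independent, and
   X equal in finite-dimensional distributions to \/_i Gamma_i^{-1} Y_i. *)
Definition lepage_rep {d d' : measure_display} {Om : measurableType d}
    {Om' : measurableType d'} {R : realType} {E : topologicalType}
    (P : probability Om R) (X : Om -> set E -> \bar R)
    (P' : probability Om' R) (Ex : nat -> Om' -> R)
    (Y : nat -> Om' -> set E -> \bar R) : Prop :=
  [/\ (forall i, std_exponential P' (Ex i)),
      (forall i, is_random_supmeasure (Y i)) /\
      (forall i, fdd_eq P' (Y i) P' (Y 0%N)),
      mutually_independent P'
        (fun k : nat + nat => match k with
          | inl i => gen_sigma [set (fun w => (Ex i w)%:E)]
          | inr i => gen_sigma [set (fun w => Y i w K) | K in compact]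
          end),
      rsm_integrable P' (Y 0%N) /\
      {ae P', forall w, scaled_indicator (Y 0%N w)} &
      fdd_eq P X P' (lepage_sup Ex Y)].

(* Main.v *)
(* For W_i i.i.d., W_i >= 0 integrable and G x = exp (x - E max(W, x)), the process
   [W_0 <= Gamma_0, .., W_(n-1) <= Gamma_(n-1)] * G(Gamma_n) is a martingale which tends to
   the indicator of the event that W_i <= Gamma_i for all i. Hence this event has
   probability G 0 = exp (- E W). With W_i = max_j u_j Y_i(K_j) this gives the joint
   law of the LePage series. If Y is a scaled indicator c 1_F, then
   int^e f dY = c max_F f, which is additive in comonotone f, so that X is a CRSM.

   Conversely, a step function is peeled level by level into comonotone layers. So for
   a CRSM X, the functional l is an integral of theta, and the joint laws of X are those
   of the LePage series of any scaled indicator process Y with E Y(K) = theta(K). To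
   build Y, let (C_i) be compact sets whose interiors form a base. The limits of
   k P[X > k on some, X <= k on other C_i] are the values of an exponent measure of mass
   theta(K) on the closed sets that hit K. It is split according to the first C_n
   that is hit and each piece is rescaled (the factor goes into c), which makes it a
   probability. The digits "C_i is hit" are realised on [0, 1) by nested intervals,
   and F is the complement of the interiors of the C_i with digit 0. *)

Require Import Defs.
From HB Require Import structures.
From mathcomp Require Import all_boot all_order all_algebra.
From mathcomp Require Import all_classical all_reals all_analysis.
From mathcomp Require Import lebesgue_measure measurable_realfun.
From mathcomp Require Import ring lra.
Set Implicit Arguments. Unset Strict Implicit. Unset Printing Implicit Defensive.
Import Order.TTheory GRing.Theory Num.Theory.
Import numFieldNormedType.Exports.
Local Open Scope classical_set_scope.
Local Open Scope ring_scope.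

(** The Poisson process is given only through sums of i.i.d. exponentials, so no marking theorem is
    at hand. Conditioning on the first gap turns the probability that [W_i <= x + Gamma_i] for all
    [i] into the renewal equation [G x = E (F G)(x + T)], and this one-step identity is all that the
    martingale needs.

    In the converse the exponent measure may have infinite total mass, so it cannot be normalised as
    a whole. Cutting it at the first [C_n] that is hit gives finite pieces, and the hypothesis that
    [X] is not zero provides some mass to normalise. A digit 0 removes only the interior of [C_i]:
    the closed set may still touch the boundary, and hitting a given compact [K] is not a digit
    event. The mass of the sets that hit [K] is therefore computed for finite unions of the [C_i]
    and carried over to [K] along finite covers that decrease to it, along which [theta] is
    continuous. *)

(** * Uniqueness for the renewal equation *)

(** Over [n] equal pieces the bound sums to [(b - a) / n] times the telescoping total [V b - V a],
    which vanishes as [n] grows. Neither continuity nor a derivative of [D] is asked for. *)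
Lemma quadratic_increment_const (R : realType) (D V : R -> R) (a b : R) :
  a <= b ->
  (forall x y, a <= x -> x <= y -> y <= b ->
     `|D y - D x| <= (y - x) * (V y - V x)) ->
  D b = D a.
Proof.
move=> ab hD.
apply/eqP; rewrite -subr_eq0 -normr_le0; apply/ler_addgt0Pl => e e0.
rewrite addr0.
have Vab : 0 <= (b - a) * (V b - V a).
  by apply: le_trans (hD a b (lexx a) ab (lexx b)).
pose n := (Num.truncn ((b - a) * (V b - V a) / e)).+1.
have n0 : 0 < n%:R :> R by rewrite ltr0n.
pose x i : R := a + (b - a) * i%:R / n%:R.
have xS i : x i.+1 - x i = (b - a) / n%:R.
  by rewrite /x -natr1; field; rewrite gt_eqF.
have xn : x n = b by rewrite /x mulfK ?gt_eqF// addrC subrK.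
have x0 : x 0%N = a by rewrite /x mulr0 mul0r addr0.
have st k : (k <= n)%N -> `|D (x k) - D (x 0%N)| <= (b - a) / n%:R * (V (x k) - V (x 0%N)).
  elim: k => [|k IH] kn; first by rewrite !subrr normr0 mulr0.
  have ge0d : 0 <= (b - a) / n%:R by rewrite divr_ge0 ?subr_ge0// ltW.
  have xle i : (i <= n)%N -> a <= x i <= b.
    move=> iN; rewrite /x lerDl; apply/andP; split.
      by rewrite divr_ge0 ?mulr_ge0 ?subr_ge0 ?ler0n.
    rewrite -lerBrDl ler_pdivrMr// ler_wpM2l ?subr_ge0//.
    by rewrite ler_nat.
  have /andP[h1 _] := xle k (ltnW kn).
  have /andP[_ h2] := xle _ kn.
  have h3 : x k <= x k.+1 by rewrite -subr_ge0 xS.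
  rewrite (_ : _ - _ = (D (x k.+1) - D (x k)) + (D (x k) - D (x 0%N))); last by ring.
  rewrite (_ : V (x k.+1) - V (x 0%N) =
    (V (x k.+1) - V (x k)) + (V (x k) - V (x 0%N))); last by ring.
  apply: le_trans (ler_normD _ _) _; rewrite mulrDr lerD ?IH 1?ltnW//.
  by rewrite -{1}(xS k); exact: hD.
have := st n (leqnn n); rewrite xn x0 => /le_trans; apply.
rewrite mulrAC ler_pdivrMr//.
have := @truncnS_gt R ((b - a) * (V b - V a) / e).
by rewrite ltr_pdivrMr// => /ltW; rewrite -/n [n%:R * e]mulrC [e * _]mulrC.
Qed.

Lemma one_sub_expRN_le (R : realType) (h : R) : 1 - expR (- h) <= h.
Proof. by have := expR_ge1Dx (- h); lra. Qed.

Lemma mul_expRN_le (R : realType) (h : R) : h * expR (- h) <= 1 - expR (- h).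
Proof.
have := expR_ge1Dx h => H.
have e0 := expR_gt0 (- h).
have : (1 + h) * expR (- h) <= 1.
  by rewrite -[leRHS](expRxMexpNx_1 h); apply: ler_wpM2r => //; exact: ltW.
lra.
Qed.

(* [F] plays the role of a distribution function, [K x] of [E max(W, x)] and
   [q] of [x |-> E (F G)(x + T)] with [T] exponential. Formally both [q] and [G]
   solve [(exp(-x) u)' = - exp(-x) F G]; since [F] may jump, only increments
   are compared. *)
Lemma renewal_unique (R : realType) (F K q : R -> R) :
  let G x := expR (x - K x) in
  (forall x, 0 <= F x <= 1) -> {homo F : x y / x <= y} ->
  (forall x, x <= K x) ->
  (forall x y, x <= y -> (y - x) * F x <= K y - K x <= (y - x) * F y) ->
  (forall x, 0 <= q x <= 1) ->
  (forall x y, x <= y ->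
     F x * G x * (1 - expR (- (y - x))) <= q x - expR (- (y - x)) * q y
       <= F y * G y * (1 - expR (- (y - x)))) ->
  forall x, q x = G x.
Proof.
move=> G F01 Fnd xK hK q01 hq.
have G01 x : 0 <= G x <= 1.
  by rewrite expR_ge0 -expR0 ler_expR subr_le0 xK.
(* [D] is shown to be constant; as [|D x| <= exp (- x)], the constant is 0. *)
pose D x := expR (- x) * (q x - G x).
have Dle x : `|D x| <= expR (- x).
  rewrite normrM (ger0_norm (expR_ge0 _)) -[leRHS]mulr1 ler_wpM2l ?expR_ge0//.
  by rewrite ler_norml; have := q01 x; have := G01 x; lra.
have Dxy a b : a <= b -> D b = D a.
  move=> ab.
  (* The increment of [D] over [[x, y]] is at most [h * (exp(-x) F y - exp(-y) F x)] in absolute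
     value. Since [0 <= F <= 1], the bracket is dominated by an increment of the function supplied
     here. *)
  apply: (@quadratic_increment_const _ D
            (fun t => expR (- a) * F t - expR (- t))) => // x y ax xy yb.
  set h := y - x.
  have h0 : 0 <= h by rewrite subr_ge0.
  have /andP[K1 K2] := hK _ _ xy.
  have /andP[q1 q2] := hq _ _ xy.
  have Fxy := Fnd _ _ xy.
  have /andP[Fx0 Fx1] := F01 x; have /andP[Fy0 Fy1] := F01 y.
  have /andP[Gx0 Gx1] := G01 x; have /andP[Gy0 Gy1] := G01 y.
  pose H t := expR (- K t).
  have HG t : H t = expR (- t) * G t.
    by rewrite /H /G -expRD; congr expR; ring.
  have H0 t : 0 <= H t by exact: expR_ge0.
  have HyE : H y = H x * expR (- (K y - K x)).
    by rewrite /H -expRD; congr expR; ring.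
  have E1 : H x - H y <= h * F y * H x.
    have e1 := one_sub_expRN_le (K y - K x).
    have : H x * (1 - expR (- (K y - K x))) <= H x * (h * F y).
      by apply: ler_wpM2l => //; apply: le_trans e1 _.
    by rewrite HyE; lra.
  have E2 : h * F x * H y <= H x - H y.
    have e1 := mul_expRN_le (K y - K x).
    have e2 : h * F x * expR (- (K y - K x)) <= (K y - K x) * expR (- (K y - K x)).
      by apply: ler_wpM2r => //; exact: expR_ge0.
    have : H x * (h * F x * expR (- (K y - K x))) <= H x * (1 - expR (- (K y - K x))).
      by apply: ler_wpM2l => //; apply: le_trans e2 e1.
    by rewrite HyE; lra.
  have ey : expR (- y) = expR (- x) * expR (- h).
    by rewrite -expRD; congr expR; rewrite /h; ring.
  have ex0 : 0 <= expR (- x) := expR_ge0 _.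
  have ey0 : 0 <= expR (- y) := expR_ge0 _.
  have eyx : expR (- y) <= expR (- x) by rewrite ler_expR lerN2.
  have exa : expR (- x) <= expR (- a) by rewrite ler_expR lerN2.
  have DE : D y - D x = (H x - H y) - expR (- x) * (q x - expR (- h) * q y).
    by rewrite /D !HG ey; ring.
  have Q1 : expR (- x) * (q x - expR (- h) * q y) <= h * F y * (expR (- x) * G y).
    have : expR (- x) * (q x - expR (- h) * q y) <=
        expR (- x) * (F y * G y * (1 - expR (- h))).
      by apply: ler_wpM2l.
    have : (expR (- x) * (F y * G y)) * (1 - expR (- h)) <= (expR (- x) * (F y * G y)) * h.
      by apply: ler_wpM2l (one_sub_expRN_le h); rewrite !mulr_ge0.
    lra.
  have Q2 : h * F x * (expR (- y) * G x) <= expR (- x) * (q x - expR (- h) * q y).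
    have : expR (- x) * (F x * G x * (1 - expR (- h))) <=
       expR (- x) * (q x - expR (- h) * q y).
      by apply: ler_wpM2l.
    have : (expR (- x) * (F x * G x)) * (h * expR (- h)) <=
        (expR (- x) * (F x * G x)) * (1 - expR (- h)).
      by apply: ler_wpM2l (mul_expRN_le h); rewrite !mulr_ge0.
    rewrite ey; lra.
  have B0 : 0 <= expR (- x) * F y - expR (- y) * F x.
    by rewrite subr_ge0; apply: ler_pM.
  have BV : expR (- x) * F y - expR (- y) * F x <=
      expR (- a) * F y - expR (- y) - (expR (- a) * F x - expR (- x)).
    have : expR (- x) * (F y - F x) <= expR (- a) * (F y - F x).
      by apply: ler_wpM2r => //; rewrite subr_ge0.
    have : F x * (expR (- x) - expR (- y)) <= 1 * (expR (- x) - expR (- y)).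
      by apply: ler_wpM2r => //; rewrite subr_ge0.
    lra.
  suff S : `|D y - D x| <= h * (expR (- x) * F y - expR (- y) * F x).
    by apply: le_trans S _; apply: ler_wpM2l.
  have Gyh : h * (expR (- x) * F y - expR (- y) * F x) * G y <=
      h * (expR (- x) * F y - expR (- y) * F x).
    by rewrite -[leRHS]mulr1; apply: ler_wpM2l => //; rewrite mulr_ge0.
  have Gxh : h * (expR (- x) * F y - expR (- y) * F x) * G x <=
      h * (expR (- x) * F y - expR (- y) * F x).
    by rewrite -[leRHS]mulr1; apply: ler_wpM2l => //; rewrite mulr_ge0.
  rewrite DE ler_norml; apply/andP; split.
    have : h * F x * (expR (- y) * G y) <= H x - H y by rewrite -HG.
    lra.
  have : H x - H y <= h * F y * (expR (- x) * G x) by rewrite -HG.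
  lra.
move=> x.
suff D0 : D x = 0.
  move/eqP: D0; rewrite /D mulf_eq0 gt_eqF ?expR_gt0//= subr_eq0.
  by move/eqP.
apply/eqP; rewrite -normr_le0; apply/ler_addgt0Pl => e e0; rewrite addr0.
pose y := Num.max x (e^-1).
rewrite -(Dxy x y); last by rewrite /y le_max lexx.
apply: le_trans (Dle y) _.
rewrite expRN -[leRHS]invrK lef_pV2 ?posrE ?invr_gt0 ?expR_gt0//.
have : e^-1 <= y by rewrite /y le_max lexx orbT.
by have := expR_ge1Dx y; lra.
Qed.

(** * Compact bases *)

Section compact_base.
Variable E : topologicalType.

Definition compact_base (C : nat -> set E) : Prop :=
  (forall i, compact (C i)) /\
  (forall x U, open U -> U x -> exists2 i, (C i)^° x & C i `<=` U).

(** Members of a countable base whose closure is not compact are replaced by the empty set. Enough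
    members remain: regularity inside a compact neighbourhood yields one whose closure is compact
    and lies in [U]. *)
Lemma exists_compact_base : hausdorff_space E -> locally_compact [set: E] ->
  @second_countable E -> exists C, compact_base C.
Proof.
move=> hE lc [B cB [oB bB]].
have /pfcard_geP[B0|[f]] := cB.
  exists (fun=> set0); split; first by move=> _; exact: compact0.
  by move=> x U _ _; have [D [+ _]] := bB x setT filterT; rewrite B0.
pose C i := if `[< compact (closure (f i)) >] then closure (f i) else set0.
exists C; split.
  by move=> i; rewrite /C; case: asboolP => // _; exact: compact0.
move=> x U oU Ux; have [V] := lc x I; rewrite withinET => Vx [cV clV].
have [|W Wx WU] := @compact_regular _ x _ hE cV Vx U; first exact: open_nbhs_nbhs.
have := bB x (W `&` V) (filterI Wx Vx).
move=> [D [BD Dx] DWV].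
have [i _ fi] := @surj _ _ _ _ f D BD.
have cD : compact (closure (f i)).
  apply: (subclosed_compact _ cV); first exact: closed_closure.
  by rewrite fi [X in _ `<=` X](closure_id V).1//; apply: closureS => y /DWV[].
exists i; rewrite /C (asboolT cD) fi.
  apply: (filterS (@subset_closure _ D)); apply: open_nbhs_nbhs.
  by split => //; exact: oB.
by apply: subset_trans WU; apply: closureS => y /DWV[].
Qed.

Variable C : nat -> set E.
Hypothesis hE : hausdorff_space E.
Hypothesis cC : compact_base C.

Definition cover_set (J : seq nat) : set E := \bigcup_(j in [set` J]) C j.
Definition cover_int (J : seq nat) : set E := \bigcup_(j in [set` J]) (C j)^°.

Lemma cover_int_sub J : cover_int J `<=` cover_set J.
Proof. by move=> x [j Jj /interior_subset Cx]; exists j. Qed.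

Lemma open_cover_int J : open (cover_int J).
Proof. by apply: bigcup_open => j _; exact: open_interior. Qed.

Lemma compact_cover_set J : compact (cover_set J).
Proof.
rewrite /cover_set bigcup_seq; apply: bigsetU_compact => j _.
by case: cC.
Qed.

Lemma cover_set_cat J J' : cover_set (J ++ J') = cover_set J `|` cover_set J'.
Proof.
apply/seteqP; split => x.
  by move=> [j /=]; rewrite mem_cat => /orP[]; [left|right]; exists j.
by move=> [[j Jj Cx]|[j Jj Cx]]; exists j => //=; rewrite mem_cat; apply/orP; [left|right].
Qed.

Lemma compact_cover_int K (D : set nat) : compact K ->
  K `<=` \bigcup_(i in D) (C i)^° ->
  exists2 J, K `<=` cover_int J & (forall j, j \in J -> D j).
Proof.
move=> cK KD.
(* [cover_compact] lives on pointed spaces; a point of [K] is the base point. *)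
have [[x0 Kx0]|K0] := pselect (K !=set0); last first.
  by exists [::] => // x Kx; case: K0; exists x.
pose E' : ptopologicalType := HB.pack E (isPointed.Build E x0).
have cK' : @cover_compact E' K by rewrite -compact_cover.
have [] := cK' nat D (fun i => (C i)^°) _ KD.
  by move=> i _; exact: open_interior.
move=> D' DU KD'; exists (finmap.enum_fset D').
  by move=> x /KD'[i Di Cx]; exists i.
by move=> j jD; have := DU j jD; rewrite inE.
Qed.

Lemma cover_int_sandwich K U : compact K -> open U -> K `<=` U ->
  exists2 J, K `<=` cover_int J & cover_set J `<=` U.
Proof.
move=> cK oU KU.
have [|J KJ JU] := @compact_cover_int K [set i | C i `<=` U] cK.
  by move=> x Kx; have [i Cix CiU] := cC.2 x U oU (KU x Kx); exists i.
by exists J => // x [j /JU]; exact.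
Qed.

(** There are countably many finite lists of indices. Stage [k] shrinks the current cover into the
    [k]-th list whenever that one covers [K], so the sequence enters every neighbourhood of [K], and
    outer approximation becomes a limit along a sequence. *)
Lemma cover_int_sequence K : compact K -> exists J : nat -> seq nat,
  [/\ forall k, K `<=` cover_int (J k),
      forall k, cover_set (J k.+1) `<=` cover_set (J k) &
      forall U, open U -> K `<=` U -> exists k, cover_set (J k) `<=` U].
Proof.
move=> cK.
have [pick pickP] : exists pick : set E -> seq nat, forall U, open U -> K `<=` U ->
    K `<=` cover_int (pick U) /\ cover_set (pick U) `<=` U.
  have H U : exists J, open U -> K `<=` U -> K `<=` cover_int J /\ cover_set J `<=` U.
    have [[oU KU]|nU] := pselect (open U /\ K `<=` U); last by exists [::] => ? ?; case: nU.
    by have [J] := cover_int_sandwich cK oU KU; exists J.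
  by have [pick pickP] := choice H; exists pick.
pose decode k : seq nat := odflt [::] (unpickle k).
pose next k (J : seq nat) :=
  cover_int J `&` (if `[< K `<=` cover_int (decode k) >] then cover_int (decode k) else setT).
pose J := fix J k := if k is k'.+1 then pick (next k' (J k')) else pick setT.
have nextP k I : K `<=` cover_int I -> open (next k I) /\ K `<=` next k I.
  move=> KI; rewrite /next; case: asboolP => [Kd|_]; split.
  - by apply: openI; exact: open_cover_int.
  - by rewrite subsetI.
  - by rewrite setIT; exact: open_cover_int.
  - by rewrite setIT.
have KJ k : K `<=` cover_int (J k).
  elim: k => [|k IH] /=; first by have [] := pickP setT openT (@subsetT _ _).
  by have [h1 h2] := nextP k _ IH; have [] := pickP _ h1 h2.
have JS k : cover_set (J k.+1) `<=` next k (J k).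
  by have [h1 h2] := nextP k _ (KJ k); have [] := pickP _ h1 h2.
exists J; split => //.
  by move=> k x /JS [/cover_int_sub].
move=> U oU KU; have [I KI IU] := cover_int_sandwich cK oU KU.
(* Stage [pickle I] intersects with [I]; the effect shows one index later. *)
exists (pickle I).+1 => x /JS[_].
by rewrite /decode pickleK/= (asboolT KI) => /cover_int_sub/IU.
Qed.

Definition exhaust (n : nat) : set E := cover_set (iota 0 n).

Lemma compact_exhaust n : compact (exhaust n).
Proof. exact: compact_cover_set. Qed.

Lemma exhaust0 : exhaust 0 = set0.
Proof. by apply/seteqP; split => // x [j]. Qed.

Lemma exhaustS n : exhaust n.+1 = exhaust n `|` C n.
Proof.
rewrite /exhaust -addn1 iotaD cover_set_cat; congr (_ `|` _).
apply/seteqP; split => x; first by move=> [j /=]; rewrite inE => /eqP ->.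
by move=> Cx; exists n => //=; rewrite inE.
Qed.

Lemma exhaust_nd m n : (m <= n)%N -> exhaust m `<=` exhaust n.
Proof.
move=> mn x [j /=]; rewrite mem_iota/= add0n => jm Cx; exists j => //=.
by rewrite mem_iota/= add0n (leq_trans jm).
Qed.

Lemma compact_sub_exhaust_int K : compact K ->
  exists n, K `<=` cover_int (iota 0 n).
Proof.
move=> cK; have [J KJ _] := cover_int_sandwich cK openT (@subsetT _ K).
exists (\max_(j <- J) j).+1 => x /KJ[j Jj Cx].
suff jJ : j \in iota 0 (\max_(j <- J) j).+1 by exists j.
by rewrite mem_iota leq0n add0n ltnS; apply: (@leq_bigmax_seq _ _ xpredT id).
Qed.

Lemma bigcup_exhaust : \bigcup_n exhaust n = setT.
Proof.
apply/seteqP; split => // x _.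
have [n /(_ x erefl) /cover_int_sub] := compact_sub_exhaust_int (@compact_set1 _ x).
by exists n.
Qed.

End compact_base.

Local Open Scope ereal_scope.

(** * Laws and the renewal equation *)

Section image_measure.
Context d d' (T : measurableType d) (T' : measurableType d') (R : realType).
Variables (P : {measure set T -> \bar R}) (f : T -> T').
Variable mf : measurable_fun setT f.

(* [pushforward] with the measurability proof as an argument, so that the
   measure structure is found by unification. *)
Definition image_measure of measurable_fun setT f := pushforward P f.

Let image_measure0 : image_measure mf set0 = 0.
Proof. by rewrite /image_measure/pushforward preimage_set0 measure0. Qed.

Let image_measure_ge0 A : 0 <= image_measure mf A.
Proof. exact: measure_ge0. Qed.

Let image_measure_sigma_additive : semi_sigma_additive (image_measure mf).
Proof. exact: (@measure_semi_sigma_additive _ _ _ (pushforward P f)). Qed.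

HB.instance Definition _ := isMeasure.Build _ _ _ (image_measure mf)
  image_measure0 image_measure_ge0 image_measure_sigma_additive.

Lemma ge0_integral_image_measure (g : T' -> \bar R) :
  measurable_fun setT g -> (forall x, 0 <= g x) ->
  \int[image_measure mf]_x g x = \int[P]_x g (f x).
Proof. by move=> mg g0; rewrite ge0_integral_pushforward. Qed.

End image_measure.

Section finite_image_measure.
Context d d' (T : measurableType d) (T' : measurableType d') (R : realType).
Variables (P : {finite_measure set T -> \bar R}) (f : T -> T').
Variable mf : measurable_fun setT f.

Let image_measure_fin : fin_num_fun (image_measure P mf).
Proof.
move=> U mU; rewrite /image_measure/pushforward fin_num_measure//.
by rewrite -[X in measurable X]setTI; exact: mf.
Qed.

HB.instance Definition _ :=
  Measure_isFinite.Build _ _ _ (image_measure P mf) image_measure_fin.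

End finite_image_measure.

Lemma measurable_rays (R : realType) :
  (measurable : set (set R)) = <<s [set A | exists t : R, A = `]-oo, t]%classic] >>.
Proof.
transitivity (<<s @RGenOInfty.G R >>); first exact: RGenOInfty.measurableE.
apply/seteqP; split.
  apply: smallest_sub; first exact: smallest_sigma_algebra.
  move=> _ [x ->].
  rewrite -setCitvl.
  rewrite -[X in _ X]setTD; apply: (@sigma_algebraCD _ setT); last first.
    by apply: sub_sigma_algebra; exists x.
apply: smallest_sub; first exact: smallest_sigma_algebra.
move=> _ [x ->].
rewrite -setCitvr.
rewrite -[X in _ X]setTD; apply: (@sigma_algebraCD _ setT).
by apply: sub_sigma_algebra; exists x.
Qed.

Lemma measure_eq_of_rays (R : realType) (m1 m2 : {measure set R -> \bar R}) :
  (forall t : R, m1 `]-oo, t]%classic = m2 `]-oo, t]%classic) ->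
  (forall t : R, m1 `]-oo, t]%classic < +oo) ->
  forall A, measurable A -> m1 A = m2 A.
Proof.
move=> m12 m1oo A mA.
apply: (measure_unique [set A | exists t : R, A = `]-oo, t]%classic]
  (fun n => `]-oo, n%:R]%classic)) => //.
- exact: measurable_rays.
- move=> _ _ [s ->] [t ->]; exists (Order.min s t).
  by apply/seteqP; split => x /=; rewrite !in_itv/= le_min => /andP.
- by move=> n; exists n%:R.
- apply/seteqP; split => // x _; exists (Num.truncn x).+1 => //=.
  by rewrite in_itv/= ltW// truncnS_gt.
- by move=> _ [t ->].
Qed.

Lemma ge0_integral_mrestr d (T : measurableType d) (R : realType)
    (mu : {measure set T -> \bar R}) (A : set T) (mA : measurable A)
    (f : T -> \bar R) : measurable_fun setT f -> (forall x, 0 <= f x) ->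
  \int[mrestr mu mA]_x f x = \int[mu]_(x in A) f x.
Proof.
move=> mf f0.
rewrite (@ge0_negligible_integral _ _ _ (mrestr mu mA) _ (~` A))//.
- rewrite setDE setCK setTI; apply: eq_measure_integral => B mB BA.
  by rewrite /= /mrestr setIidl.
- exact: measurableC.
- by rewrite /= /mrestr setICl measure0.
Qed.

Section laws.
Context d (Om : measurableType d) (R : realType) (P : probability Om R).

(** Both sides integrate [f] against finite measures: the law of [T - h] restricted to [h < T], and
    [exp (- h)] times the law of [T]. The two agree on rays. *)
Lemma memoryless_integral (T : Om -> R) (f : R -> \bar R) (h : R) :
  std_exponential P T -> measurable_fun setT f -> (forall x, 0 <= f x) ->
  (0 <= h)%R ->
  \int[P]_(w in [set w | (h < T w)%R]) f (T w - h)%R =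
  (expR (- h))%:E * \int[P]_w f (T w).
Proof.
move=> [mT cT] mf f0 h0.
have mA : measurable [set w | (h < T w)%R].
  rewrite -[X in measurable X]setTI; have := mT measurableT _ (measurable_itv `]h, +oo[).
  by congr measurable; congr (_ `&` _); apply/seteqP; split => x /=; rewrite in_itv/= andbT.
have mTh : measurable_fun setT (fun w => T w - h)%R.
  exact: measurable_funB.
have e0 : (0 <= expR (- h))%R by exact: expR_ge0.
pose e : {nonneg R} := NngNum e0.
have E : forall A, measurable A ->
   image_measure (mrestr P mA) mTh A = mscale e (image_measure P mT) A.
  apply: measure_eq_of_rays => // t.
    rewrite /= /mscale/= /image_measure /pushforward /mrestr.
    have [t0|t0] := ltP t 0%R.
      rewrite (_ : _ `&` _ = set0); last first.
        apply/seteqP; split => // w [/=]; rewrite in_itv/=; lra.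
      rewrite measure0.
      rewrite (_ : T @^-1` _ = [set w | (T w <= t)%R]); last first.
        by apply/seteqP; split => w /=; rewrite in_itv.
      by rewrite cT leNgt t0/= mule0.
    rewrite (_ : _ `&` _ = [set w | (T w <= t + h)%R] `\` [set w | (T w <= h)%R]); last first.
      apply/seteqP; split => w [/=]; rewrite in_itv/=.
        by move=> ? ?; split; [lra|apply/negP; rewrite -ltNge].
      by move=> ? /negP; rewrite -ltNge => ?; split => //; lra.
    have mR x : measurable [set w | (T w <= x)%R].
      rewrite -[X in measurable X]setTI; have := mT measurableT _ (measurable_itv `]-oo, x]).
      by congr measurable; congr (_ `&` _); apply/seteqP; split => w /=; rewrite in_itv/=.
    rewrite measureD//; last by rewrite -ge0_fin_numE ?fin_num_measure.
    rewrite (_ : _ `&` _ = [set w | (T w <= h)%R]); last first.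
      by apply/seteqP; split => w /=; [case|split => //; lra].
    rewrite (_ : T @^-1` _ = [set w | (T w <= t)%R]); last first.
      by apply/seteqP; split => w /=; rewrite in_itv.
    transitivity ((1 - expR (- (t + h)))%:E - (1 - expR (- h))%:E).
      by congr (_ - _); rewrite [LHS]cT ?h0// addr_ge0.
    rewrite [in RHS]cT t0 -EFinB -EFinM; congr EFin.
    rewrite opprD expRD; ring.
  rewrite /= /image_measure /pushforward /mrestr; apply: le_lt_trans (probability_le1 _ _) _.
    apply: measurableI => //; rewrite -[X in measurable X]setTI; exact: mTh.
  exact: ltry.
rewrite -ge0_integral_mrestr//; last first.
  by apply: measurableT_comp.
rewrite -(ge0_integral_image_measure _ mTh mf)//.
rewrite (eq_measure_integral (mscale e (image_measure P mT))); last by move=> A mA' _; exact: E.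
by rewrite ge0_integral_mscale// ge0_integral_image_measure.
Qed.

(** The joint law of [(S, Z)] on [A] is a product measure, so Tonelli applies. [A] and [S] may
    depend on each other; only [Z] has to factor out. *)
Lemma indep_integral (A : set Om) (S Z : Om -> R) (h : R * R -> \bar R) :
  measurable A -> measurable_fun setT S -> measurable_fun setT Z ->
  (forall B C, measurable B -> measurable C ->
     P (A `&` S @^-1` B `&` Z @^-1` C) = P (A `&` S @^-1` B) * P (Z @^-1` C)) ->
  measurable_fun setT h -> (forall x, 0 <= h x) ->
  \int[P]_(w in A) h (S w, Z w) = \int[P]_(w in A) \int[P]_w' h (S w, Z w').
Proof.
move=> mA mS mZ hI mh h0.
have mSZ : measurable_fun setT (fun w => (S w, Z w)) by exact: measurable_fun_pair.
pose s : {finite_measure set R -> \bar R} := image_measure (mrestr P mA) mS.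
pose z : {finite_measure set R -> \bar R} := image_measure P mZ.
rewrite -(@ge0_integral_mrestr _ _ _ P A mA (fun w => h (S w, Z w)))//; last first.
  exact: measurableT_comp.
rewrite -(ge0_integral_image_measure _ mSZ mh)//.
rewrite (eq_measure_integral (s \x z)%E); last first.
  move=> B mB _; apply/esym; apply: product_measure_unique => // B1 C1 mB1 mC1.
  rewrite /= /image_measure /pushforward /mrestr.
  rewrite [in RHS]setIC -hI// setIC; congr (P _).
  by apply/seteqP; split => w /=; tauto.
rewrite fubini_tonelli1//.
rewrite ge0_integral_image_measure//; last 2 first.
- exact: measurable_fun_fubini_tonelli_F.
- by move=> x; apply: integral_ge0.
rewrite ge0_integral_mrestr//; last 2 first.
- by apply: measurableT_comp (measurable_fun_fubini_tonelli_F _ mh h0) _.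
- by move=> x; apply: integral_ge0.
apply: eq_integral => w _; rewrite /fubini_F ge0_integral_image_measure//.
exact: measurableT_comp.
Qed.
End laws.

Lemma measurable_preimageT d d' (T : measurableType d) (T' : measurableType d')
    (f : T -> T') (B : set T') :
  measurable_fun setT f -> measurable B -> measurable (f @^-1` B).
Proof. by move=> mf mB; rewrite -[X in measurable X]setTI; exact: mf. Qed.

Section real_events.
Context d (T : measurableType d) (R : realType) (f : T -> R).
Hypothesis mf : measurable_fun setT f.

Lemma measurable_set_le (x : R) : measurable [set w | (f w <= x)%R].
Proof.
rewrite (_ : mkset _ = f @^-1` `]-oo, x]); first exact: measurable_preimageT.
by apply/seteqP; split => w /=; rewrite in_itv.
Qed.

Lemma measurable_set_gt (x : R) : measurable [set w | (x < f w)%R].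
Proof.
rewrite (_ : mkset _ = f @^-1` `]x, +oo[); first exact: measurable_preimageT.
by apply/seteqP; split => w /=; rewrite in_itv/= andbT.
Qed.

End real_events.

Section renewal.
Context d (Om : measurableType d) (R : realType) (P : probability Om R).
Variables (T W : Om -> R).
Hypothesis expT : std_exponential P T.
Hypothesis mW : measurable_fun setT W.
Hypothesis W0 : forall w, (0 <= W w)%R.
Hypothesis iW : \int[P]_w (W w)%:E < +oo.

Definition cdfR (x : R) : R := fine (P [set w | (W w <= x)%R]).
Definition mean_max (x : R) : R := fine (\int[P]_w (Num.max (W w) x)%:E).
(** This is [exp (- E (W - x)^+)], the value expected for the probability that [W_i <= x + Gamma_i]
    for all [i]. *)
Definition mean_excess (x : R) : R := expR (x - mean_max x).

Let mT : measurable_fun setT T. Proof. by case: expT. Qed.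

Lemma cdfRE x : P [set w | (W w <= x)%R] = (cdfR x)%:E.
Proof. by rewrite fineK// fin_num_measure//; exact: measurable_set_le. Qed.

Lemma cdfR01 x : (0 <= cdfR x <= 1)%R.
Proof.
by rewrite -!lee_fin -cdfRE measure_ge0 probability_le1//; exact: measurable_set_le.
Qed.

Lemma cdfR_nd : {homo cdfR : x y / (x <= y)%R}.
Proof.
move=> x y xy; rewrite -lee_fin -!cdfRE le_measure ?inE//;
  try exact: measurable_set_le.
by move=> w /= /le_trans; exact.
Qed.

Let mmax x : measurable_fun setT (fun w => (Num.max (W w) x)%:E).
Proof. by apply/measurable_EFinP; apply: measurable_maxr. Qed.

Let max0 x w : 0 <= (Num.max (W w) x)%:E.
Proof. by rewrite lee_fin le_max W0. Qed.

Lemma mean_maxE x : \int[P]_w (Num.max (W w) x)%:E = (mean_max x)%:E.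
Proof.
rewrite fineK// ge0_fin_numE ?integral_ge0//.
apply: (@le_lt_trans _ _ (\int[P]_w ((W w)%:E + (`|x|)%:E))).
  apply: ge0_le_integral => //.
  - by apply: emeasurable_funD => //; exact/measurable_EFinP.
  - move=> w _; rewrite -EFinD lee_fin ge_max lerDl normr_ge0/=.
    by rewrite (le_trans (ler_norm x))// lerDr.
rewrite ge0_integralD//.
- by rewrite integral_cst//= probability_setT mule1 lte_add_pinfty// ltry.
- by move=> w _; rewrite lee_fin.
- exact/measurable_EFinP.
Qed.

Let cst_int (c : R) : \int[P]_w c%:E = c%:E.
Proof. by rewrite integral_cst//= probability_setT mule1. Qed.

Lemma le_mean_max x : (x <= mean_max x)%R.
Proof.
have [x0|x0] := leP 0%R x; last first.
  by apply: (le_trans (ltW x0)); rewrite -lee_fin -mean_maxE integral_ge0.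
rewrite -lee_fin -mean_maxE -[leLHS]cst_int; apply: ge0_le_integral => //.
by move=> w _; rewrite lee_fin le_max lexx orbT.
Qed.

Let int_indic (h : R) x : (0 <= h)%R ->
  \int[P]_w (h * \1_([set w | (W w <= x)%R]) w)%:E = (h * cdfR x)%:E.
Proof.
move=> h0; have mA := measurable_set_le mW x.
under eq_integral do rewrite EFinM.
rewrite ge0_integralZl_EFin//.
- by rewrite integral_indic//= setIT cdfRE.
- by apply/measurable_EFinP; exact: measurable_indic.
Qed.

(** Increment form of [K' = F] for [K x = E max(W, x)]. Raising [x] to [y] raises the maximum by the
    full [y - x] where [W <= x], and not at all where [y < W]. *)
Lemma mean_max_increment x y : (x <= y)%R ->
  ((y - x) * cdfR x <= mean_max y - mean_max x <= (y - x) * cdfR y)%R.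
Proof.
move=> xy; have h0 : (0 <= y - x)%R by rewrite subr_ge0.
have mI z : measurable_fun setT
    (fun w => ((y - x) * \1_([set w | (W w <= z)%R]) w)%:E).
  apply/measurable_EFinP; apply: measurable_funM => //.
  by apply: measurable_indic; exact: measurable_set_le.
have I0 z w : 0 <= ((y - x) * \1_([set w | (W w <= z)%R]) w)%:E.
  by rewrite lee_fin mulr_ge0.
rewrite lerBrDr lerBlDr.
rewrite -!lee_fin !EFinD -!mean_maxE -!int_indic// -!ge0_integralD//.
apply/andP; split; apply: ge0_le_integral => //; try exact: emeasurable_funD.
- by move=> w _; rewrite adde_ge0.
- move=> w _; rewrite -EFinD lee_fin indicE.
  have -> : (w \in [set w | (W w <= x)%R]) = (W w <= x)%R.
    by apply/idP/idP; rewrite inE.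
  by rewrite !maxEle; case: (leP (W w) x) => ?; case: (leP (W w) y) => ? /=; rewrite ?mulr1 ?mulr0; lra.
- move=> w _; rewrite -EFinD lee_fin indicE.
  have -> : (w \in [set w | (W w <= y)%R]) = (W w <= y)%R.
    by apply/idP/idP; rewrite inE.
  by rewrite !maxEle; case: (leP (W w) x) => ?; case: (leP (W w) y) => ? /=; rewrite ?mulr1 ?mulr0; lra.
Qed.

Lemma mean_excess_nd : {homo mean_excess : x y / (x <= y)%R}.
Proof.
move=> x y xy; rewrite ler_expR.
have /andP[_ H] := mean_max_increment xy.
have /andP[c0 c1] := cdfR01 y.
have : ((y - x) * cdfR y <= (y - x) * 1)%R by rewrite ler_wpM2l// subr_ge0.
lra.
Qed.

Lemma mean_excess01 x : (0 <= mean_excess x <= 1)%R.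
Proof. by rewrite expR_ge0 -expR0 ler_expR subr_le0 le_mean_max. Qed.

Let psi (x : R) : R := (cdfR x * mean_excess x)%R.

Let psi_nd : {homo psi : x y / (x <= y)%R}.
Proof.
move=> x y xy; have := cdfR01 x; have := mean_excess01 x => /andP[? ?] /andP[? ?].
by apply: ler_pM => //; [exact: cdfR_nd|exact: mean_excess_nd].
Qed.

Let psi01 x : (0 <= psi x <= 1)%R.
Proof.
have := cdfR01 x; have := mean_excess01 x => /andP[? ?] /andP[? ?].
by rewrite mulr_ge0//= mulr_ile1.
Qed.

Let psi0 x : (0 <= psi x)%R. Proof. by have /andP[] := psi01 x. Qed.

Let mpsi : measurable_fun setT psi.
Proof. exact: nondecreasing_measurable. Qed.

Let mpsiT x : measurable_fun setT (fun w => (psi (x + T w))%:E).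
Proof.
apply/measurable_EFinP; apply: (measurableT_comp mpsi).
exact: measurable_funD.
Qed.

Let q (x : R) : R := fine (\int[P]_w (psi (x + T w))%:E).

Let qE x : \int[P]_w (psi (x + T w))%:E = (q x)%:E.
Proof.
rewrite fineK// ge0_fin_numE ?integral_ge0//; last by move=> w _; rewrite lee_fin.
apply: (@le_lt_trans _ _ (\int[P]_w 1%:E)); last by rewrite cst_int ltry.
by apply: ge0_le_integral => // w _; rewrite lee_fin//; have /andP[] := psi01 (x + T w).
Qed.

Let q01 x : (0 <= q x <= 1)%R.
Proof.
rewrite -!lee_fin -qE integral_ge0/=; last by move=> w _; rewrite lee_fin.
rewrite -[leRHS]cst_int.
by apply: ge0_le_integral => // w _; rewrite lee_fin//; have /andP[] := psi01 (x + T w).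
Qed.

Lemma exponential_null : P [set w | (T w <= 0)%R] = 0.
Proof. by case: expT => _ ->; rewrite lexx oppr0 expR0 subrr. Qed.

Lemma exponential_interval h : (0 <= h)%R ->
  P [set w | (0 < T w <= h)%R] = (1 - expR (- h))%:E.
Proof.
move=> h0.
rewrite (_ : mkset _ = [set w | (T w <= h)%R] `\` [set w | (T w <= 0)%R]); last first.
  apply/seteqP; split => w /=; first by move=> /andP[? ?]; split => //; apply/negP; rewrite -ltNge.
  by move=> [? /negP]; rewrite -ltNge => ?; apply/andP.
rewrite measureD//; last 3 first.
- exact: measurable_set_le.
- exact: measurable_set_le.
- by rewrite -ge0_fin_numE ?fin_num_measure//; exact: measurable_set_le.
rewrite (_ : _ `&` _ = [set w | (T w <= 0)%R]); last first.
  by apply/seteqP; split => w /=; [case|move=> w0; split => //; exact: le_trans w0 h0].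
by rewrite /= exponential_null sube0; case: expT => _ ->; rewrite h0.
Qed.

(** The event [h < T] contributes exactly [exp (- h) * q y] by lack of memory. On [0 < T <= h] the
    argument [x + T] lies between [x] and [y], and [psi] is monotone. *)
Let q_increment x y : (x <= y)%R ->
  (psi x * (1 - expR (- (y - x))) <= q x - expR (- (y - x)) * q y
       <= psi y * (1 - expR (- (y - x))))%R.
Proof.
move=> xy; set h := (y - x)%R; have h0 : (0 <= h)%R by rewrite subr_ge0.
pose S := [set w | (0 < T w <= h)%R].
have mS : measurable S.
  rewrite (_ : S = [set w | (0 < T w)%R] `&` [set w | (T w <= h)%R]).
    by apply: measurableI; [exact: measurable_set_gt|exact: measurable_set_le].
  by apply/seteqP; split => w /=; [move/andP|case=> *; apply/andP].
have mG : measurable [set w | (h < T w)%R] by exact: measurable_set_gt.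
have qd : (q x)%:E = \int[P]_(w in S) (psi (x + T w))%:E + (expR (- h) * q y)%:E.
  rewrite -qE (@ge0_negligible_integral _ _ _ _ _ [set w | (T w <= 0)%R])//; last 3 first.
  - exact: measurable_set_le.
  - by move=> w _; rewrite lee_fin.
  - exact: exponential_null.
  rewrite (_ : _ `\` _ = S `|` [set w | (h < T w)%R]); last first.
    apply/seteqP; split => w /=.
      move=> [_ /negP]; rewrite -ltNge => T0.
      by have [?|?] := leP (T w) h; [left; apply/andP|right].
    move=> [/andP[T0 _]|T0]; split => //; apply/negP; rewrite -ltNge//.
    exact: le_lt_trans T0.
  rewrite ge0_integral_setU//; last 3 first.
  - exact: measurable_funS (mpsiT x).
  - by move=> w _; rewrite lee_fin.
  - apply/disj_set2P/seteqP; split => // w [/= /andP[_ H1] H2].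
    by move: (lt_le_trans H2 H1); rewrite ltxx.
  congr (_ + _).
  have mpsiy : measurable_fun setT (fun s => (psi (y + s))%:E).
    by apply/measurable_EFinP; apply: (measurableT_comp mpsi); exact: measurable_funD.
  have psiy0 s : 0 <= (psi (y + s))%:E by rewrite lee_fin.
  transitivity (\int[P]_(w in [set w | (h < T w)%R]) (psi (y + (T w - h)))%:E).
    by apply: eq_integral => w _; congr (psi _)%:E; rewrite /h; ring.
  by rewrite (memoryless_integral expT mpsiy psiy0 h0) (qE y).
have cS c : \int[P]_(w in S) (c)%:E = (c * (1 - expR (- h)))%:E.
  by rewrite integral_cst//= exponential_interval// -EFinM.
have hr : (q x - expR (- h) * q y)%:E = \int[P]_(w in S) (psi (x + T w))%:E.
  by rewrite EFinB qd addeK.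
rewrite -!lee_fin hr -!cS; apply/andP; split; apply: ge0_le_integral => //.
- by move=> w _; rewrite lee_fin.
- exact: measurable_funS (mpsiT x).
- by move=> w /= /andP[T0 Th]; rewrite lee_fin; apply: psi_nd; rewrite lerDl ltW.
- by move=> w _; rewrite lee_fin.
- exact: measurable_funS (mpsiT x).
- move=> w /= /andP[T0 Th]; rewrite lee_fin; apply: psi_nd.
  by rewrite -lerBrDl.
Qed.

Lemma renewal_identity x :
  \int[P]_w (cdfR (x + T w) * mean_excess (x + T w))%:E = (mean_excess x)%:E.
Proof.
rewrite -/(psi _) qE; congr EFin.
apply: (@renewal_unique R cdfR mean_max) => //.
- exact: cdfR01.
- exact: cdfR_nd.
- exact: le_mean_max.
- exact: mean_max_increment.
Qed.

End renewal.

(** * Independence from the sigma-algebra of the past *)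

Section independence.
Context d (Om : measurableType d) (R : realType) (P : probability Om R).
Context (I : eqType) (F : I -> set (set Om)).
Hypothesis saF : forall i, sigma_algebra setT (F i).
Hypothesis mF : forall i, F i `<=` measurable.
Hypothesis indF : mutually_independent P F.

Definition past_boxes (J : seq I) : set (set Om) :=
  [set B | exists2 A : I -> set Om, (forall i, F i (A i)) &
    B = \bigcap_(i in [set i | i \in J]) A i].

Let FT i : F i setT.
Proof. by have [F0 FC _] := saF i; rewrite -[setT]setD0; exact: FC. Qed.

Let FI i A B : F i A -> F i B -> F i (A `&` B).
Proof.
have E : <<s F i>> = F i by apply: smallest_id; exact: saF.
by rewrite -E; exact: (@measurableI _ (g_sigma_algebraType (F i)) A B).
Qed.

Lemma sub_past_boxes J i : i \in J -> F i `<=` past_boxes J.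
Proof.
move=> iJ A FA; exists (fun j => if j == i then A else setT).
  by move=> j; case: eqP => [->|_].
apply/seteqP; split => [w Aw j jJ|w]; first by case: eqP.
by move=> /(_ i iJ); rewrite eqxx.
Qed.

Lemma past_boxes_measurable J : past_boxes J `<=` measurable.
Proof.
move=> _ [A FA ->]; apply: fin_bigcap_measurable => //.
by move=> i _; exact: mF (FA i).
Qed.

Lemma past_measurable J : <<s past_boxes J>> `<=` measurable.
Proof.
apply: smallest_sub; first exact: sigma_algebra_measurable.
exact: past_boxes_measurable.
Qed.

(** [mutually_independent] only speaks of one event per index. Intersections of such events form a
    pi-system, on which the restriction of [P] to [D] agrees with the multiple [P D] of [P];
    uniqueness of finite measures does the rest. *)
Lemma past_indep J k A D : uniq (k :: J) -> <<s past_boxes J>> A -> F k D ->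
  P (A `&` D) = P A * P D.
Proof.
move=> uJ sA FD; have mD : measurable D by exact: mF FD.
have e0 : (0 <= fine (P D))%R by exact: fine_ge0.
pose e : {nonneg R} := NngNum e0.
have PDE : P D = (fine (P D))%:E by rewrite fineK// fin_num_measure.
suff : mrestr P mD A = mscale e P A.
  by rewrite /mrestr/mscale/= muleC -PDE.
apply: (@g_sigma_algebra_measure_unique _ _ _ (past_boxes J) _ (fun=> setT)) sA.
- exact: past_boxes_measurable.
- move=> _; exists (fun=> setT) => //.
  by apply/seteqP; split.
- by apply/seteqP; split => // w _; exists 0%N.
- move=> B C [B' FB ->] [C' FC ->]; exists (fun i => B' i `&` C' i).
    by move=> i; exact: FI.
  by rewrite bigcapI.
- move=> B [B' FB ->]; rewrite /= /mrestr/mscale/=.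
  have kJ : k \notin J by move: uJ => /andP[].
  pose A' i := if i == k then D else B' i.
  have FA' i : F i (A' i) by rewrite /A'; case: eqP => [->|].
  have mB : measurable (\bigcap_(i in [set i | i \in J]) B' i).
    by apply: past_boxes_measurable; exists B'.
  rewrite -[LHS]fineK; last by rewrite fin_num_measure//; exact: measurableI.
  rewrite -[P (\bigcap_(i in _) _)]fineK ?fin_num_measure// -EFinM; congr EFin.
  rewrite (indF _ (fun i _ => FB i)); last by move: uJ => /andP[].
  transitivity (\prod_(i <- k :: J) fine (P (A' i)))%R.
    rewrite -(indF uJ (fun i _ => FA' i)); congr (fine (P _)).
    apply/seteqP; split => w /=.
      move=> [Bw Dw] i /=; rewrite inE /A' => /orP[/eqP ->|iJ]; first by rewrite eqxx.
      by case: eqP => // _; exact: Bw.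
    move=> Aw; split.
      move=> i /= iJ; have := Aw i; rewrite /= inE iJ orbT /A' => /(_ erefl).
      by case: eqP => // ik; move: kJ; rewrite -ik iJ.
    by have := Aw k; rewrite /= inE eqxx /A' => /(_ erefl); rewrite eqxx.
  rewrite big_cons {1}/A' eqxx; congr (_ * _)%R.
  apply: eq_big_seq => i iJ; rewrite /A'; case: eqP => // ik.
  by move: kJ; rewrite -ik iJ.
- by move=> _; rewrite /= /mrestr; apply: le_lt_trans (probability_le1 _ _) (ltry _);
    exact: measurableI.
Qed.

End independence.

(** * The probability that all W_i lie below the Poisson points *)

Section lepage.
Context d (Om : measurableType d) (R : realType) (P : probability Om R).
Context (F : nat + nat -> set (set Om)).
Hypothesis saF : forall i, sigma_algebra setT (F i).
Hypothesis mF : forall i, F i `<=` measurable.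
Hypothesis indF : mutually_independent P F.
Variables (T W : nat -> Om -> R).
Hypothesis expT : forall i, std_exponential P (T i).
Hypothesis FT : forall i B, measurable B -> F (inl i) (T i @^-1` B).
Hypothesis FW : forall i B, measurable B -> F (inr i) (W i @^-1` B).
Hypothesis W0 : forall i w, (0 <= W i w)%R.
Hypothesis lawW : forall i x,
  P [set w | (W i w <= x)%R] = P [set w | (W 0%N w <= x)%R].
Hypothesis iW : \int[P]_w (W 0%N w)%:E < +oo.

Let S n (w : Om) : R := (\sum_(j < n) T j w)%R.
Let past n : seq (nat + nat) :=
  [seq inl i | i <- iota 0 n] ++ [seq inr i | i <- iota 0 n].

Let inl_past n i : (inl i \in past n) = (i < n)%N.
Proof.
rewrite mem_cat mem_map ?mem_iota//; last by move=> ? ? [].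
by rewrite add0n/= orbC (_ : (_ \in _) = false)//; apply/negP => /mapP[].
Qed.

Let inr_past n i : (inr i \in past n) = (i < n)%N.
Proof.
rewrite mem_cat [X in _ || X]mem_map ?mem_iota//; last by move=> ? ? [].
by rewrite add0n/= (_ : (_ \in _) = false)//; apply/negP => /mapP[].
Qed.

Let uniq_past n : uniq (past n).
Proof.
rewrite cat_uniq !map_inj_uniq ?iota_uniq ?andbT//=; try by move=> ? ? [].
by apply/hasPn => _ /mapP[i _ ->]; apply/negP => /mapP[].
Qed.

Let mT i : measurable_fun setT (T i).
Proof. by move=> _ B mB; rewrite setTI; apply: mF (FT _ mB). Qed.

Let mW i : measurable_fun setT (W i).
Proof. by move=> _ B mB; rewrite setTI; apply: mF (FW _ mB). Qed.

Let G := mean_excess P (W 0%N).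
Let cW := cdfR P (W 0%N).

(** [S i.+1] is [poisson_points T i], so the [A n] decrease to the event of [lepage_probability]. *)
Let A n : set Om := [set w | forall i, (i < n)%N -> (W i w <= S i.+1 w)%R].

Let Sig (J : seq (nat + nat)) := g_sigma_algebraType (past_boxes F J).

Let SigT J i : inl i \in J -> measurable_fun setT (T i : Sig J -> R).
Proof.
move=> iJ _ B mB; rewrite setTI; apply: sub_sigma_algebra.
exact: (sub_past_boxes saF iJ (FT _ mB)).
Qed.

Let SigW J i : inr i \in J -> measurable_fun setT (W i : Sig J -> R).
Proof.
move=> iJ _ B mB; rewrite setTI; apply: sub_sigma_algebra.
exact: (sub_past_boxes saF iJ (FW _ mB)).
Qed.

Let SigS J n : {subset [seq inl i | i <- iota 0 n] <= J} ->
  measurable_fun setT (S n : Sig J -> R).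
Proof.
move=> sJ; apply: (@measurable_sum _ (Sig J)) => i; apply: SigT; apply: sJ.
by apply/mapP; exists (i : nat) => //; rewrite mem_iota/=.
Qed.

Let SigA J n : {subset past n <= J} -> @measurable _ (Sig J) (A n).
Proof.
move=> sJ.
rewrite (_ : A n = \bigcap_(i in [set i | (i < n)%N])
   [set w | (W i w <= S i.+1 w)%R]); last by apply/seteqP; split => w Aw i; exact: Aw.
apply: fin_bigcap_measurable; first exact: finite_II.
move=> i /= iN.
have mWi : measurable_fun setT (W i : Sig J -> R).
  by apply: SigW; apply: sJ; rewrite inr_past.
have mSi : measurable_fun setT (S i.+1 : Sig J -> R).
  apply: SigS => _ /mapP[j + ->]; rewrite mem_iota/= add0n => ji.
  by apply: sJ; rewrite inl_past (leq_trans ji).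
have := measurable_fun_ler mWi mSi measurableT (Y := [set true]).
rewrite setTI => /(_ Logic.I); congr measurable.
Qed.

Let mA n : measurable (A n).
Proof. exact: past_measurable mF _ _ (@SigA (past n) n _). Qed.

Let mS n : measurable_fun setT (S n).
Proof. by apply: measurable_sum => i. Qed.

Let G_nd : {homo G : x y / (x <= y)%R}.
Proof. exact: mean_excess_nd. Qed.

Let mG : measurable_fun setT G.
Proof. exact: nondecreasing_measurable. Qed.

Let G01 x : (0 <= G x <= 1)%R.
Proof. exact: mean_excess01. Qed.

Let G0 x : (0 <= G x)%R. Proof. by have /andP[] := G01 x. Qed.

Let mc : measurable_fun setT cW.
Proof. by apply: nondecreasing_measurable => //; exact: cdfR_nd. Qed.

Let c0 x : (0 <= cW x)%R. Proof. by have /andP[] := cdfR01 P (mW 0%N) x. Qed.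

(** [A n] and [V] belong to the past [J] and [k] is a fresh index; this is the factorisation that
    [indep_integral] asks for. *)
Let box_indep J k n (Z : Om -> R) (V : Om -> R) : uniq (k :: J) ->
  {subset past n <= J} -> measurable_fun setT (V : Sig J -> R) ->
  (forall B, measurable B -> F k (Z @^-1` B)) ->
  forall B C, measurable B -> measurable C ->
     P (A n `&` V @^-1` B `&` Z @^-1` C) = P (A n `&` V @^-1` B) * P (Z @^-1` C).
Proof.
move=> uJ sJ mV FZ B C mB mC.
apply: (past_indep saF mF indF uJ) => //; last exact: FZ.
apply: (@measurableI _ (Sig J)); first exact: SigA.
by rewrite -[X in measurable X]setTI; exact: mV.
Qed.

(** Integrate out [W n], which is independent of [A n] and [S n.+1]: the added constraint
    [W n <= S n.+1] becomes the factor [cW (S n.+1)]. *)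
Let stepW n : \int[P]_(w in A n.+1) (G (S n.+1 w))%:E =
  \int[P]_(w in A n) (cW (S n.+1 w) * G (S n.+1 w))%:E.
Proof.
pose h (x : R * R) : \bar R := (\1_([set y : R * R | (y.2 <= y.1)%R]) x * G x.1)%:E.
have mD : measurable [set y : R * R | (y.2 <= y.1)%R].
  have ml : measurable_fun setT (fun y : R * R => (y.2 <= y.1)%R).
    by apply: measurable_fun_ler; [exact: measurable_snd|exact: measurable_fst].
  by have := ml measurableT [set true] Logic.I; rewrite setTI.
have mh : measurable_fun setT h.
  apply/measurable_EFinP; apply: measurable_funM; first exact: measurable_indic.
  by apply: measurableT_comp mG _; exact: measurable_fst.
have h0 x : 0 <= h x by rewrite lee_fin mulr_ge0.
transitivity (\int[P]_(w in A n) h (S n.+1 w, W n w)).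
  rewrite (_ : A n.+1 = A n `&` [set w | (W n w <= S n.+1 w)%R]); last first.
    apply/seteqP; split => w.
      by move=> Aw; split; [move=> i iN; apply: Aw; exact: leqW|exact: Aw].
    move=> [Aw Wn] i; rewrite ltnS leq_eqVlt => /orP[/eqP ->//|]; exact: Aw.
  rewrite integral_mkcondr; apply: eq_integral => w _.
  rewrite /h patchE indicE/=.
  have -> : ((S n.+1 w, W n w) \in [set y : R * R | (y.2 <= y.1)%R]) =
     (w \in [set w | (W n w <= S n.+1 w)%R]) by apply/idP/idP; rewrite !inE.
  by case: ifP; rewrite ?mul1r ?mul0r.
rewrite (indep_integral (mA n) (mS n.+1) (mW n) _ mh h0); last first.
  apply: (@box_indep (inl n :: past n) (inr n)).
  - by rewrite /= inE/= inr_past ltnn inl_past ltnn uniq_past.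
  - by move=> i ip; rewrite inE ip orbT.
  - apply: SigS => _ /mapP[j + ->]; rewrite mem_iota/= add0n ltnS leq_eqVlt => /orP[/eqP ->|ji].
      by rewrite inE eqxx.
    by rewrite inE inl_past ji orbT.
  - by move=> B mB; exact: FW.
apply: eq_integral => w _; rewrite /h/=.
under eq_integral do rewrite mulrC EFinM.
rewrite ge0_integralZl_EFin//; last first.
- have mi : measurable_fun setT (\1_[set y : R * R | (y.2 <= y.1)%R] : R * R -> R).
    exact: measurable_indic.
  apply/measurable_EFinP; apply: (measurableT_comp mi).
  exact: measurable_fun_pair.
- rewrite mulrC EFinM; congr (_ * _).
  rewrite /cW -(cdfRE P (mW 0%N)) -(lawW n) -[X in P X]setIT -integral_indic//.
  exact: measurable_set_le.
Qed.

(** Integrate out [T n] in [S n.+1 = S n + T n]; what remains is [renewal_identity] at [S n w]. *)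
Let stepT n : \int[P]_(w in A n) (cW (S n.+1 w) * G (S n.+1 w))%:E =
  \int[P]_(w in A n) (G (S n w))%:E.
Proof.
pose h (x : R * R) : \bar R := (cW (x.1 + x.2) * G (x.1 + x.2))%:E.
have mD : measurable_fun setT (fun x : R * R => (x.1 + x.2)%R).
  by apply: measurable_funD; [exact: measurable_fst|exact: measurable_snd].
have mh : measurable_fun setT h.
  apply/measurable_EFinP; apply: measurable_funM.
    exact: measurableT_comp mc mD.
  exact: measurableT_comp mG mD.
have h0 x : 0 <= h x by rewrite lee_fin mulr_ge0.
transitivity (\int[P]_(w in A n) h (S n w, T n w)).
  by apply: eq_integral => w _; rewrite /h/= /S big_ord_recr.
rewrite (indep_integral (mA n) (mS n) (mT n) _ mh h0); last first.
  apply: (@box_indep (past n) (inl n)) => //.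
  - by rewrite /= inl_past ltnn uniq_past.
  - by apply: SigS => i ip; rewrite mem_cat ip.
  - by move=> B mB; exact: FT.
apply: eq_integral => w _; rewrite /h/=.
exact: (renewal_identity (expT n) (mW 0%N) (W0 0%N) iW).
Qed.

Let martingale n :
  \int[P]_(w in A n) (G (S n w))%:E = (expR (- fine (\int[P]_w (W 0%N w)%:E)))%:E.
Proof.
elim: n => [|n IH]; last by rewrite stepW stepT.
rewrite (_ : A 0%N = setT); last by apply/seteqP; split.
rewrite (eq_integral (fun=> (G 0)%:E)); last by move=> w _; rewrite /S big_ord0.
rewrite integral_cst//= probability_setT mule1 /G /mean_excess sub0r.
congr (expR (- fine _))%:E; apply: eq_integral => w _.
by congr EFin; apply/max_idPl.
Qed.

Let null_neg : P (\bigcup_j [set w | (T j w <= 0)%R]) = 0.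
Proof.
apply/eqP; rewrite eq_le measure_ge0 andbT.
apply: (@le_trans _ _ (\sum_(j <oo) P [set w | (T j w <= 0)%R])).
  apply: measure_sigma_subadditive => //.
    - by move=> j; exact: measurable_set_le.
  - by apply: bigcup_measurable => j _; exact: measurable_set_le.
by rewrite eseries0// => j _ _; exact: exponential_null.
Qed.

(** Up to a null set the [T i] are positive, so [S n <= x] forces each of its [n] terms below [x].
    This crude bound suffices for [S n] to tend to infinity in probability. *)
Let P_S_le n (x : R) : (0 <= x)%R ->
  P [set w | (S n w <= x)%R] <= ((1 - expR (- x)) ^+ n)%:E.
Proof.
move=> x0; pose N := \bigcup_j [set w | (T j w <= 0)%R].
have mN : measurable N by apply: bigcup_measurable => j _; exact: measurable_set_le.
pose J := [seq inl i | i <- iota 0 n] : seq (nat + nat).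
pose B (k : nat + nat) := match k with inl i => [set w | (T i w <= x)%R] | inr _ => setT end.
have FB k : F k (B k).
  case: k => [i|i] /=.
    rewrite (_ : mkset _ = T i @^-1` `]-oo, x]%classic); first exact: FT.
    by apply/seteqP; split => w /=; rewrite in_itv.
  by have := FW i measurableT; rewrite preimage_setT.
have mB k : measurable (B k) by exact: mF (FB k).
have mI : measurable (\bigcap_(i in [set i | i \in J]) B i).
  by apply: fin_bigcap_measurable => // i _.
apply: (@le_trans _ _ (P (N `|` \bigcap_(i in [set i | i \in J]) B i))).
  apply: le_measure; rewrite ?inE.
  - exact: measurable_set_le.
  - exact: measurableU.
  - move=> w /= Sx; have [Nw|Nw] := pselect (N w); first by left.
    right => k /= /mapP[i]; rewrite mem_iota/= add0n => iN ->/=.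
    have T0 j : (0 < T j w)%R.
      by rewrite ltNge; apply/negP => Tj; apply: Nw; exists j.
    apply: le_trans Sx; rewrite /S (bigD1 (Ordinal iN))//= lerDl sumr_ge0// => j _.
    exact: ltW.
apply: le_trans (measureU2 _ _ _) _ => //.
rewrite /= /N null_neg add0e -[leLHS]fineK ?fin_num_measure// lee_fin.
rewrite (indF (A := B)); last 2 first.
- by rewrite map_inj_uniq ?iota_uniq// => ? ? [].
- by move=> i _.
rewrite big_map/= (eq_bigr (fun=> (1 - expR (- x))%R)); last first.
  by move=> i _; have [_ ->] := expT i; rewrite x0.
by rewrite big_const_seq count_predT size_iota iter_mulr mulr1.
Qed.

(** As [max(W, k) + min(W, k) = W + k], the exponent [k - E max(W, k)] equals [E min(W, k) - E W],
    which tends to 0 by monotone convergence. *)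
Let G_cvg1 (e : R) : (0 < e)%R -> exists2 x, (0 <= x)%R & (1 - e <= G x)%R.
Proof.
move=> e0.
pose f k w := (Num.min (W 0%N w) k%:R)%:E.
have mf k : measurable_fun setT (f k).
  by apply/measurable_EFinP; apply: measurable_minr.
have f0 k w : 0 <= f k w by rewrite lee_fin le_min W0/=.
have cv : (fun k => \int[P]_w f k w) @ \oo --> \int[P]_w (W 0%N w)%:E.
  rewrite (eq_integral (fun w => limn (f ^~ w))).
    apply: cvg_monotone_convergence => //.
    move=> w _ a b ab; rewrite lee_fin le_min ge_min lexx/=.
    by rewrite ge_min ler_nat ab orbT.
  move=> w _; apply/esym/cvg_lim => //; apply: cvg_near_cst.
  exists (Num.truncn (W 0%N w)).+1 => //= k /= hk; rewrite /f; congr EFin.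
  apply/min_idPl; apply: ltW; apply: lt_le_trans (truncnS_gt _) _.
  by rewrite ler_nat.
have fW : \int[P]_w (W 0%N w)%:E \is a fin_num.
  by rewrite ge0_fin_numE ?integral_ge0// => w _; rewrite lee_fin.
have [k Hk] : exists k, \int[P]_w (W 0%N w)%:E - e%:E < \int[P]_w f k w.
  have lt0 : \int[P]_w (W 0%N w)%:E - e%:E < \int[P]_w (W 0%N w)%:E.
    by rewrite -(fineK fW) -EFinB lte_fin; lra.
  apply: contrapT => /forallNP nH; move: lt0; apply/negP; rewrite -leNgt.
  have cvk := cvg_lim (@ereal_hausdorff R) cv.
  rewrite -[leLHS]cvk; apply: lime_le; first by apply/cvg_ex; eexists; exact: cv.
  by apply: nearW => k; rewrite leNgt; apply/negP; exact: nH.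
exists k%:R => //.
rewrite /G /mean_excess.
apply: le_trans (expR_ge1Dx _).
have fk : \int[P]_w f k w \is a fin_num.
  rewrite ge0_fin_numE ?integral_ge0//; apply: le_lt_trans iW.
  apply: ge0_le_integral => //; first by apply/measurable_EFinP.
  by move=> w _; rewrite lee_fin ge_min lexx.
have : (mean_max P (W 0%N) k%:R)%:E + \int[P]_w f k w = k%:R%:E + \int[P]_w (W 0%N w)%:E.
  rewrite -(mean_maxE (mW 0%N) (W0 0%N) iW) -ge0_integralD//; last 2 first.
  - by move=> w _; rewrite lee_fin le_max W0.
  - by apply/measurable_EFinP; apply: measurable_maxr.
  have <- : \int[P]_w (k%:R)%:E = k%:R%:E by rewrite integral_cst//= probability_setT mule1.
  rewrite -ge0_integralD//; try by [apply/measurable_EFinP|move=> w _; rewrite lee_fin].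
  apply: eq_integral => w _; rewrite -!EFinD; congr EFin.
  by rewrite addr_max_min addrC.
move: Hk; rewrite -(fineK fk) -(fineK fW) -EFinB lte_fin -!EFinD => H [] H2.
lra.
Qed.

Theorem lepage_probability :
  P [set w | forall i, (W i w <= poisson_points T i w)%R] =
  (expR (- fine (\int[P]_w (W 0%N w)%:E)))%:E.
Proof.
rewrite (_ : mkset _ = \bigcap_n A n); last first.
  apply/seteqP; split => w; first by move=> Aw n _ i _; exact: Aw.
  by move=> Aw i; exact: (Aw i.+1 Logic.I i (leqnn _)).
have cvA : P (A n) @[n --> \oo] --> P (\bigcap_n A n).
  apply: nonincreasing_cvg_mu.
  - by rewrite (le_lt_trans (probability_le1 _ _))// ltry.
  - by [].
  - by apply: bigcapT_measurable.
  - move=> a b ab; apply/subsetPset => w Aw i ia.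
    by apply: Aw; exact: leq_trans ab.
set g := expR _.
suff : (fun n => P (A n)) @ \oo --> g%:E by move=> /(cvg_unique _ cvA) ->.
(* The constant martingale value [g] bounds [P (A n)] from below because [G <= 1]. It bounds it from
   above up to [1 - G x] plus the probability of [S n <= x], because [G] is non-decreasing. *)
have up n : g%:E <= P (A n).
  rewrite -(martingale n) -[leRHS]mul1e -integral_cst//.
  apply: ge0_le_integral => //.
  - by move=> w _; rewrite lee_fin.
  - by apply/measurable_EFinP; apply: measurable_funTS; exact: measurableT_comp.
  - by move=> w _; rewrite lee_fin; have /andP[] := G01 (S n w).
have lo n x : (0 <= x)%R -> P (A n) <= g%:E + (1 - G x + (1 - expR (- x)) ^+ n)%:E.
  move=> x0.
  apply: (@le_trans _ _ (\int[P]_(w in A n) ((G (S n w))%:E +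
       ((1 - G x)%:E + (\1_[set w | (S n w <= x)%R] w)%:E)))).
    rewrite -[leLHS]mul1e -integral_cst//; apply: ge0_le_integral => //.
    - apply: measurable_funTS; apply: emeasurable_funD.
        by apply/measurable_EFinP; exact: measurableT_comp.
      apply: emeasurable_funD => //; apply/measurable_EFinP; apply: measurable_indic.
      exact: measurable_set_le.
    - move=> w _; rewrite -!EFinD lee_fin indicE.
      have -> : (w \in [set w | (S n w <= x)%R]) = (S n w <= x)%R.
        by apply/idP/idP; rewrite inE.
      have /andP[? ?] := G01 x.
      have H0 := G0 (S n w).
      by case: (leP (S n w) x) => [_|/ltW /G_nd] /=; rewrite ?mulr1n ?mulr0n; lra.
  have mI : measurable_fun setT (fun w => (\1_[set w | (S n w <= x)%R] w)%:E : \bar R).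
    by apply/measurable_EFinP; apply: measurable_indic; exact: measurable_set_le.
  have G1x : (0 <= 1 - G x)%R by have /andP[_] := G01 x; lra.
  rewrite ge0_integralD//; last 4 first.
  - by move=> w _; rewrite lee_fin.
  - by apply: measurable_funTS; apply/measurable_EFinP; exact: measurableT_comp.
  - by move=> w _; rewrite -EFinD lee_fin addr_ge0.
  - by apply: measurable_funTS; apply: emeasurable_funD.
  rewrite martingale leeD2l//.
  rewrite ge0_integralD//; last first.
  - by apply: measurable_funTS.
  rewrite integral_cst// integral_indic//=; last exact: measurable_set_le.
  rewrite [leRHS]EFinD; apply: leeD.
    rewrite -[leRHS]mule1; apply: lee_wpmul2l; first by rewrite lee_fin.
    exact: probability_le1.
  apply: le_trans (P_S_le n x0); apply: le_measure; rewrite ?inE; last by move=> w [].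
  - by apply: measurableI => //; exact: measurable_set_le.
  - exact: measurable_set_le.
have fA n : P (A n) = (fine (P (A n)))%:E by rewrite fineK// fin_num_measure.
under eq_fun do rewrite fA.
apply: cvg_EFin; first by near=> n.
apply/cvgrPdist_le => e e0.
have [x x0 Gx] := G_cvg1 (divr_gt0 e0 (ltr0Sn R 1)).
have cx : (fun n => (1 - expR (- x)) ^+ n)%R @ \oo --> (0%R : R).
  apply: cvg_expr; rewrite ger0_norm ?gtrBl ?expR_gt0// subr_ge0 -expR0 ler_expR.
  by rewrite oppr_le0.
move/cvgrPdist_le : cx => /(_ _ (divr_gt0 e0 (ltr0Sn R 1))); apply: filterS => n.
rewrite sub0r normrN /= => H.
have := up n; have := lo n x x0; rewrite fA -EFinD !lee_fin => H1 H2.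
have := ler_norm ((1 - expR (- x)) ^+ n)%R => H3.
by rewrite ler_norml; apply/andP; split; lra.
Unshelve. all: by end_near.
Qed.

End lepage.

(** * Independent uniform variables on the unit interval *)

Section uniform01.
Variable R : realType.

(** Kept as a probability on all of [R], so that [R] itself is the sample space of the
    construction. *)
Definition unif01 (S : set R) : \bar R := lebesgue_measure (S `&` `[0%R, 1%R[).

Let leb01 : {measure set (measurableTypeR R) -> \bar R} :=
  mrestr (@lebesgue_measure R) (measurable_itv (`[0%R, 1%R[ : interval R)).

Let unif01_0 : unif01 set0 = 0.
Proof. exact: (measure0 leb01). Qed.

Let unif01_ge0 S : 0 <= unif01 S.
Proof. exact: (measure_ge0 leb01). Qed.

Let unif01_sigma_additive : semi_sigma_additive unif01.
Proof. exact: (@measure_semi_sigma_additive _ _ _ leb01). Qed.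

HB.instance Definition _ := isMeasure.Build _ _ _ unif01
  unif01_0 unif01_ge0 unif01_sigma_additive.

Lemma unif01E (S : set R) : unif01 S = lebesgue_measure (S `&` `[0%R, 1%R[).
Proof. by []. Qed.

Let unif01_setT : unif01 setT = 1.
Proof. by rewrite unif01E setTI lebesgue_measure_itv/= lte01 oppr0 adde0. Qed.

HB.instance Definition _ :=
  Measure_isProbability.Build _ _ _ unif01 unif01_setT.

Lemma unif01_ray (t : R) :
  unif01 `]-oo, t]%classic = (Num.max 0 (Num.min t 1))%:E.
Proof.
rewrite unif01E.
have [t0|t0] := ltP t 0%R.
  rewrite (_ : _ `&` _ = set0) ?measure0.
    by rewrite max_l// ge_min ltW.
  by apply/seteqP; split => // x /= []; rewrite !in_itv/= => ? /andP[]; lra.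
have [t1|t1] := ltP t 1%R.
  rewrite (_ : _ `&` _ = `[0%R, t]%classic).
    rewrite (_ : Num.max _ _ = t); last by rewrite maxEle t0.
    rewrite lebesgue_measure_itv/= lte_fin -EFinB subr0; case: ltP => // t0'.
    by congr EFin; lra.
  apply/seteqP; split => x /=; rewrite !in_itv/=; first by move=> [? /andP[? ?]]; apply/andP.
  by move=> /andP[? ?]; split => //; apply/andP; split => //; lra.
rewrite (_ : _ `&` _ = `[0%R, 1%R[%classic).
  rewrite (_ : Num.max _ _ = 1%R); last by rewrite maxEle ler01.
  by rewrite lebesgue_measure_itv/= lte_fin ltr01 -EFinB subr0.
apply/seteqP; split => x /=; rewrite !in_itv/=; first by case.
by move=> /andP[? ?]; split => //; [lra|apply/andP].
Qed.

Lemma unif01_itv (a b : R) : (0 <= a)%R -> (a <= b)%R -> (b <= 1)%R ->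
  unif01 `[a, b[%classic = (b - a)%:E.
Proof.
move=> a0 ab b1; rewrite unif01E setIidl.
  rewrite lebesgue_measure_itv/= lte_fin -EFinB; case: ltP => // ba.
  by congr EFin; lra.
by move=> x /=; rewrite !in_itv/= => /andP[? ?]; apply/andP; split; lra.
Qed.

(** The first binary digit; [tau] is the shift of the expansion, which on [[0, 1)] is the doubling
    map. *)
Definition bit (u : R) : bool := (2^-1 <= u)%R.
Definition tau (u : R) : R := (if bit u then 2 * u - 1 else 2 * u)%R.

Lemma measurable_bit : measurable_fun setT bit.
Proof. exact: measurable_fun_ler. Qed.

Lemma measurable_set_bit b : measurable [set u | bit u = b].
Proof. exact: (@measurable_preimageT _ _ _ _ bit [set b] measurable_bit Logic.I). Qed.

Lemma measurable_tau : measurable_fun setT tau.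
Proof.
apply: measurable_fun_if => //; first exact: measurable_bit.
  by apply: measurable_funTS; apply: measurable_funB => //; exact: measurable_funM.
Qed.

(** The first digit is fair and independent of the shifted point, since [tau] maps each half of
    [[0, 1)] onto [[0, 1)] with slope 2. *)
Lemma unif01_bit_tau b S : measurable S ->
  unif01 ([set u | bit u = b] `&` tau @^-1` S) = (2^-1)%:E * unif01 S.
Proof.
move=> mS.
have h0 : (0 <= 2^-1 :> R)%R by [].
pose e : {nonneg R} := NngNum h0.
rewrite setIC; suff : image_measure (mrestr unif01 (measurable_set_bit b)) measurable_tau S =
   mscale e unif01 S by [].
move: S mS; apply: measure_eq_of_rays => t.
  rewrite /= /image_measure /pushforward /mrestr /mscale/=.
  rewrite unif01_ray unif01E -EFinM.
  pose c : R := ((if b then 2^-1 else 0) + 2^-1 * Num.max 0 (Num.min t 1))%R.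
  pose c0 : R := (if b then 2^-1 else 0)%R.
  have c0c : (c0 <= c)%R by rewrite lerDl mulr_ge0// le_max lexx.
  have cE : (c - c0 = 2^-1 * Num.max 0 (Num.min t 1))%R by rewrite /c addrAC subrr add0r.
  rewrite -cE.
  have m01 : (0 <= (Num.max 0 (Num.min t 1) : R) <= 1)%R.
    by rewrite le_max lexx/= ge_max ler01 ge_min lexx orbT.
  have hc : (0 <= c0 /\ c <= 1)%R.
    by rewrite /c /c0; case: (b); move: m01 => /andP[]; split; lra.
  have [s0|s0] := ltP t 0%R.
    rewrite (_ : _ `&` _ = set0).
      rewrite measure0 cE (_ : Num.max 0 _ = 0)%R ?mulr0//.
      by rewrite max_l// ge_min ltW.
    apply/seteqP; split => // x /=; rewrite !in_itv/= /tau /bit => -[[]].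
    by case: (leP 2^-1%R x) => /= ? ? _ /andP[]; lra.
  have mE : (Num.max 0 (Num.min t 1) = Num.min t 1)%R.
    by rewrite max_r// le_min s0 ler01.
  have [t1|t1] := ltP t 1%R.
    have cE' : c = (c0 + 2^-1 * t)%R by rewrite /c mE min_l ?ltW.
    rewrite (_ : _ `&` _ = `[c0, c]%classic).
      rewrite lebesgue_measure_itv/= lte_fin -EFinB; case: ltP => // ba.
      by congr EFin; lra.
    apply/seteqP; split => x /=; rewrite !in_itv/= cE' /tau /bit /c0.
      move=> [[+ <-]]; case: (leP 2^-1%R x) => /= ? ? /andP[? ?]; apply/andP; split; lra.
    case: (b) => /andP[? ?]; case: (leP 2^-1%R x) => /= ?; repeat split => //; try (apply/andP; split); lra.
  have cE' : c = (c0 + 2^-1)%R by rewrite /c mE min_r// mulr1.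
  rewrite (_ : _ `&` _ = `[c0, c[%classic).
    rewrite lebesgue_measure_itv/= lte_fin -EFinB; case: ltP => // ba.
    by congr EFin; lra.
  apply/seteqP; split => x /=; rewrite !in_itv/= cE' /tau /bit /c0.
    move=> [[+ <-]]; case: (leP 2^-1%R x) => /= ? ? /andP[? ?]; apply/andP; split; lra.
  case: (b) => /andP[? ?]; case: (leP 2^-1%R x) => /= ?; repeat split => //; try (apply/andP; split); lra.
rewrite /= /image_measure /pushforward /mrestr; apply: le_lt_trans (probability_le1 _ _) (ltry _).
apply: measurableI; last exact: measurable_set_bit.
exact: (measurable_preimageT measurable_tau).
Qed.

End uniform01.

(** Iteration gives [|delta i| <= 2^-n] for every [n]. This identifies distribution functions from
    the self-similarity of binary digits. *)
Lemma contracting_eq0 (R : realType) (I : Type) (delta : I -> R) :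
  (forall i, `|delta i| <= 1)%R ->
  (forall i, exists j, `|delta i| <= 2^-1 * `|delta j|)%R ->
  forall i, delta i = 0%R.
Proof.
move=> d1 dc.
have dn n i : (`|delta i| <= (2^-1) ^+ n)%R.
  elim: n i => [|n IH] i; first by rewrite expr0.
  have [j /le_trans] := dc i; apply.
  by rewrite exprS; apply: ler_wpM2l => //; rewrite invr_ge0.
move=> i; apply/eqP; rewrite -normr_le0.
have c : (fun n => (2^-1 : R) ^+ n)%R @ \oo --> (0%R : R).
  by apply: cvg_expr; rewrite ger0_norm ?invr_ge0// invf_lt1// ltr1n.
rewrite -(cvg_lim (@Rhausdorff R) c).
by apply: limr_ge; [apply/cvg_ex; exists 0%R|apply: nearW => n; exact: dn].
Qed.

(** * Binary digits and a sequence of independent uniform variables *)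

Section digits.
Variable R : realType.
Local Notation P := (@unif01 R).

Fixpoint even_digits n (u : R) : R :=
  if n is m.+1 then ((bit u)%:R + even_digits m (tau (tau u)))/ 2%R else 0%R.

(* The binary expansion [0.a b' a'' b''' (..)] of [u] is split into its even and
   odd digits. *)
Definition even_part (u : R) : R := limn (fun n => even_digits n u).
Definition odd_part (u : R) : R := even_part (tau u).

Let ed01 n u : (0 <= even_digits n u <= 1)%R.
Proof.
elim: n u => [|n IH] u /=; first by rewrite lexx ler01.
have /andP[? ?] := IH (tau (tau u)).
by case: (bit u) => /=; apply/andP; split; lra.
Qed.

Let ed_nd u : nondecreasing_seq (fun n => even_digits n u).
Proof.
apply/nondecreasing_seqP => n.
elim: n u => [|n IH] u; first by have /andP[] := ed01 1 u.
have := IH (tau (tau u)).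
rewrite [in X in _ -> X]/=; set x := even_digits n _; set y := even_digits n.+1 _ => xy.
by rewrite ler_wpM2r ?invr_ge0// lerD2l.
Qed.

Let ed_cvg u : cvgn (fun n => even_digits n u).
Proof.
apply: nondecreasing_is_cvgn; first exact: ed_nd.
by exists 1%R => _ [n _ <-]; have /andP[] := ed01 n u.
Qed.

Lemma even_part01 u : (0 <= even_part u <= 1)%R.
Proof.
apply/andP; split.
  by apply: limr_ge => //; apply: nearW => n; have /andP[] := ed01 n u.
by apply: limr_le => //; apply: nearW => n; have /andP[] := ed01 n u.
Qed.

Lemma even_partE u : even_part u = (((bit u)%:R + odd_part (tau u)) / 2)%R.
Proof.
rewrite /odd_part /even_part; apply: cvg_lim => //.
rewrite -cvg_shiftS/=; apply: cvgM; last exact: cvg_cst.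
by apply: cvgD; [exact: cvg_cst|exact: ed_cvg].
Qed.

Lemma measurable_even_part : measurable_fun setT even_part.
Proof.
apply: (measurable_fun_cvg (h := even_digits)).
  elim=> [|n IH] /=; first exact: measurable_cst.
  apply: measurable_funM => //; apply: measurable_funD.
    apply: (measurableT_comp (f := fun b : bool => (b%:R : R))) => //.
    exact: measurable_bit.
  apply: (measurableT_comp IH); apply: measurableT_comp => //; exact: measurable_tau.
by move=> u _; exact: ed_cvg.
Qed.

Lemma measurable_odd_part : measurable_fun setT odd_part.
Proof. apply: (measurableT_comp measurable_even_part); exact: measurable_tau. Qed.

Lemma unif01_split_bit S0 S1 : measurable S0 -> measurable S1 ->
  P [set u | (if bit u then S1 else S0) (tau u)] = (2^-1)%:E * (P S0 + P S1).
Proof.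
move=> m0 m1.
rewrite (_ : mkset _ = ([set u | bit u = false] `&` @tau R @^-1` S0) `|`
                   ([set u | bit u = true] `&` @tau R @^-1` S1)); last first.
  apply/seteqP; split => u /=; first by case: ifP => ?; [right|left].
  by move=> [[-> ?]|[-> ?]].
have mt S b : measurable S -> measurable ([set u | bit u = b] `&` @tau R @^-1` S).
  move=> mS; apply: measurableI; first exact: measurable_set_bit.
  exact: (measurable_preimageT (@measurable_tau R)).
rewrite measureU//; try exact: mt.
  rewrite ge0_muleDr//.
  by congr (_ + _); exact: unif01_bit_tau.
by apply/seteqP; split => // u [[/= -> _] [] ].
Qed.

Lemma unif01_tau S : measurable S -> P (@tau R @^-1` S) = P S.
Proof.
move=> mS; transitivity (P [set u | (if bit u then S else S) (tau u)]).
  by congr (P _); apply/seteqP; split => u /=; case: bit.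
rewrite unif01_split_bit// -[P S]fineK ?fin_num_measure// -EFinD -EFinM.
congr EFin; lra.
Qed.

(** The uniform distribution function, in a form suited to case analysis. *)
Let g (t : R) : R := (if t < 0 then 0 else if t < 1 then t else 1)%R.

Let gE t : P `]-oo, t]%classic = (g t)%:E.
Proof.
rewrite unif01_ray /g; congr EFin; case: ltP => t0.
  by rewrite max_l// ge_min ltW.
by case: ltP => t1; rewrite maxEle ?t0 ?ler01.
Qed.

Let g01 t : (0 <= g t <= 1)%R.
Proof. by rewrite /g; case: ltP => // ?; [rewrite lexx ler01|case: ltP => // ?; lra]. Qed.

Let g_split t : g t = (2^-1 * (g (2 * t) + g (2 * t - 1)))%R.
Proof. by rewrite /g; do ?case: ltP => // ?; lra. Qed.

Let setle (f : R -> R) x := [set u | (f u <= x)%R].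

Let me x : measurable (setle even_part x).
Proof. exact: (measurable_set_le measurable_even_part). Qed.

Let mo x : measurable (setle odd_part x).
Proof. exact: (measurable_set_le measurable_odd_part). Qed.

Let J x y : R := fine (P (setle even_part x `&` setle odd_part y)).

Let PJ x y : P (setle even_part x `&` setle odd_part y) = (J x y)%:E.
Proof. by rewrite fineK// fin_num_measure//; exact: measurableI. Qed.

Let J01 x y : (0 <= J x y <= 1)%R.
Proof.
by rewrite -!lee_fin -PJ measure_ge0 probability_le1//; exact: measurableI.
Qed.

(** Removing the first digit exchanges the two parts, hence the exchanged arguments: the odd part of
    [u] is the even part of [tau u], and the even part of [u] is half the sum of the first digit and
    the odd part of [tau u]. *)
Let J_split x y : J x y = (2^-1 * (J y (2 * x) + J y (2 * x - 1)))%R.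
Proof.
have mE a b : measurable (setle even_part a `&` setle odd_part b) by exact: measurableI.
apply: EFin_inj; rewrite EFinM EFinD -!PJ -unif01_split_bit//; congr (P _).
apply/seteqP; split => u; rewrite /setle /= even_partE /odd_part;
  case: (bit u) => /= -[? ?]; split => //; lra.
Qed.

Let f x : R := fine (P (setle even_part x)).

Let Pf x : P (setle even_part x) = (f x)%:E.
Proof. by rewrite fineK// fin_num_measure. Qed.

Let P_odd x : P (setle odd_part x) = (f x)%:E.
Proof. by rewrite -Pf -[RHS]unif01_tau. Qed.

Let f_split x : f x = (2^-1 * (f (2 * x) + f (2 * x - 1)))%R.
Proof.
apply: EFin_inj; rewrite EFinM EFinD -(Pf x) -!P_odd -unif01_split_bit//.
by congr (P _);
    apply/seteqP; split => u; rewrite /setle /= even_partE /odd_part;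
    case: (bit u) => /= ?; lra.
Qed.

Let f_lt0 x : (x < 0)%R -> f x = 0%R.
Proof.
move=> x0; rewrite /f (_ : setle _ _ = set0) ?measure0//.
apply/seteqP; split => // u; rewrite /setle/= => ux.
by have /andP[] := even_part01 u; lra.
Qed.

Let f_ge1 x : (1 <= x)%R -> f x = 1%R.
Proof.
move=> x1; rewrite /f (_ : setle _ _ = setT) ?probability_setT//.
apply/seteqP; split => // u _; rewrite /setle/=.
by have /andP[] := even_part01 u; lra.
Qed.

Let f01 x : (0 <= f x <= 1)%R.
Proof. by rewrite -!lee_fin -Pf measure_ge0 probability_le1. Qed.

Let fg x : f x = g x.
Proof.
apply/eqP; rewrite -subr_eq0; apply/eqP; move: x.
apply: (@contracting_eq0 R R (fun x => f x - g x)%R) => x.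
  by rewrite ler_norml; have := f01 x; have := g01 x; lra.
(* At least one of [2 * x] and [2 * x - 1] lies outside [[0, 1)], where [f] and [g] agree. A single
   term survives, with the factor [2^-1] that [contracting_eq0] wants. *)
have d0 z : (z < 0)%R || (1 <= z)%R -> (f z - g z = 0)%R.
  move=> /orP[z0|z1]; first by rewrite f_lt0// /g z0 subrr.
  by rewrite f_ge1// /g !ltNge z1 (le_trans ler01 z1) subrr.
have [x1|x1] := ltP (2 * x)%R 1%R.
  exists (2 * x)%R; rewrite f_split g_split.
  have E : (f (2 * x - 1) - g (2 * x - 1) = 0)%R by apply: d0; apply/orP; left; lra.
  rewrite (_ : _ - _ = 2^-1 * (f (2 * x) - g (2 * x)))%R; last by lra.
  by rewrite normrM ger0_norm ?invr_ge0.
exists (2 * x - 1)%R; rewrite f_split g_split.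
have E : (f (2 * x) - g (2 * x) = 0)%R by apply: d0; rewrite x1 orbT.
rewrite (_ : _ - _ = 2^-1 * (f (2 * x - 1) - g (2 * x - 1)))%R; last by lra.
by rewrite normrM ger0_norm ?invr_ge0.
Qed.

(** The same contraction on pairs: [(x, y)] goes to [(y, 2 * x)] or [(y, 2 * x - 1)]. If the new
    second argument is outside [[0, 1)], its constraint is impossible or automatic, and [fg] settles
    the term. *)
Let Jg x y : J x y = (g x * g y)%R.
Proof.
apply/eqP; rewrite -subr_eq0; apply/eqP; move: x y.
suff H (p : R * R) : (J p.1 p.2 - g p.1 * g p.2 = 0)%R by move=> x y; exact: (H (x, y)).
move: p; apply: (@contracting_eq0 R (R * R)%type (fun p => J p.1 p.2 - g p.1 * g p.2)%R) => -[x y] /=.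
  have := J01 x y; have := g01 x; have := g01 y => /andP[? ?] /andP[? ?] /andP[? ?].
  have : (0 <= g x * g y)%R by rewrite mulr_ge0.
  have : (g x * g y <= 1)%R by rewrite mulr_ile1.
  by rewrite ler_norml; lra.
have d0 z : (z < 0)%R || (1 <= z)%R -> (J y z - g y * g z = 0)%R.
  move=> /orP[z0|z1].
    rewrite /g z0 mulr0 subr0 /J (_ : _ `&` _ = set0) ?measure0//.
    apply/seteqP; split => // u; rewrite /setle/= => -[_ ux].
    by have /andP[] := even_part01 (tau u); move: ux; rewrite /odd_part; lra.
  rewrite /g !(ltNge z) z1 (le_trans ler01 z1)/= mulr1 -/(g y) -fg /J /f (_ : _ `&` _ = setle even_part y) ?subrr//.
  apply/seteqP; split => u; rewrite /setle/=; first by case.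
  by move=> ux; split => //; have /andP[_ h] := even_part01 (tau u); exact: le_trans z1.
have [x1|x1] := ltP (2 * x)%R 1%R.
  exists (y, 2 * x)%R; rewrite /= J_split (g_split x).
  have E : (J y (2 * x - 1) - g y * g (2 * x - 1) = 0)%R by apply: d0; apply/orP; left; lra.
  rewrite (_ : _ - _ = 2^-1 * (J y (2 * x) - g y * g (2 * x)))%R; last by lra.
  by rewrite normrM ger0_norm ?invr_ge0.
exists (y, 2 * x - 1)%R; rewrite /= J_split (g_split x).
have E : (J y (2 * x) - g y * g (2 * x) = 0)%R by apply: d0; rewrite x1 orbT.
rewrite (_ : _ - _ = 2^-1 * (J y (2 * x - 1) - g y * g (2 * x - 1)))%R; last by lra.
by rewrite normrM ger0_norm ?invr_ge0.
Qed.

Let preim_ray (h : R -> R) t : h @^-1` `]-oo, t]%classic = setle h t.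
Proof. by apply/seteqP; split => u /=; rewrite in_itv. Qed.

(** For two rays this is [Jg]; one factor after the other is extended to Borel sets by uniqueness of
    finite measures. *)
Lemma unif01_even_odd S S' : measurable S -> measurable S' ->
  P (even_part @^-1` S `&` odd_part @^-1` S') = P S * P S'.
Proof.
move=> mS mS'.
have fineP0 (A : set R) : (0 <= fine (P A))%R by exact: fine_ge0.
have PE (A : set R) : measurable A -> P A = (fine (P A))%:E.
  by move=> mA; rewrite fineK// fin_num_measure.
have mpo A : measurable A -> measurable (odd_part @^-1` A).
  by move=> mA; exact: (measurable_preimageT measurable_odd_part).
have mpe A : measurable A -> measurable (even_part @^-1` A).
  by move=> mA; exact: (measurable_preimageT measurable_even_part).
have E1 y A : measurable A ->
    P (even_part @^-1` A `&` setle odd_part y) = P A * (g y)%:E.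
  move=> mA; have g0 : (0 <= g y)%R by have /andP[] := g01 y.
  pose e : {nonneg R} := NngNum g0.
  suff : image_measure (mrestr P (mo y)) measurable_even_part A = mscale e P A.
    by move=> H; rewrite muleC; exact: H.
  move: A mA; apply: measure_eq_of_rays => t.
    rewrite /= /image_measure /pushforward /mrestr /mscale/= preim_ray PJ Jg gE.
    by rewrite -EFinM mulrC.
  rewrite /= /image_measure /pushforward /mrestr.
  apply: le_lt_trans (probability_le1 _ _) (ltry _).
  by apply: measurableI => //; exact: mpe.
pose e : {nonneg R} := NngNum (fineP0 S).
suff : image_measure (mrestr P (mpe _ mS)) measurable_odd_part S' = mscale e P S'.
  rewrite /= /image_measure /pushforward /mrestr /mscale/= => H.
  by rewrite setIC H -PE.
move: S' mS'; apply: measure_eq_of_rays => t.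
  rewrite /= /image_measure /pushforward /mrestr /mscale/= preim_ray setIC E1//.
  by rewrite gE -PE.
rewrite /= /image_measure /pushforward /mrestr.
apply: le_lt_trans (probability_le1 _ _) (ltry _).
by apply: measurableI; [exact: mpo|exact: mpe].
Qed.

Lemma unif01_even S : measurable S -> P (even_part @^-1` S) = P S.
Proof.
move=> mS; have := unif01_even_odd mS measurableT.
by rewrite preimage_setT setIT probability_setT mule1.
Qed.

Lemma unif01_odd S : measurable S -> P (odd_part @^-1` S) = P S.
Proof.
move=> mS; have := unif01_even_odd measurableT mS.
by rewrite preimage_setT setTI probability_setT mul1e.
Qed.

(** Each split keeps the even digits as one variable and splits the odd digits again, so one point
    carries countably many variables. *)
Definition iid_unif (i : nat) (u : R) : R := even_part (iter i odd_part u).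

Let m_iter i : measurable_fun setT (iter i odd_part).
Proof.
elim: i => [|i IH]; first exact: measurable_id.
by apply: (measurableT_comp measurable_odd_part IH).
Qed.

Lemma measurable_iid_unif i : measurable_fun setT (iid_unif i).
Proof. exact: (measurableT_comp measurable_even_part (m_iter i)). Qed.

Lemma unif01_iid_unif i S : measurable S -> P (iid_unif i @^-1` S) = P S.
Proof.
move=> mS; rewrite -[RHS]unif01_even//.
have : measurable (even_part @^-1` S).
  exact: (measurable_preimageT measurable_even_part).
rewrite (_ : iid_unif i @^-1` S = iter i odd_part @^-1` (even_part @^-1` S))//.
move: (even_part @^-1` S) => A mA.
elim: i => [//|i IH]; rewrite -[RHS]IH.
rewrite (_ : iter i.+1 odd_part @^-1` A = odd_part @^-1` (iter i odd_part @^-1` A)).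
  by rewrite unif01_odd//; exact: (measurable_preimageT (m_iter i)).
by apply/seteqP; split => u; rewrite /preimage/= -iterS iterSr.
Qed.

Lemma iid_unif_indep n (S : nat -> set R) : (forall i, measurable (S i)) ->
  P [set u | forall i, (i < n)%N -> S i (iid_unif i u)] =
  (\prod_(i < n) fine (P (S i)))%:E.
Proof.
elim: n S => [|n IH] S mS.
  by rewrite big_ord0 (_ : mkset _ = setT) ?probability_setT//; apply/seteqP; split.
rewrite (_ : mkset _ = even_part @^-1` (S 0%N) `&` odd_part @^-1`
   [set u | forall i, (i < n)%N -> S i.+1 (iid_unif i u)]); last first.
  apply/seteqP; split => u /=.
    move=> H; split; first exact: (H 0%N).
    by move=> i iN; have := H i.+1 iN; rewrite /iid_unif iterSr.
  move=> [H0 H] [|i] iN; first exact: H0.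
  by have := H i iN; rewrite /iid_unif iterSr.
rewrite unif01_even_odd//; last first.
  rewrite (_ : mkset _ = \bigcap_(i in [set i | (i < n)%N]) (iid_unif i @^-1` S i.+1)).
    apply: fin_bigcap_measurable; first exact: finite_II.
    by move=> i _; exact: (measurable_preimageT (@measurable_iid_unif i)).
  by apply/seteqP; split => u Hu i; exact: Hu.
rewrite (IH (fun i => S i.+1))// big_ord_recl EFinM fineK// fin_num_measure//.
Qed.

End digits.

Definition enc_sum (k : nat + nat) : nat :=
  match k with inl i => i.*2 | inr i => i.*2.+1 end.
Definition dec_sum (n : nat) : nat + nat :=
  if odd n then inr n./2 else inl n./2.

Lemma enc_sumK : cancel enc_sum dec_sum.
Proof.
by case=> i; rewrite /dec_sum /= ?odd_double ?doubleK//= uphalf_double.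
Qed.

Lemma dec_sumK : cancel dec_sum enc_sum.
Proof.
move=> n; rewrite -[RHS]odd_double_half /dec_sum.
by case: (odd n); rewrite /= ?add1n ?add0n.
Qed.

(** Positions not coded by an element of [J] are filled with [setT]. This reduces an arbitrary
    finite [J] to an initial segment of positions, where [iid_unif_indep] applies. *)
Lemma mutually_independent_iid_unif (R : realType)
    (F : nat + nat -> set (set R)) :
  (forall k A, F k A ->
     exists2 S, measurable S & A = iid_unif (enc_sum k) @^-1` S) ->
  mutually_independent (@unif01 R) F.
Proof.
move=> HF J A uJ FA.
have [S [mS AS]] : exists S : nat + nat -> set R, (forall k, measurable (S k)) /\
    forall k, k \in J -> A k = iid_unif (enc_sum k) @^-1` S k.
  have H k : exists S, measurable S /\ (k \in J -> A k = iid_unif (enc_sum k) @^-1` S).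
    have [kJ|kJ] := boolP (k \in J); last by exists setT.
    by have [S mS ->] := HF _ _ (FA k kJ); exists S.
  by have [S HS] := choice H; exists S; split => k; have [] := HS k.
pose S' i := if dec_sum i \in J then S (dec_sum i) else setT.
have mS' i : measurable (S' i) by rewrite /S'; case: ifP.
pose n := (\max_(k <- J) enc_sum k).+1.
have Jn k : k \in J -> (enc_sum k < n)%N.
  by move=> kJ; rewrite ltnS; apply: (@leq_bigmax_seq _ _ xpredT enc_sum).
transitivity (fine (@unif01 R [set u | forall i, (i < n)%N -> S' i (iid_unif i u)])).
  congr (fine (_ _)); apply/seteqP; split => u /=.
    move=> Au i iN; rewrite /S'; case: ifP => // iJ.
    by have := Au _ iJ; rewrite AS// /preimage/= dec_sumK.
  move=> Su k kJ; rewrite AS//; have := Su _ (Jn k kJ).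
  by rewrite /S' enc_sumK kJ.
rewrite iid_unif_indep//=.
have -> : (\prod_(i < n) fine (@unif01 R (S' i)) =
    \prod_(i <- iota 0 n | dec_sum i \in J) fine (@unif01 R (S (dec_sum i))))%R.
  rewrite [RHS]big_mkcond.
  rewrite -(big_mkord xpredT (fun i => fine (@unif01 R (S' i)))) /index_iota subn0.
  apply: eq_bigr => i _; rewrite /S'; case: ifP => // _.
  by rewrite probability_setT.
rewrite -big_filter -(big_map dec_sum xpredT (fun k => fine (@unif01 R (S k)))).
have pJ : perm_eq [seq dec_sum i | i <- iota 0 n & dec_sum i \in J] J.
  apply: uniq_perm => //.
    by rewrite map_inj_uniq ?filter_uniq ?iota_uniq//; exact: can_inj dec_sumK.
  move=> k; apply/mapP/idP => [[i]|kJ].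
    by rewrite mem_filter => /andP[iJ _] ->.
  exists (enc_sum k); last by rewrite enc_sumK.
  by rewrite mem_filter enc_sumK kJ mem_iota/= add0n Jn.
rewrite (perm_big _ pJ)/=; apply: eq_big_seq => k kJ.
by rewrite AS// unif01_iid_unif.
Qed.

(** * Sup-measures and extremal integrals *)

Section supmeasure.
Context (R : realType) (E : topologicalType).
Variable C : nat -> set E.
Hypothesis hE : hausdorff_space E.
Hypothesis cC : compact_base C.
Variable phi : set E -> \bar R.
Hypothesis sphi : is_supmeasure phi.

Lemma supmeasure_le A B : A `<=` B -> phi A <= phi B.
Proof. by case: sphi => H _ _ _ _; exact: H. Qed.

Lemma supmeasure0 : phi set0 = 0.
Proof. by case: sphi. Qed.

Lemma supmeasure_ge0 A : 0 <= phi A.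
Proof. by rewrite -supmeasure0; exact: supmeasure_le. Qed.

Lemma supmeasure_fin K : compact K -> phi K \is a fin_num.
Proof. by case: sphi => _ _ _ _ [H _]; exact: H. Qed.

Lemma supmeasure_openU U V : open U -> open V ->
  phi (U `|` V) <= maxe (phi U) (phi V).
Proof.
move=> oU oV; case: sphi => _ _ _ _ [_ /(_ [set U; V])].
rewrite bigcup_setU !bigcup_set1 => -> => [|W [->|->]//].
apply: ub_ereal_sup => _ [[W [->|->] <-]|->].
- by rewrite le_max lexx.
- by rewrite le_max lexx orbT.
- by rewrite le_max supmeasure_ge0.
Qed.

Lemma supmeasure_cover_sequence K (J : nat -> seq nat) : compact K ->
  (forall k, K `<=` cover_int C (J k)) ->
  (forall k, cover_set C (J k.+1) `<=` cover_set C (J k)) ->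
  (forall U, open U -> K `<=` U -> exists k, cover_set C (J k) `<=` U) ->
  phi (cover_set C (J k)) @[k --> \oo] --> phi K.
Proof.
move=> cK KJ Jd JU; case: sphi => _ _ _ /(_ (fun k => cover_set C (J k))) + _.
rewrite (_ : \bigcap_i cover_set C (J i) = K).
  by apply => // k; exact: compact_cover_set.
apply/seteqP; split => x; last first.
  by move=> Kx k _; apply: cover_int_sub; exact: KJ.
move=> Jx; apply: contrapT => nKx.
have oU : open (~` [set x]) by apply: closed_openC; apply: compact_closed => //; exact: compact_set1.
have [k Jk] := JU _ oU (fun y Ky yx => nKx (eq_ind _ K Ky _ yx)).
exact: (Jk x (Jx k Logic.I)).
Qed.

(** The sets [cover_set C (J k)] are compact and decrease to [K], and [phi] is continuous along such
    sequences. *)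
Lemma supmeasure_outer K (c : \bar R) : compact K -> phi K < c ->
  exists2 J, K `<=` cover_int C J & phi (cover_set C J) < c.
Proof.
move=> cK Kc; have [J [KJ Jd JU]] := cover_int_sequence cC cK.
have cv := supmeasure_cover_sequence cK KJ Jd JU.
apply: contrapT => nJ; move: Kc; apply/negP; rewrite -leNgt.
rewrite -(cvg_lim (@ereal_hausdorff R) cv); apply: lime_ge.
  by apply/cvg_ex; eexists; exact: cv.
by apply: nearW => k; rewrite leNgt; apply/negP => kc; apply: nJ; exists (J k).
Qed.

(** The sup property is given for open sets only. Compact sets inherit it because each is enclosed
    in an open [cover_int] that costs arbitrarily little in [phi]. *)
Lemma supmeasureU K L : compact K -> compact L ->
  phi (K `|` L) = maxe (phi K) (phi L).
Proof.
move=> cK cL.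
have hK : phi K <= phi (K `|` L) by apply: supmeasure_le; exact: subsetUl.
have hL : phi L <= phi (K `|` L) by apply: supmeasure_le; exact: subsetUr.
apply/eqP; rewrite eq_le ge_max hK hL !andbT leNgt; apply/negP; rewrite gt_max => /andP[Kc Lc].
have [J KJ Jc] := supmeasure_outer cK Kc.
have [I LI Ic] := supmeasure_outer cL Lc.
have : phi (K `|` L) <= maxe (phi (cover_int C J)) (phi (cover_int C I)).
  apply: le_trans (supmeasure_openU (open_cover_int _ _) (open_cover_int _ _)).
  by apply: supmeasure_le; exact: setUSS.
rewrite le_max => /orP[|] H.
  have := lt_le_trans Jc H; rewrite ltNge => /negP; apply.
  by apply: supmeasure_le; exact: cover_int_sub.
have := lt_le_trans Ic H; rewrite ltNge => /negP; apply.
by apply: supmeasure_le; exact: cover_int_sub.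
Qed.

Lemma supmeasureU_le K L (x : \bar R) : compact K -> compact L ->
  (phi (K `|` L) <= x) = (phi K <= x) && (phi L <= x).
Proof. by move=> cK cL; rewrite supmeasureU// ge_max. Qed.

Lemma supmeasure_cover_set_le J (x : \bar R) : 0 <= x ->
  (phi (cover_set C J) <= x) <-> (forall j, j \in J -> phi (C j) <= x).
Proof.
move=> x0; elim: J => [|i J IH].
  rewrite (_ : cover_set C [::] = set0) ?supmeasure0//.
  by apply/seteqP; split => // y [j].
rewrite -cat1s cover_set_cat supmeasureU_le; try exact: compact_cover_set.
rewrite (_ : cover_set C [:: i] = C i); last first.
  apply/seteqP; split => y; first by move=> [j /=]; rewrite inE => /eqP ->.
  by move=> Cy; exists i => //=; rewrite inE.
split.
  by move=> /andP[Ci /IH CJ] j; rewrite /= inE => /orP[/eqP ->|/CJ].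
move=> H; apply/andP; split; first by apply: H; rewrite inE eqxx.
by apply/IH => j jJ; apply: H; rewrite inE jJ orbT.
Qed.

Lemma supmeasure_eq0 : (forall n, phi (exhaust C n) = 0) -> phi = zero_supmeasure.
Proof.
move=> h0; apply/funext => A; rewrite /zero_supmeasure.
apply/eqP; rewrite eq_le supmeasure_ge0 andbT.
apply: (@le_trans _ _ (phi setT)); first exact: supmeasure_le.
case: sphi => _ _ /(_ (exhaust C)) + _ _.
rewrite (bigcup_exhaust cC) => /(_ _) cv.
have := cvg_lim (@ereal_hausdorff R) (cv (fun n => @exhaust_nd _ C _ _ (leqnSn n))).
rewrite (_ : (fun _ => _) = cst 0); last by apply/funext => n; rewrite h0.
by rewrite lim_cst// => <-.
Qed.

Lemma ext_int_ge0 (f : E -> R) : 0 <= ext_int f phi.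
Proof.
apply: ereal_sup_ubound; exists set0; first exact: compact0.
by rewrite supmeasure0 mul0e.
Qed.

Lemma ext_int_upper (f : E -> R) K (c : R) : compact K -> (0 <= c)%R ->
  (forall x, K x -> (c <= f x)%R) -> phi K * c%:E <= ext_int f phi.
Proof.
move=> cK c0 Kc; have [[x Kx]|K0] := pselect (K !=set0); last first.
  rewrite (_ : K = set0) ?supmeasure0 ?mul0e ?ext_int_ge0//.
  by apply/seteqP; split => // x Kx; case: K0; exists x.
apply: le_trans (ereal_sup_ubound _); last by exists K.
apply: lee_wpmul2l; first exact: supmeasure_ge0.
by apply: le_ereal_inf_tmp => _ [y Ky <-]; rewrite lee_fin Kc.
Qed.

(* The infimum over the empty compact set is [+oo], but then [phi set0 = 0]. *)
Lemma ext_int_lower (f : E -> R) (M : \bar R) : (forall x, (0 <= f x)%R) -> 0 <= M ->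
  (forall K (c : R), compact K -> (0 < c)%R -> (forall x, K x -> (c <= f x)%R) ->
      phi K * c%:E <= M) ->
  ext_int f phi <= M.
Proof.
move=> f0 M0 H; apply: ub_ereal_sup => _ [K cK <-].
have [[x Kx]|K0] := pselect (K !=set0); last first.
  rewrite (_ : K = set0) ?supmeasure0 ?mul0e//.
  by apply/seteqP; split => // x Kx; case: K0; exists x.
set i := ereal_inf _.
have i0 : 0 <= i by apply: le_ereal_inf_tmp => _ [y Ky <-]; rewrite lee_fin.
have ix : i <= (f x)%:E by apply: ereal_inf_lbound; exists x.
have fi : i \is a fin_num by rewrite ge0_fin_numE// (le_lt_trans ix)// ltry.
have ilb y : K y -> i <= (f y)%:E.
  by move=> Ky; apply: ereal_inf_lbound; exists y.
have /orP[/eqP c0|c0] : (0 == fine i)%R || (0 < fine i)%R.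
  by rewrite -le_eqVlt fine_ge0.
  by rewrite -(fineK fi) -c0 mule0.
rewrite -(fineK fi).
by apply: H => // y /ilb; rewrite -lee_fin fineK.
Qed.

Lemma supmeasure_bigsetU_le (T : eqType) (K : T -> set E) (s : seq T) (Q : pred T)
    (x : \bar R) : 0 <= x ->
  (forall p, p \in s -> compact (K p)) -> (forall p, p \in s -> Q p -> phi (K p) <= x) ->
  phi (\big[setU/set0]_(p <- s | Q p) K p) <= x.
Proof.
move=> x0 cK Kx.
suff : compact (\big[setU/set0]_(p <- s | Q p) K p) /\
       phi (\big[setU/set0]_(p <- s | Q p) K p) <= x by case.
rewrite big_seq_cond; elim/big_rec: _ => [|p A /andP[ps Qp] [cA Ax]].
  by split; [exact: compact0|rewrite supmeasure0].
have cp := cK p ps; split; first exact: compactU.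
by rewrite supmeasureU_le// Ax Kx.
Qed.

(** A compact set on which the step function is at least [c > 0] lies in the union of the [p.2] with
    [c <= p.1], and on this finite union [phi] is the maximum of its values on the members. *)
Lemma ext_int_bigmax (s : seq (R * set E)) :
  (forall p, p \in s -> compact p.2) -> (forall p, p \in s -> 0 <= p.1)%R ->
  ext_int (fun x => \big[Num.max/0%R]_(p <- s) (p.1 * \1_(p.2) x)%R) phi =
  \big[maxe/0]_(p <- s) (p.1%:E * phi p.2).
Proof.
move=> cs s0; set f := fun x : E => _; set M := \big[maxe/0]_(p <- s) _.
have M0 : 0 <= M by rewrite /M; elim/big_rec: _ => // p x _ x0; rewrite le_max x0 orbT.
have f0 x : (0 <= f x)%R.
  by rewrite /f; elim/big_rec: _ => // p y _ y0; rewrite le_max y0 orbT.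
apply/eqP; rewrite eq_le; apply/andP; split; last first.
  rewrite /M big_seq; apply: bigmax_le; first exact: ext_int_ge0.
  move=> p ps; rewrite muleC; apply: ext_int_upper; [exact: cs|exact: s0|].
  move=> x px; apply: le_trans (@le_bigmax_seq _ R _ s 0%R p xpredT
    (fun p => (p.1 * \1_(p.2) x)%R) ps isT).
  by rewrite indicE mem_set// mulr1.
apply: ext_int_lower => // K c cK c0 Kc.
rewrite -lee_pdivlMr//.
apply: (@le_trans _ _ (phi (\big[setU/set0]_(p <- s | (c <= p.1)%R) p.2))).
  apply: supmeasure_le => x /Kc; rewrite /f => cx.
  rewrite -bigcup_seq_cond.
  apply: contrapT => nx; move: cx; apply/negP; rewrite -ltNge.
  rewrite big_seq; apply: bigmax_lt => // p ps; rewrite indicE.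
  case: (boolP (x \in p.2)) => xp /=; last by rewrite mulr0.
  rewrite mulr1 ltNge; apply/negP => cp; apply: nx; exists p => //=.
  by rewrite ps cp.
  exact: set_mem.
apply: supmeasure_bigsetU_le => //; first by rewrite mule_ge0// lee_fin invr_ge0 ltW.
move=> p ps cp; rewrite lee_pdivlMr//.
apply: le_trans (@le_bigmax_seq _ (\bar R) _ s 0 p xpredT
  (fun p => p.1%:E * phi p.2) ps isT).
by rewrite muleC; apply: lee_wpmul2r; rewrite ?lee_fin// supmeasure_ge0.
Qed.

Lemma ext_int_indic K : compact K -> ext_int (\1_K : E -> R) phi = phi K.
Proof.
move=> cK.
transitivity (\big[maxe/0]_(p <- [:: (1%R, K)]) (p.1%:E * phi p.2)); last first.
  by rewrite big_cons big_nil /= mul1e max_l ?supmeasure_ge0.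
rewrite -ext_int_bigmax.
- congr (ext_int _ _); apply/funext => x.
  by rewrite big_cons big_nil/= mul1r max_l.
- by move=> p; rewrite inE => /eqP ->.
- by move=> p; rewrite inE => /eqP ->.
Qed.

End supmeasure.

(** Runs through the positive rationals with repetitions; a number that codes no pair gives 1. *)
Definition posrat {R : realType} (n : nat) : R :=
  let p := odflt (0%N, 0%N) (unpickle n) in (p.1.+1%:R / p.2.+1%:R)%R.

Lemma posrat_gt0 (R : realType) n : (0 < posrat n :> R)%R.
Proof. by rewrite divr_gt0// ltr0n. Qed.

Lemma posrat_dense (R : realType) (a b : R) : (0 <= a)%R -> (a < b)%R ->
  exists n, (a < posrat n < b)%R.
Proof.
move=> a0 ab; have ba0 : (0 < b - a)%R by rewrite subr_gt0.
pose m := Num.truncn (b - a)^-1; pose k := Num.truncn (a * m.+1%:R).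
exists (pickle (k, m)); rewrite /posrat pickleK/=.
have m0 : (0 < m.+1%:R :> R)%R by rewrite ltr0n.
have hm : ((b - a)^-1 < m.+1%:R)%R by exact: truncnS_gt.
rewrite ltr_pdivlMr// ltr_pdivrMr// truncnS_gt/= -natr1.
have : (k%:R <= a * m.+1%:R)%R by rewrite truncn_le// mulr_ge0// ltW.
have : (1 < (b - a) * m.+1%:R)%R by rewrite mulrC -ltr_pdivrMr// div1r.
lra.
Qed.

(** * Upper semicontinuous functions and indicators of closed sets *)

Section usc.
Context (R : realType) (E : topologicalType).
Hypothesis hE : hausdorff_space E.
Implicit Types f g : E -> R.

Lemma usc_level_compact f (t : R) : USC f -> (0 < t)%R ->
  compact [set x | (t <= f x)%R].
Proof.
move=> [_ f0 of_ cf] t0; apply: (subclosed_compact _ cf).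
  rewrite (_ : mkset _ = ~` [set x | (f x < t)%R]); first exact: open_closedC.
  by apply/seteqP; split => x /=; rewrite leNgt => /negP.
by move=> x /= tx; apply: subset_closure => /=; rewrite gt_eqF// (lt_le_trans t0).
Qed.

Let sub_closed_compact (A B : set E) : compact B -> A `<=` B -> compact (closure A).
Proof.
move=> cB AB; apply: (subclosed_compact (@closed_closure _ A) cB).
apply: subset_trans (closureS AB) _; rewrite -(closure_id B).1//.
exact: compact_closed.
Qed.

Lemma USC_scaled_indic (K : set E) (u : R) : compact K -> (0 <= u)%R ->
  USC (fun x => u * \1_K x)%R.
Proof.
move=> cK u0; split.
- exists u => x; rewrite indicE; case: (_ \in _); rewrite ?mulr1// mulr0//.
- by move=> x; rewrite mulr_ge0.
- move=> t; have oK : open (~` K) by apply: closed_openC; exact: compact_closed.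
  have [t0|t0] := leP t 0%R.
    rewrite (_ : mkset _ = set0); first exact: open0.
    by apply/seteqP; split => // x /= /lt_le_trans/(_ t0); rewrite ltNge mulr_ge0.
  have [ut|ut] := ltP u t.
    rewrite (_ : mkset _ = setT); first exact: openT.
    apply/seteqP; split => // x _ /=; rewrite indicE.
    by case: (_ \in _); rewrite ?mulr1 ?mulr0.
  rewrite (_ : mkset _ = ~` K)//; apply/seteqP; split => x /=; rewrite indicE.
    by move=> + Kx; rewrite mem_set// mulr1 ltNge ut.
  by move=> nK; rewrite memNset// mulr0.
- apply: (sub_closed_compact cK) => x /=; rewrite indicE.
  by case: (boolP (x \in K)) => [/set_mem//|_]; rewrite mulr0 eqxx.
Qed.

Lemma USC_max f g : USC f -> USC g -> USC (fun x => Num.max (f x) (g x)).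
Proof.
move=> [[M fM] f0 of_ cf] [[N gN] g0 og cg]; split.
- exists (Num.max M N) => x; rewrite ge_max !le_max fM gN orbT//.
- by move=> x; rewrite le_max f0.
- move=> t; rewrite (_ : mkset _ = [set x | (f x < t)%R] `&` [set x | (g x < t)%R]).
    exact: openI.
  by apply/seteqP; split => x /=; rewrite gt_max => /andP.
- apply: (sub_closed_compact (compactU cf cg)) => x /= fg.
  have [fx|fx] := eqVneq (f x) 0%R; last by left; exact: subset_closure.
  right; apply: subset_closure => /=; apply: contraNneq fg => ->.
  by rewrite fx maxxx.
Qed.

Lemma USC_add f g : USC f -> USC g -> USC (fun x => f x + g x)%R.
Proof.
move=> [[M fM] f0 of_ cf] [[N gN] g0 og cg]; split.
- by exists (M + N)%R => x; rewrite lerD.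
- by move=> x; rewrite addr_ge0.
- move=> t; rewrite (_ : mkset _ =
    \bigcup_(s in [set: R]) ([set x | (f x < s)%R] `&` [set x | (g x < t - s)%R])).
    by apply: bigcup_open => s _; exact: openI.
  apply/seteqP; split => x /=.
    move=> fgt; exists (f x + (t - f x - g x) / 2)%R => //=; split; lra.
  by move=> [s _ /= []]; lra.
- apply: (sub_closed_compact (compactU cf cg)) => x /= fg.
  have [fx|fx] := eqVneq (f x) 0%R; last by left; exact: subset_closure.
  right; apply: subset_closure => /=; apply: contraNneq fg => ->.
  by rewrite fx addr0.
Qed.

Lemma USC_bigmax (s : seq (R * set E)) :
  (forall p, p \in s -> compact p.2) -> (forall p, p \in s -> 0 <= p.1)%R ->
  USC (fun x => \big[Num.max/0%R]_(p <- s) (p.1 * \1_(p.2) x)%R).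
Proof.
elim: s => [|p s IH] cs s0.
  have := USC_scaled_indic (@compact0 E) (lexx (0 : R)%R).
  by congr USC; apply/funext => x; rewrite big_nil mul0r.
rewrite (_ : (fun _ => _) = (fun x => Num.max (p.1 * \1_(p.2) x)
   (\big[Num.max/0%R]_(p <- s) (p.1 * \1_(p.2) x)))%R); last first.
  by apply/funext => x; rewrite big_cons.
apply: USC_max.
  by apply: USC_scaled_indic; [apply: cs|apply: s0]; rewrite inE eqxx.
by apply: IH => q qs; [apply: cs|apply: s0]; rewrite inE qs orbT.
Qed.

(** A compact set with level [c] is nearly matched by the level set of [f] at a rational just below
    [c]. The extremal integral is thus a countable supremum, which gives its measurability. *)
Lemma ext_int_posrat f phi : USC f -> is_supmeasure phi ->
  ext_int f phi =
  ereal_sup (range (fun n => (posrat n)%:E * phi [set x | (posrat n <= f x)%R])).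
Proof.
move=> uf sphi; have [_ f0 _ _] := uf.
have q0 n : (0 <= posrat n :> R)%R by rewrite ltW// posrat_gt0.
set S := ereal_sup _.
have S0 : 0 <= S.
  apply: (@le_trans _ _ ((posrat 0)%:E * phi [set x | (posrat 0 <= f x)%R])).
    by rewrite mule_ge0 ?lee_fin// supmeasure_ge0.
  by apply: ereal_sup_ubound; exists 0%N.
apply/eqP; rewrite eq_le; apply/andP; split; last first.
  apply: ub_ereal_sup => _ [n _ <-]; rewrite muleC; apply: ext_int_upper => //.
  by apply: usc_level_compact => //; exact: posrat_gt0.
apply: (ext_int_lower sphi) => // K c cK c0 Kc.
have fK := supmeasure_fin sphi cK; have K0 := supmeasure_ge0 sphi K.
rewrite leNgt; apply/negP => SK.
have fS : S \is a fin_num.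
  rewrite ge0_fin_numE//; apply: lt_trans SK _.
  by rewrite -(fineK fK) -EFinM ltry.
move: SK; rewrite -(fineK fS) -(fineK fK) -EFinM lte_fin => SK.
have k0 : (0 < fine (phi K))%R.
  rewrite lt_neqAle fine_ge0// andbT; apply/eqP => k0.
  by move: SK; rewrite -k0 mul0r ltNge fine_ge0.
have Sk0 : (0 <= fine S / fine (phi K))%R by rewrite divr_ge0// ?fine_ge0.
have [n /andP[n1 n2]] : exists n, (fine S / fine (phi K) < posrat n < c)%R.
  by apply: posrat_dense => //; rewrite ltr_pdivrMr// mulrC.
have : (posrat n * fine (phi K) <= fine S)%R.
  rewrite -lee_fin EFinM !fineK//.
  apply: (@le_trans _ _ ((posrat n)%:E * phi [set x | (posrat n <= f x)%R])).
    apply: lee_wpmul2l; first by rewrite lee_fin.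
    apply: (supmeasure_le sphi) => x /Kc /=; apply: le_trans; exact: ltW.
  by apply: ereal_sup_ubound; exists n.
by move: n1; rewrite ltr_pdivrMr// => n1 /(lt_le_trans n1); rewrite ltxx.
Qed.

(** The substantial case is that of decreasing compact sets: if [F] meets every [K n], the
    intersections generate a proper filter, and a cluster point of it lies in all of them. *)
Lemma is_supmeasure_scaled_indicator (c : R) (F : set E) : (0 <= c)%R -> closed F ->
  is_supmeasure (fun A : set E => if `[< F `&` A !=set0 >] then c%:E else 0).
Proof.
move=> c0 cF.
have le A B : A `<=` B -> (if `[< F `&` A !=set0 >] then c%:E else 0) <=
    (if `[< F `&` B !=set0 >] then c%:E else 0) :> \bar R.
  move=> AB; case: asboolP => [[x [Fx Ax]]|_]; last by case: ifP; rewrite ?lee_fin.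
  by rewrite asboolT//; exists x; split => //; exact: AB.
split => //.
- by rewrite asboolF// => -[x []].
- move=> A An; have Amn m n : (m <= n)%N -> A m `<=` A n.
    move=> /subnK <-; elim: (n - m)%N => // k IH; rewrite addSn.
    exact: subset_trans IH (An _).
  have [[x [Fx [i _ Ai]]]|H] := pselect (F `&` (\bigcup_i A i) !=set0).
    apply: cvg_near_cst; exists i => //= n /= ni.
    rewrite !asboolT//; first by exists x; split => //; exists i.
    by exists x; split => //; exact: Amn Ai.
  rewrite [X in _ --> X]ifF; last by apply/negbTE/negP => /asboolP.
  apply: cvg_near_cst; near=> n; rewrite asboolF// => -[x [Fx Ax]].
  by apply: H; exists x; split => //; exists n.
- move=> K cK Kn; have Kmn m n : (m <= n)%N -> K n `<=` K m.
    move=> /subnK <-; elim: (n - m)%N => // k IH; rewrite addSn.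
    exact: subset_trans (Kn _) IH.
  have [[n Hn]|Hall] := pselect (exists n, ~ (F `&` K n !=set0)).
    rewrite [X in _ --> X]ifF; last first.
      apply/negbTE/negP => /asboolP[x [Fx Kx]].
      by apply: Hn; exists x; split => //; exact: Kx.
    apply: cvg_near_cst; exists n => //= m /= nm; rewrite asboolF// => -[x [Fx Kx]].
    by apply: Hn; exists x; split => //; exact: Kmn Kx.
  have FK n : F `&` K n !=set0 by apply: contrapT => H; apply: Hall; exists n.
  rewrite asboolT; last first.
    pose G := filter_from [set: nat] (fun n => F `&` K n).
    have FG : ProperFilter G.
      apply: filter_from_proper; last by move=> n _; exact: FK.
      apply: filter_from_filter; first by exists 0%N.
      move=> i j _ _; exists (maxn i j) => // x [Fx Kx]; split; split => //.
        by apply: Kmn Kx; exact: leq_maxl.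
      by apply: Kmn Kx; exact: leq_maxr.
    have GK : G (K 0%N) by exists 0%N => // x [].
    have [x [K0x]] := cK 0%N G FG GK.
    rewrite clusterE => xc; exists x.
    have clFK n : (F `&` K n) x.
      have /closure_id -> : closed (F `&` K n).
        by apply: closedI => //; exact: compact_closed.
      by apply: xc; exists n.
    split; first by have [] := clFK 0%N.
    by move=> n _; have [] := clFK n.
  apply: cvg_near_cst; near=> n; rewrite asboolT//.
- split; first by move=> K _; case: ifP.
  move=> G oG.
  apply/eqP; rewrite eq_le; apply/andP; split; last first.
    apply: ub_ereal_sup => _ [[U GU <-]|->]; last by case: ifP; rewrite ?lee_fin.
    by apply: le => x Ux; exists U.
  case: asboolP => [[x [Fx [U GU Ux]]]|_].
    apply: ereal_sup_ubound; left; exists U => //.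
    by rewrite asboolT//; exists x.
  by apply: ereal_sup_ubound; right.
Unshelve. all: by end_near.
Qed.

End usc.

(** * Peeling step functions *)

Section scaled_indicator.
Context (R : realType) (E : topologicalType).
Implicit Types f g : E -> R.
Variable phi : set E -> \bar R.
Hypothesis sphi : is_supmeasure phi.

(** Singletons of points of [F] are compact sets of mass [c], so testing on them loses nothing. *)
Lemma ext_int_scaled_indicator (c : R) (F : set E) f : (0 < c)%R -> F !=set0 ->
  (forall K, compact K -> phi K = if `[< F `&` K !=set0 >] then c%:E else 0) ->
  (forall x, 0 <= f x)%R ->
  ext_int f phi = c%:E * ereal_sup [set (f x)%:E | x in F].
Proof.
move=> c0 [x0 Fx0] phiE f0; set S := ereal_sup _.
have S0 : 0 <= S.
  apply: (@le_trans _ _ (f x0)%:E); first by rewrite lee_fin.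
  by apply: ereal_sup_ubound; exists x0.
apply/eqP; rewrite eq_le; apply/andP; split.
  apply: ext_int_lower => //; first by rewrite mule_ge0// lee_fin ltW.
  move=> K t cK t0 Kt; rewrite phiE//; case: asboolP => [[x [Fx Kx]]|_].
    apply: lee_wpmul2l; first by rewrite lee_fin ltW.
    apply: (@le_trans _ _ (f x)%:E); first by rewrite lee_fin Kt.
    by apply: ereal_sup_ubound; exists x.
  by rewrite mul0e mule_ge0// lee_fin ltW.
rewrite muleC -lee_pdivlMr//; apply: ub_ereal_sup => _ [x Fx <-].
rewrite lee_pdivlMr//.
have := @ext_int_upper _ _ _ sphi f [set x] (f x) (@compact_set1 _ x) (f0 x).
rewrite phiE; last exact: compact_set1.
rewrite asboolT; last by exists x.
by rewrite muleC; apply => y ->.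
Qed.

(** Of two points [x], [y] of [F], comonotonicity makes one at least as good as the other for both
    functions, so [f x + g y] is at most [f + g] at that point. Hence the suprema over [F] add up,
    attained or not. *)
Lemma ext_int_comonotone f g : scaled_indicator phi -> USC f -> USC g ->
  comonotone f g ->
  ext_int (fun x => f x + g x)%R phi = ext_int f phi + ext_int g phi.
Proof.
move=> [c [F [c0 cF F0 phiE]]] [[M fM] f0 _ _] [[N gN] g0 _ _] cm.
have fg0 x : (0 <= f x + g x)%R by rewrite addr_ge0.
rewrite !(ext_int_scaled_indicator c0 F0 phiE)//.
have [x0 Fx0] := F0.
have fin (h : E -> R) B : (forall x, h x <= B)%R -> (forall x, 0 <= h x)%R ->
    ereal_sup [set (h x)%:E | x in F] \is a fin_num /\
    0 <= ereal_sup [set (h x)%:E | x in F].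
  move=> hB h0.
  have s0 : 0 <= ereal_sup [set (h x)%:E | x in F].
    apply: (@le_trans _ _ (h x0)%:E); first by rewrite lee_fin.
    by apply: ereal_sup_ubound; exists x0.
  split=> //; rewrite ge0_fin_numE//; apply: (@le_lt_trans _ _ B%:E); last exact: ltry.
  by apply: ub_ereal_sup => _ [x _ <-]; rewrite lee_fin.
have [ff fF0] := fin f M fM f0; have [fg gF0] := fin g N gN g0.
rewrite -ge0_muleDr//; congr (_ * _); apply/eqP; rewrite eq_le; apply/andP; split.
  apply: ub_ereal_sup => _ [x Fx <-]; rewrite EFinD; apply: leeD;
  by apply: ereal_sup_ubound; exists x.
set S := ereal_sup [set (f x + g x)%:E | x in F].
have sep x y : F x -> F y -> (f x + g y)%:E <= S.
  move=> Fx Fy.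
  suff [z Fz h] : exists2 z, F z & (f x + g y <= f z + g z)%R.
    by apply: (@le_trans _ _ (f z + g z)%:E); [rewrite lee_fin|apply: ereal_sup_ubound; exists z].
  have [gyx|gxy] := leP (g y) (g x); first by exists x => //; rewrite lerD2l.
  exists y => //; rewrite lerD2r leNgt; apply/negP => fyx.
  have := cm x y; rewrite leNgt => /negP; apply.
  by rewrite pmulr_rlt0 ?subr_gt0 ?subr_lt0.
rewrite -leeBrDl//; apply: ub_ereal_sup => _ [y Fy <-].
rewrite leeBrDl// addeC -leeBrDl//; apply: ub_ereal_sup => _ [x Fx <-].
by rewrite leeBrDl// addeC -EFinD sep.
Qed.

End scaled_indicator.

Lemma frechet_scale_unique d (Om : measurableType d) (R : realType)
    (P : probability Om R) (Z : Om -> \bar R) (a b : R) :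
  frechet_scale P Z a -> frechet_scale P Z b -> a = b.
Proof.
move=> [_ Pa] [_ Pb]; have := Pa 1%R ltr01; rewrite Pb// => -[] /expR_inj.
by rewrite !divr1 => /oppr_inj.
Qed.

Definition step_fun {R : realType} {E : topologicalType} (s : seq (R * set E)) (x : E) : R :=
  \big[Num.max/0%R]_(p <- s) (p.1 * \1_(p.2) x)%R.

Definition sup_eval {R : realType} {E : topologicalType} (s : seq (R * set E))
  (phi : set E -> \bar R) : \bar R := \big[maxe/0]_(p <- s) (p.1%:E * phi p.2).

Definition admissible {R : realType} {E : topologicalType} (s : seq (R * set E)) :=
  (forall p, p \in s -> compact p.2) /\ (forall p, p \in s -> 0 <= p.1)%R.

Section step_functions.
Context (R : realType) (E : topologicalType) (C : nat -> set E).
Hypothesis hE : hausdorff_space E.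
Hypothesis cC : compact_base C.
Implicit Types s : seq (R * set E).

Lemma step_fun_ge0 s x : (0 <= step_fun s x)%R.
Proof. by rewrite /step_fun; elim/big_rec: _ => // p y _ y0; rewrite le_max y0 orbT. Qed.

Lemma step_fun_ge s x p : p \in s -> x \in p.2 -> (p.1 <= step_fun s x)%R.
Proof.
move=> ps xp; apply: le_trans (@le_bigmax_seq _ R _ s 0%R p xpredT
    (fun p => (p.1 * \1_(p.2) x)%R) ps isT).
by rewrite indicE xp mulr1.
Qed.

Lemma step_fun_le s x (M : R) : (0 <= M)%R ->
  (forall p, p \in s -> x \in p.2 -> p.1 <= M)%R -> (step_fun s x <= M)%R.
Proof.
move=> M0 H; rewrite /step_fun big_seq; apply: bigmax_le => // p ps.
by rewrite indicE; case: (boolP (_ \in _)) => xp; rewrite ?mulr0// mulr1 H.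
Qed.

Lemma sup_eval_ge0 s phi : 0 <= sup_eval s phi.
Proof. by rewrite /sup_eval; elim/big_rec: _ => // p y _ y0; rewrite le_max y0 orbT. Qed.

Lemma ext_int_step_fun s phi : admissible s -> is_supmeasure phi ->
  ext_int (step_fun s) phi = sup_eval s phi.
Proof. by move=> [cs s0] sphi; exact: (ext_int_bigmax hE cC sphi). Qed.

Lemma USC_step_fun s : admissible s -> USC (step_fun s).
Proof. by move=> [cs s0]; exact: USC_bigmax. Qed.

(** The initial value is the first height and not 0, so that the minimum is a height of [s] as soon
    as [s] is non-empty. *)
Definition step_min s : R := \big[Num.min/(head (0%R, set0) s).1]_(p <- s) p.1.
Definition step_union s : set E := \big[setU/set0]_(p <- s) p.2.
Definition step_tail s : seq (R * set E) :=
  [seq ((p.1 - step_min s)%R, p.2) | p <- s & p.1 != step_min s].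

Lemma step_min_le s p : p \in s -> (step_min s <= p.1)%R.
Proof.
rewrite /step_min; move: (head _ _).1 => i; elim: s => // q s IH.
by rewrite inE big_cons ge_min => /orP[/eqP ->|/IH ->]; rewrite ?lexx// orbT.
Qed.

Lemma step_min_in s : s != [::] -> exists2 p, p \in s & p.1 = step_min s.
Proof.
case: s => // p s _; rewrite /step_min/=.
suff : forall t : seq (R * set E), {subset t <= p :: s} ->
    exists2 q, q \in p :: s & q.1 = \big[Num.min/p.1]_(r <- t) r.1 by exact.
elim=> [_|q t IH ts]; first by exists p; rewrite ?big_nil// inE eqxx.
rewrite big_cons; have [] := IH; first by move=> r rt; apply: ts; rewrite inE rt orbT.
move=> r rs <-; case: leP => _; first by exists q => //; apply: ts; rewrite inE eqxx.
by exists r.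
Qed.

Lemma step_unionP s x : step_union s x <-> exists2 p, p \in s & x \in p.2.
Proof.
rewrite /step_union -bigcup_seq; split; first by move=> [p ps xp]; exists p => //; exact: mem_set.
by move=> [p ps xp]; exists p => //; exact: set_mem.
Qed.

(** Layer cake: the bottom layer has height [step_min s] over the union of all the sets, and the
    list lowered by this height describes the rest. Entries of minimal height drop out, so the list
    becomes shorter. *)
Lemma step_fun_peel s x : s != [::] -> (forall p, p \in s -> 0 <= p.1)%R ->
  step_fun s x = (step_min s * \1_(step_union s) x + step_fun (step_tail s) x)%R.
Proof.
move=> sN s0; have m0 : (0 <= step_min s)%R.
  by have [p ps <-] := step_min_in sN; exact: s0.
rewrite indicE; case: (boolP (x \in step_union s)) => [/set_mem/step_unionP[p ps xp]|nx].
  rewrite mulr1; apply/eqP; rewrite eq_le; apply/andP; split.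
    apply: step_fun_le; first by rewrite addr_ge0// step_fun_ge0.
    move=> q qs xq; have [qm|qm] := eqVneq q.1 (step_min s).
      by rewrite qm lerDl step_fun_ge0.
    rewrite -lerBlDl; apply: (@step_fun_ge _ _ ((q.1 - step_min s)%R, q.2)) => //.
    by apply/mapP; exists q => //; rewrite mem_filter qm.
  rewrite -lerBrDl; apply: step_fun_le.
    by rewrite subr_ge0 (le_trans (step_min_le ps))// step_fun_ge.
  move=> _ /mapP[q + ->] /= xq; rewrite mem_filter => /andP[_ qs].
  by rewrite lerD2r step_fun_ge.
have nxp p : p \in s -> x \in p.2 -> False.
  by move=> ps xp; move/negP: nx; apply; apply/mem_set/step_unionP; exists p.
rewrite mulr0 add0r; apply/eqP; rewrite eq_le; apply/andP; split.
  by apply: step_fun_le; [exact: step_fun_ge0|move=> p ps /(nxp _ ps)].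
apply: step_fun_le; first exact: step_fun_ge0.
by move=> _ /mapP[q + ->] /= xq; rewrite mem_filter => /andP[_ /nxp/(_ xq)].
Qed.

Lemma step_tail_admissible s : admissible s -> admissible (step_tail s).
Proof.
move=> [cs s0]; split=> _ /mapP[p + ->]; rewrite mem_filter => /andP[_ ps]/=.
  exact: cs.
by rewrite subr_ge0 step_min_le.
Qed.

Lemma size_step_tail s : s != [::] -> (size (step_tail s) < size s)%N.
Proof.
move=> sN; rewrite size_map size_filter -(count_predC (fun p => p.1 != step_min s) s).
rewrite -[X in (X < _)%N]addn0 ltn_add2l -has_count.
by have [p ps pm] := step_min_in sN; apply/hasP; exists p => //=; rewrite pm eqxx.
Qed.

Lemma compact_step_union s : admissible s -> compact (step_union s).
Proof.
move=> [cs _]; rewrite /step_union big_seq.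
elim/big_rec: _ => [|p A ps cA]; first exact: compact0.
by apply: compactU => //; exact: cs.
Qed.

(** Off the union both functions vanish, and on the union the bottom layer is constant. *)
Lemma comonotone_peel s : s != [::] -> admissible s ->
  comonotone (fun x => step_min s * \1_(step_union s) x)%R (step_fun (step_tail s)).
Proof.
move=> sN [cs s0] x y; have m0 : (0 <= step_min s)%R.
  by have [p ps <-] := step_min_in sN; exact: s0.
have out z : z \notin step_union s -> step_fun (step_tail s) z = 0%R.
  move=> nz; apply/eqP; rewrite eq_le step_fun_ge0 andbT; apply: step_fun_le => //.
  move=> _ /mapP[q + ->] /= xq; rewrite mem_filter => /andP[_ qs].
  by move/negP: nz => []; apply/mem_set/step_unionP; exists q.
rewrite !indicE; case: (boolP (x \in _)) => hx; case: (boolP (y \in _)) => hy;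
  rewrite ?mulr1 ?mulr0 ?subrr ?mul0r//.
  by rewrite (out y hy) !subr0 mulr_ge0// step_fun_ge0.
by rewrite (out x hx) !sub0r mulrNN mulr_ge0// step_fun_ge0.
Qed.

End step_functions.

(** * Random sup-measures evaluated on step functions *)

Section random_supmeasures.
Context (R : realType) (E : topologicalType) (C : nat -> set E).
Hypothesis hE : hausdorff_space E.
Hypothesis cC : compact_base C.

Lemma measurable_sup_eval_compact d (Om : measurableType d)
    (Y : Om -> set E -> \bar R) s :
  (forall K, compact K -> measurable_fun setT (fun w => Y w K)) -> admissible s ->
  measurable_fun setT (fun w => sup_eval s (Y w)).
Proof.
move=> mY; rewrite /sup_eval; elim: s => [|p s IH] [cs s0].
  by under eq_fun do rewrite big_nil; exact: measurable_cst.
under eq_fun do rewrite big_cons; apply: measurable_maxe.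
  by apply: measurable_funeM; apply: mY; apply: cs; rewrite inE eqxx.
by apply: IH; split=> q qs; [apply: cs|apply: s0]; rewrite inE qs orbT.
Qed.

Lemma measurable_sup_eval d (Om : measurableType d) (Y : Om -> set E -> \bar R) s :
  is_random_supmeasure Y -> admissible s ->
  measurable_fun setT (fun w => sup_eval s (Y w)).
Proof. by move=> [_ mY]; exact: measurable_sup_eval_compact. Qed.

Lemma sup_eval1 (u : R) K (phi : set E -> \bar R) : is_supmeasure phi -> (0 <= u)%R ->
  sup_eval [:: (u, K)] phi = u%:E * phi K.
Proof.
move=> sphi u0; rewrite /sup_eval big_cons big_nil max_l//.
by rewrite mule_ge0 ?lee_fin// supmeasure_ge0.
Qed.

Lemma step_fun1 (u : R) (K : set E) x : (0 <= u)%R ->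
  step_fun [:: (u, K)] x = (u * \1_K x)%R.
Proof. by move=> u0; rewrite /step_fun big_cons big_nil max_l// mulr_ge0. Qed.

Lemma frechet_scaleZ d (Om : measurableType d) (P : probability Om R)
    (Z : Om -> \bar R) (a u : R) : (0 <= u)%R -> (forall w, 0 <= Z w) ->
  frechet_scale P Z a -> frechet_scale P (fun w => u%:E * Z w) (u * a).
Proof.
move=> u0 Z0 [a0 Pa]; split; first exact: mulr_ge0.
move=> t t0; move: u0; rewrite le_eqVlt => /orP[/eqP <-|u0].
  rewrite (_ : mkset _ = setT) ?probability_setT ?mul0r ?oppr0 ?expR0//.
  by apply/seteqP; split => // w _ /=; rewrite mul0e lee_fin ltW.
rewrite (_ : mkset _ = [set w | Z w <= (t / u)%:E]); last first.
  by apply/seteqP; split => w /=; rewrite EFinM lee_pdivlMr// muleC.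
rewrite Pa ?divr_gt0//; congr (expR (- _))%:E; field.
by rewrite !gt_eqF.
Qed.

Context d (Om : measurableType d) (P : probability Om R) (X : Om -> set E -> \bar R).
Context d' (Om' : measurableType d') (P' : probability Om' R)
  (Y : Om' -> set E -> \bar R).
Hypothesis hX : is_random_supmeasure X.
Hypothesis hY : is_random_supmeasure Y.
Hypothesis aeY : {ae P', forall w, scaled_indicator (Y w)}.

(** The integrands enter as functions [F], [G], [H] known to be measurable, so that the lemma serves
    [sup_eval] and [ext_int] alike. *)
Lemma ae_integral_ext_int (f g : E -> R) (F G H : Om' -> \bar R) :
  USC f -> USC g -> comonotone f g ->
  measurable_fun setT F -> measurable_fun setT G -> measurable_fun setT H ->
  (forall w, ext_int f (Y w) = F w) -> (forall w, ext_int g (Y w) = G w) ->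
  (forall w, ext_int (fun x => f x + g x)%R (Y w) = H w) ->
  \int[P']_w H w = \int[P']_w F w + \int[P']_w G w.
Proof.
move=> uf ug cm mF mG mH eF eG eH.
have sY w : is_supmeasure (Y w) by case: hY.
have F0 w : 0 <= F w by rewrite -eF; exact: ext_int_ge0.
have G0 w : 0 <= G w by rewrite -eG; exact: ext_int_ge0.
have H0 w : 0 <= H w by rewrite -eH; exact: ext_int_ge0.
rewrite -ge0_integralD//; apply: ge0_ae_eq_integral => //.
- exact: emeasurable_funD.
- by move=> w _; rewrite adde_ge0.
apply: filterS aeY => w sw _.
by rewrite -eH -eF -eG; exact: ext_int_comonotone.
Qed.

Lemma integral_sup_eval_fin s : rsm_integrable P' Y -> admissible s ->
  \int[P']_w sup_eval s (Y w) \is a fin_num.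
Proof.
move=> iY; have sY w : is_supmeasure (Y w) by case: hY.
elim: s => [|p s IH] adm.
  rewrite /sup_eval; under eq_integral do rewrite big_nil.
  by rewrite integral0.
have adms : admissible s.
  by case: adm => cs s0; split=> q qs; [apply: cs|apply: s0]; rewrite inE qs orbT.
have cp : compact p.2 by case: adm => cs _; apply: cs; rewrite inE eqxx.
have p0 : (0 <= p.1)%R by case: adm => _ s0; apply: s0; rewrite inE eqxx.
have mp : measurable_fun setT (fun w => p.1%:E * Y w p.2).
  by apply: measurable_funeM; case: hY => _; exact.
have Yp0 w : 0 <= p.1%:E * Y w p.2 by rewrite mule_ge0 ?lee_fin// supmeasure_ge0.
have ms := measurable_sup_eval hY adms.
rewrite ge0_fin_numE; last by apply: integral_ge0 => w _; exact: sup_eval_ge0.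
apply: (@le_lt_trans _ _ (\int[P']_w (p.1%:E * Y w p.2 + sup_eval s (Y w)))).
  apply: ge0_le_integral => //.
  - by move=> w _; exact: sup_eval_ge0.
  - exact: measurable_sup_eval.
  - exact: emeasurable_funD.
  - move=> w _; rewrite /sup_eval big_cons ge_max; apply/andP; split.
      by rewrite leeDl// sup_eval_ge0.
    by rewrite leeDr.
rewrite ge0_integralD//; last by move=> w _; exact: sup_eval_ge0.
apply: lte_add_pinfty; last first.
  by rewrite -ge0_fin_numE ?IH//; apply: integral_ge0 => w _; exact: sup_eval_ge0.
rewrite ge0_integralZl_EFin//.
- have K0 : 0 <= \int[P']_w Y w p.2 by apply: integral_ge0 => w _; exact: supmeasure_ge0.
  have fK : \int[P']_w Y w p.2 \is a fin_num by rewrite ge0_fin_numE// iY.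
  by rewrite -(fineK fK) -EFinM ltry.
- by move=> w _; exact: supmeasure_ge0.
- by case: hY => _; exact.
Qed.

(** Induction on the length of the list. A peeled layer contributes the same amount on both sides:
    for [X] by additivity of the tail dependence functional, for [Y] because a scaled indicator
    integrates comonotone functions additively. So single compact sets decide everything. *)
Lemma CRSM_sup_eval : is_CRSM P X -> rsm_integrable P' Y ->
  (forall K, compact K ->
     frechet_scale P (fun w => X w K) (fine (\int[P']_w Y w K))) ->
  forall s, admissible s ->
  frechet_scale P (fun w => sup_eval s (X w)) (fine (\int[P']_w sup_eval s (Y w))).
Proof.
move=> [_ cX] iY YX s; have [n] := ubnP (size s); elim: n s => // n IH s sn adm.
have sX w : is_supmeasure (X w) by case: hX.
have sY w : is_supmeasure (Y w) by case: hY.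
have [->|sN] := eqVneq s [::].
  rewrite /sup_eval; under eq_integral do rewrite big_nil.
  rewrite integral0/=; split => // t t0; rewrite mul0r oppr0 expR0.
  rewrite (_ : mkset _ = setT) ?probability_setT//.
  by apply/seteqP; split => // w _ /=; rewrite big_nil lee_fin ltW.
set u := step_min s; set K := step_union s; set s' := step_tail s.
have u0 : (0 <= u)%R.
  by have [p ps pm] := step_min_in sN; rewrite /u -pm; case: adm => _; exact.
have cK : compact K by exact: compact_step_union.
have adm' : admissible s' by exact: step_tail_admissible.
have adm1 : admissible [:: (u, K)] by split=> p; rewrite inE => /eqP ->.
have sz : (size s' < n)%N.
  by rewrite (leq_trans (size_step_tail sN)).
have IHs' := IH s' sz adm'.
have uf : USC (step_fun [:: (u, K)]) by exact: (USC_step_fun hE).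
have ug : USC (step_fun s') by exact: (USC_step_fun hE).
have cm : comonotone (step_fun [:: (u, K)]) (step_fun s').
  have := comonotone_peel sN adm; congr (comonotone _ _).
  by apply/funext => x; rewrite step_fun1.
have eF w := ext_int_step_fun hE cC adm1 (sX w).
have eG w := ext_int_step_fun hE cC adm' (sX w).
have fgE : (fun x => step_fun [:: (u, K)] x + step_fun s' x)%R = step_fun s.
  apply/funext => x; rewrite step_fun1// (step_fun_peel x sN)//.
  by case: adm.
have [a [b [ta tb tab]]] := cX _ _ uf ug cm.
move: ta; rewrite /tail_dep; under eq_fun do rewrite eF sup_eval1//.
move=> ta; have := frechet_scaleZ u0 (fun w => supmeasure_ge0 (sX w) K) (YX K cK).
move=> /(frechet_scale_unique ta) aE.
move: tb; rewrite /tail_dep; under eq_fun do rewrite eG.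
move=> /frechet_scale_unique/(_ IHs') bE.
move: tab; rewrite /tail_dep fgE.
under eq_fun do rewrite (ext_int_step_fun hE cC adm)//.
suff -> : (a + b = fine (\int[P']_w sup_eval s (Y w)))%R by [].
rewrite aE bE.
rewrite (ae_integral_ext_int uf ug cm (F := fun w => sup_eval [:: (u, K)] (Y w))
  (G := fun w => sup_eval s' (Y w)) (H := fun w => sup_eval s (Y w))); last 6 first.
- exact: measurable_sup_eval.
- exact: measurable_sup_eval.
- exact: measurable_sup_eval.
- by move=> w; exact: (ext_int_step_fun hE cC).
- by move=> w; exact: (ext_int_step_fun hE cC).
- by move=> w; rewrite fgE; exact: (ext_int_step_fun hE cC).
rewrite (@fineD _ (\int[P']_w sup_eval [:: (u, K)] (Y w)));
  try exact: integral_sup_eval_fin.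
congr (_ + _)%R.
under [in RHS]eq_integral do rewrite sup_eval1//.
rewrite ge0_integralZl_EFin//.
- have K0 : 0 <= \int[P']_w Y w K by apply: integral_ge0 => w _; exact: supmeasure_ge0.
  by rewrite fineM// ge0_fin_numE// iY.
- by move=> w _; exact: supmeasure_ge0.
- by case: hY => _; exact.
Qed.

End random_supmeasures.

(** * Joint laws of the LePage series *)

Lemma measure_eq_off_null d (Om : measurableType d) (R : realType)
    (P : probability Om R) (N A B : set Om) :
  measurable N -> measurable A -> measurable B -> P N = 0 ->
  (forall w, ~ N w -> A w <-> B w) -> P A = P B.
Proof.
move=> mN mA mB PN AB.
have E D : measurable D -> P D = P (D `\` N).
  move=> mD; rewrite -(@measureU0 _ _ _ P (D `\` N) (D `&` N)).
  - by congr (P _); rewrite setUC setUIDK.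
  - exact: measurableD.
  - exact: measurableI.
  - by apply: subset_measure0 PN => //; exact: measurableI.
rewrite E// [RHS]E//; congr (P _); apply/seteqP; split => w [Dw Nw]; split => //; exact/AB.
Qed.

Section scaled_cdf.
Context (R : realType) (n : nat).

(** Turns a constraint [z <= t] into a multiple of [z] bounded by 1; the level [+oo] constrains
    nothing and gets multiplier 0. *)
Definition inv_level (t : \bar R) : R := if t is x%:E then x^-1%R else 0%R.

Lemma inv_level_ge0 t : 0 <= t -> (0 <= inv_level t)%R.
Proof. by case: t => [x| |]//=; rewrite lee_fin invr_ge0. Qed.

Lemma inv_levelP (t z : \bar R) : 0 < t -> 0 <= z ->
  ((inv_level t)%:E * z <= 1) = (z <= t).
Proof.
case: t => [x| |]//=; last by rewrite mul0e lee01 leey.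
by rewrite lte_fin => x0 z0; rewrite muleC lee_pdivrMr// mul1e.
Qed.

Context d1 d2 (Om1 : measurableType d1) (Om2 : measurableType d2).
Variables (P1 : probability Om1 R) (P2 : probability Om2 R).
Variables (Z1 : Om1 -> 'I_n -> \bar R) (Z2 : Om2 -> 'I_n -> \bar R).
Hypothesis mZ1 : forall i, measurable_fun setT (Z1 ^~ i).
Hypothesis mZ2 : forall i, measurable_fun setT (Z2 ^~ i).

Let mset d (Om : measurableType d) (Z : Om -> 'I_n -> \bar R) (t : 'I_n -> \bar R) :
  (forall i, measurable_fun setT (Z ^~ i)) -> measurable [set w | forall i, Z w i <= t i].
Proof.
move=> mZ; rewrite (_ : mkset _ = \bigcap_(i in [set: 'I_n]) (Z ^~ i @^-1` [set x | x <= t i])).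
  apply: fin_bigcap_measurable => // i _; apply: measurable_preimageT => //.
  have -> : [set x : \bar R | x <= t i] = [set` `]-oo, t i]].
    by apply/seteqP; split => x /=; rewrite in_itv.
  exact: emeasurable_itv.
by apply/seteqP; split => w Zw i; [move=> _|]; exact: Zw.
Qed.

Variables (N1 : set Om1) (N2 : set Om2).
Hypotheses (mN1 : measurable N1) (mN2 : measurable N2).
Hypotheses (PN1 : P1 N1 = 0) (PN2 : P2 N2 = 0).
Hypothesis Z10 : forall w i, ~ N1 w -> 0 <= Z1 w i.
Hypothesis Z20 : forall w i, ~ N2 w -> 0 <= Z2 w i.
Hypothesis Z12 : forall u : 'I_n -> R, (forall i, (0 <= u i)%R) ->
  P1 [set w | forall i, (u i)%:E * Z1 w i <= 1] =
  P2 [set w | forall i, (u i)%:E * Z2 w i <= 1].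

Let pos_case (t : 'I_n -> \bar R) : (forall i, 0 < t i) ->
  P1 [set w | forall i, Z1 w i <= t i] = P2 [set w | forall i, Z2 w i <= t i].
Proof.
move=> t0.
have mu d (Om : measurableType d) (Z : Om -> 'I_n -> \bar R) :
    (forall i, measurable_fun setT (Z ^~ i)) ->
    measurable [set w | forall i, (inv_level (t i))%:E * Z w i <= 1].
  move=> mZ; apply: (@mset _ _ (fun w i => (inv_level (t i))%:E * Z w i) (fun=> 1)) => i.
  exact: measurable_funeM.
rewrite (measure_eq_off_null mN1 (mset _ mZ1) (mu _ _ _ mZ1) PN1); last first.
  by move=> w Nw; split => H i; have := H i; rewrite inv_levelP// Z10.
rewrite (measure_eq_off_null mN2 (mset _ mZ2) (mu _ _ _ mZ2) PN2); last first.
  by move=> w Nw; split => H i; have := H i; rewrite inv_levelP// Z20.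
by apply: Z12 => i; exact/inv_level_ge0/ltW.
Qed.

(** Positive levels, including [+oo], come from multipliers by [inv_level]. If some level is
    negative, both events are null; if all are non-negative, they are approached from the right by
    positive ones. *)
Lemma cdf_eq_of_scaled (t : 'I_n -> \bar R) :
  P1 [set w | forall i, Z1 w i <= t i] = P2 [set w | forall i, Z2 w i <= t i].
Proof.
have [t0|/existsNP[i /negP]] := pselect (forall i, 0 <= t i); last first.
  rewrite -ltNge => ti.
  have null d (Om : measurableType d) (P : probability Om R) (Z : Om -> 'I_n -> \bar R) N :
      (forall i, measurable_fun setT (Z ^~ i)) -> measurable N -> P N = 0 ->
      (forall w i, ~ N w -> 0 <= Z w i) ->
      P [set w | forall i, Z w i <= t i] = 0.
    move=> mZ mN PN Z0; rewrite (measure_eq_off_null mN (mset t mZ) measurable0 PN) ?measure0//.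
    move=> w Nw; split => // /(_ i) /(le_trans (Z0 w i Nw)).
    by rewrite leNgt ti.
  by rewrite (null _ _ P1 Z1 N1)// (null _ _ P2 Z2 N2).
pose tm (m : nat) i := t i + (m.+1%:R^-1)%:E.
have tm0 m i : 0 < tm m i.
  apply: (@lt_le_trans _ _ (m.+1%:R^-1)%:E); last by rewrite /tm leeDr.
  by rewrite lte_fin invr_gt0 ltr0n.
have cv d (Om : measurableType d) (P : probability Om R) (Z : Om -> 'I_n -> \bar R) :
    (forall i, measurable_fun setT (Z ^~ i)) ->
    P [set w | forall i, Z w i <= tm m i] @[m --> \oo] --> P [set w | forall i, Z w i <= t i].
  move=> mZ.
  have -> : [set w | forall i, Z w i <= t i] =
      \bigcap_m [set w | forall i, Z w i <= tm m i].
    apply/seteqP; split => w /= Zw.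
      by move=> m _ j; apply: le_trans (Zw j) _; rewrite leeDl// lee_fin invr_ge0.
    move=> j; move: (t0 j) (fun m => Zw m Logic.I j); rewrite /tm.
    case: (t j) => [x| |]//; last by move=> _ _; rewrite leey.
    move=> _ H; apply/lee_addgt0Pr => e e0.
    pose m := Num.truncn e^-1.
    apply: le_trans (H m) _; rewrite -EFinD lee_fin lerD2l.
    rewrite -[leRHS]invrK lef_pV2 ?posrE ?invr_gt0//.
    by rewrite ltW// truncnS_gt.
  apply: nonincreasing_cvg_mu.
  - by rewrite (le_lt_trans (probability_le1 _ _)) ?ltry//; exact: mset.
  - by move=> m; exact: mset.
  - by apply: bigcapT_measurable => m; exact: mset.
  - move=> a b ab; apply/subsetPset => w /= Zw j.
    apply: le_trans (Zw j) _; rewrite /tm leeD2l// lee_fin.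
    by rewrite lef_pV2 ?posrE// ler_nat.
have c1 := cv _ _ P1 _ mZ1; have c2 := cv _ _ P2 _ mZ2.
rewrite -(cvg_lim (@ereal_hausdorff R) c1) -(cvg_lim (@ereal_hausdorff R) c2).
by apply: congr_lim; apply/funext => m; exact: pos_case.
Qed.

End scaled_cdf.

Lemma measurable_invR (R : realType) : measurable_fun setT (fun x : R => x^-1%R).
Proof.
rewrite (_ : (fun _ => _) =
    (fun x : R => if (0 <= x)%R then (x `^ (-1))%R else (- (- x) `^ (-1))%R)).
  apply: measurable_fun_if => //; first exact: measurable_fun_ler.
    by apply: measurable_funTS; exact: measurable_powR.
  apply: measurable_funTS; apply: measurableT_comp => //.
  by apply: (measurableT_comp (measurable_powR (-1))).
apply/funext => x; case: leP => x0; first by rewrite powR_inv1.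
by rewrite powR_inv1 ?oppr_ge0 ?ltW// invrN opprK.
Qed.

Lemma measurable_ereal_sup_range d (T : measurableType d) (R : realType)
    (f : nat -> T -> \bar R) : (forall n, measurable_fun setT (f n)) ->
  measurable_fun setT (fun x => ereal_sup (range (f ^~ x))).
Proof.
move=> mf; have := measurable_fun_esups mf 0%N; congr (measurable_fun _ _).
apply/funext => x; rewrite /esups; congr ereal_sup.
by apply/seteqP; split => _ [n _ <-]; exists n.
Qed.

Section lepage_rep.
Context (R : realType) (E : topologicalType) (C : nat -> set E).
Hypothesis hE : hausdorff_space E.
Hypothesis cC : compact_base C.

Lemma sup_eval_le (s : seq (R * set E)) phi (r : \bar R) : 0 <= r ->
  is_true (sup_eval s phi <= r) = (forall p, p \in s -> p.1%:E * phi p.2 <= r).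
Proof.
move=> r0; rewrite /sup_eval; apply/propext; split => [H p ps|H].
  by apply: le_trans H; exact: (@le_bigmax_seq _ (\bar R) _ s 0 p xpredT
    (fun p => p.1%:E * phi p.2) ps isT).
by rewrite big_seq; apply: bigmax_le.
Qed.

Lemma sup_eval_fin (s : seq (R * set E)) phi : is_supmeasure phi -> admissible s ->
  sup_eval s phi \is a fin_num.
Proof.
move=> sphi [cs s0]; rewrite ge0_fin_numE ?sup_eval_ge0// /sup_eval big_seq.
apply: bigmax_lt => [|p ps]; first exact: ltry.
by rewrite -(fineK (supmeasure_fin sphi (cs p ps))) -EFinM ltry.
Qed.

Definition family_seq n (u : 'I_n -> R) (K : 'I_n -> set E) : seq (R * set E) :=
  [seq (u i, K i) | i <- enum 'I_n].

Lemma family_seq_admissible n (u : 'I_n -> R) (K : 'I_n -> set E) :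
  (forall i, compact (K i)) -> (forall i, 0 <= u i)%R -> admissible (family_seq u K).
Proof.
by move=> cK u0; split=> _ /mapP[i _ ->] /=; [exact: cK|exact: u0].
Qed.

Lemma family_seqP n (u : 'I_n -> R) (K : 'I_n -> set E) (Q : R * set E -> Prop) :
  (forall p, p \in family_seq u K -> Q p) = (forall i, Q (u i, K i)).
Proof.
apply/propext; split=> [H i|H _ /mapP[i _ ->]//].
by apply: H; apply/mapP; exists i; rewrite ?mem_enum.
Qed.

Context d (Om : measurableType d) (P : probability Om R).
Variables (T : nat -> Om -> R) (Y : nat -> Om -> set E -> \bar R).
Hypothesis expT : forall i, std_exponential P (T i).
Hypothesis rY : forall i, is_random_supmeasure (Y i).
Hypothesis lawY : forall i, fdd_eq P (Y i) P (Y 0%N).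

Let F (k : nat + nat) : set (set Om) := match k with
  | inl i => gen_sigma [set (fun w => (T i w)%:E)]
  | inr i => gen_sigma [set (fun w => Y i w K) | K in compact] end.

Hypothesis indF : mutually_independent P F.
Hypothesis iY : rsm_integrable P (Y 0%N).

Let sY i w : is_supmeasure (Y i w). Proof. by case: (rY i). Qed.

Let saF k : sigma_algebra setT (F k).
Proof. by case: k => i; apply: smallest_sigma_algebra. Qed.

Let gen_sigma_measurable (fs : set (Om -> \bar R)) :
  (forall f, fs f -> measurable_fun setT f) -> gen_sigma fs `<=` measurable.
Proof.
move=> mfs; apply: smallest_sub; first exact: sigma_algebra_measurable.
move=> _ [f [B [fsf mB ->]]]; apply: measurable_preimageT => //; exact: mfs.
Qed.

Let mF k : F k `<=` measurable.
Proof.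
case: k => i; apply: gen_sigma_measurable.
  by move=> _ ->; apply/measurable_EFinP; case: (expT i).
by move=> _ [K cK <-]; case: (rY i) => _; exact.
Qed.

Let FT i B : measurable B -> F (inl i) (T i @^-1` B).
Proof.
move=> mB; apply: sub_sigma_algebra; exists (fun w => (T i w)%:E), (fine @^-1` B).
split => //; exact: (measurable_preimageT (fine_measurable measurableT)).
Qed.

Let FY i s B : admissible s -> measurable B ->
  F (inr i) ((fun w => fine (sup_eval s (Y i w))) @^-1` B).
Proof.
move=> adm mB.
(* Measurability is checked for the sigma-algebra generated by [Y i] alone, as independence
   demands. *)
pose Om' := g_sigma_algebraType [set A | exists f (B : set (\bar R)),
  [/\ [set (fun w => Y i w K) | K in compact] f, measurable B & A = f @^-1` B]].
have mY : forall K, compact K -> measurable_fun setT ((fun w => Y i w K) : Om' -> \bar R).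
  move=> K cK _ B' mB'; rewrite setTI; apply: sub_sigma_algebra.
  by exists (fun w => Y i w K), B'; split => //; exists K.
have ms := measurable_sup_eval_compact mY adm.
have mf : measurable_fun setT (fun w : Om' => fine (sup_eval s (Y i w))).
  by apply: (measurableT_comp _ ms); exact: fine_measurable.
exact: (measurable_preimageT mf mB).
Qed.

Let N := \bigcup_j [set w | (T j w <= 0)%R].

Let mT i : measurable_fun setT (T i). Proof. by case: (expT i). Qed.

Lemma measurable_lepage_null : measurable N.
Proof. by apply: bigcup_measurable => j _; exact: measurable_set_le. Qed.

Lemma lepage_null : P N = 0.
Proof.
apply/eqP; rewrite eq_le measure_ge0 andbT.
apply: (@le_trans _ _ (\sum_(j <oo) P [set w | (T j w <= 0)%R])).
  apply: measure_sigma_subadditive => //.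
  - by move=> j; exact: measurable_set_le.
  - exact: measurable_lepage_null.
by rewrite eseries0// => j _ _; exact: exponential_null.
Qed.

Let gam_gt0 w j : ~ N w -> (0 < poisson_points T j w)%R.
Proof.
move=> Nw; have T0 k : (0 < T k w)%R.
  by rewrite ltNge; apply/negP => Tk; apply: Nw; exists k.
rewrite /poisson_points big_ord_recr/= ltr_wpDl// sumr_ge0// => i _; exact: ltW.
Qed.

Lemma lepage_sup_ge0 w A : ~ N w -> 0 <= lepage_sup T Y w A.
Proof.
move=> Nw; apply: (@le_trans _ _ ((poisson_points T 0 w)^-1%:E * Y 0%N w A)).
  by rewrite mule_ge0 ?supmeasure_ge0// lee_fin invr_ge0 ltW// gam_gt0.
by apply: ereal_sup_ubound; exists 0%N.
Qed.

Let mgam j : measurable_fun setT (poisson_points T j).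
Proof. by apply: measurable_sum => i. Qed.

Lemma measurable_lepage_sup K : compact K ->
  measurable_fun setT (fun w => lepage_sup T Y w K).
Proof.
move=> cK; apply: measurable_ereal_sup_range => j.
apply: emeasurable_funM; last by case: (rY j) => _; exact.
by apply/measurable_EFinP; apply: (measurableT_comp (@measurable_invR R)).
Qed.

(** Multiplied by [Gamma_j], the event says that [max_i u_i Y_j(K_i) <= Gamma_j] for every [j]. With
    these maxima as [W j], [lepage_probability] gives the value. *)
Lemma lepage_scaled n (u : 'I_n -> R) (K : 'I_n -> set E) :
  (forall i, compact (K i)) -> (forall i, 0 <= u i)%R ->
  P [set w | forall i, (u i)%:E * lepage_sup T Y w (K i) <= 1] =
  (expR (- fine (\int[P]_w sup_eval (family_seq u K) (Y 0%N w))))%:E.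
Proof.
move=> cK u0; set s := family_seq u K.
have adm : admissible s by exact: family_seq_admissible.
pose W j w := fine (sup_eval s (Y j w)).
have WE j w : (W j w)%:E = sup_eval s (Y j w) by rewrite fineK// sup_eval_fin.
have W0 j w : (0 <= W j w)%R by rewrite -lee_fin WE sup_eval_ge0.
have lawW j x : P [set w | (W j w <= x)%R] = P [set w | (W 0%N w <= x)%R].
  have [x0|x0] := ltP x 0%R.
    have E0 k : [set w | (W k w <= x)%R] = set0.
      by apply/seteqP; split => // w /= /le_lt_trans/(_ x0); rewrite ltNge W0.
    by rewrite !E0.
  (* Where [u i] is 0 the value on [K i] is not constrained, hence the level [+oo]. In this form
     [fdd_eq] shows that the [W j] have the same law. *)
  pose t i : \bar R := if u i == 0%R then +oo else (x / u i)%:E.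
  have EW k : [set w | (W k w <= x)%R] = [set w | forall i, Y k w (K i) <= t i].
    apply/seteqP; split => w /=.
      rewrite -lee_fin WE sup_eval_le ?lee_fin// family_seqP => H i.
      rewrite /t; case: eqVneq => [_|ui]; first by rewrite leey.
      have ui0 : (0 < u i)%R by rewrite lt_neqAle eq_sym ui u0.
      by rewrite EFinM lee_pdivlMr// muleC; exact: H.
    move=> H; rewrite -lee_fin WE sup_eval_le ?lee_fin// family_seqP => i /=.
    have := H i; rewrite /t; case: eqVneq => [-> _|ui]; first by rewrite mul0e lee_fin.
    have ui0 : (0 < u i)%R by rewrite lt_neqAle eq_sym ui u0.
    by rewrite EFinM lee_pdivlMr// muleC.
  by rewrite !EW; apply: lawY.
have iW : \int[P]_w (W 0%N w)%:E < +oo.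
  under eq_integral do rewrite WE.
  rewrite -ge0_fin_numE; last by apply: integral_ge0 => w _; exact: sup_eval_ge0.
  exact: (integral_sup_eval_fin (rY 0)).
have FW i B : measurable B -> F (inr i) (W i @^-1` B) by move=> mB; exact: FY.
have := lepage_probability saF mF indF expT FT FW W0 lawW iW.
under eq_integral do rewrite WE.
move=> <-; apply: (measure_eq_off_null measurable_lepage_null _ _ lepage_null).
- rewrite (_ : mkset _ = \bigcap_(i in [set: 'I_n])
      ((fun w => (u i)%:E * lepage_sup T Y w (K i)) @^-1` [set x | x <= 1])).
    apply: fin_bigcap_measurable => // i _; apply: measurable_preimageT.
      by apply: measurable_funeM; exact: measurable_lepage_sup.
    have -> : [set x : \bar R | x <= 1] = [set` `]-oo, 1%E]].
      by apply/seteqP; split => x /=; rewrite in_itv.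
    exact: emeasurable_itv.
  by apply/seteqP; split => w Zw i; [move=> _|]; exact: Zw.
- rewrite (_ : mkset _ = \bigcap_i [set w | (W i w - poisson_points T i w <= 0)%R]).
    apply: bigcapT_measurable => i; apply: measurable_set_le.
    apply: measurable_funB => //.
    by apply: (measurableT_comp (fine_measurable measurableT)); exact: measurable_sup_eval.
  apply/seteqP; split => w /=; first by move=> H i _ /=; rewrite subr_le0.
  by move=> H i; have := H i Logic.I; rewrite /= subr_le0.
move=> w Nw; split => [H j|H i].
  have g0 := gam_gt0 j Nw.
  rewrite -lee_fin WE sup_eval_le ?lee_fin ?ltW// family_seqP => i /=.
  have ui := u0 i.
  have : (u i)%:E * ((poisson_points T j w)^-1%:E * Y j w (K i)) <= 1.
    apply: le_trans (H i); apply: lee_wpmul2l; first by rewrite lee_fin.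
    by apply: ereal_sup_ubound; exists j.
  by rewrite muleCA muleC lee_pdivrMr// mul1e.
have [ui|ui] := eqVneq (u i) 0%R; first by rewrite ui mul0e lee01.
have ui0 : (0 < u i)%R by rewrite lt_neqAle eq_sym ui u0.
rewrite muleC -lee_pdivlMr//; apply: ub_ereal_sup => _ [j _ <-].
have g0 := gam_gt0 j Nw.
rewrite lee_pdivlMr// -muleA muleC lee_pdivrMr// mul1e muleC.
have := H j; rewrite -lee_fin WE sup_eval_le ?lee_fin ?(ltW g0)// => /(_ (u i, K i)); apply.
by apply/mapP; exists i; rewrite ?mem_enum.
Qed.

End lepage_rep.

Lemma sup_evalZ (R : realType) (E : topologicalType) (c : R) (s : seq (R * set E)) phi :
  (0 <= c)%R ->
  sup_eval [seq (c * p.1, p.2)%R | p <- s] phi = c%:E * sup_eval s phi.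
Proof.
move=> c0; rewrite /sup_eval; elim: s => [|p s IH]; first by rewrite !big_nil mule0.
rewrite /= !big_cons IH /= maxe_pMr ?lee_fin// EFinM muleA; congr maxe.
Qed.

Lemma sup_eval_ge (R : realType) (E : topologicalType) (s : seq (R * set E)) phi u K :
  (u, K) \in s -> u%:E * phi K <= sup_eval s phi.
Proof.
move=> ps; have := lexx (sup_eval s phi).
by rewrite sup_eval_le ?sup_eval_ge0// => /(_ _ ps).
Qed.

(** * The CRSM property from the scaled joint laws *)

Section crsm_of_scaled.
Context (R : realType) (E : topologicalType) (C : nat -> set E).
Hypothesis hE : hausdorff_space E.
Hypothesis cC : compact_base C.

Definition level_seq (f : E -> R) (N : nat) : seq (R * set E) :=
  [seq (posrat m, [set x | (posrat m <= f x)%R]) | m <- iota 0 N].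

Lemma level_seq_admissible f N : USC f -> admissible (level_seq f N).
Proof.
move=> uf; split=> _ /mapP[m _ ->] /=; last by rewrite ltW// posrat_gt0.
by apply: usc_level_compact => //; exact: posrat_gt0.
Qed.

Lemma sup_eval_level_nd f phi : is_supmeasure phi ->
  nondecreasing_seq (fun N => sup_eval (level_seq f N) phi).
Proof.
move=> sphi M N MN; rewrite sup_eval_le ?sup_eval_ge0// => _ /mapP[m + ->] /=.
rewrite mem_iota/= add0n => mM.
apply: sup_eval_ge; apply/mapP; exists m => //; rewrite mem_iota/= add0n.
exact: leq_trans MN.
Qed.

(** Extremal integrals are increasing limits of values on step functions, so results pass from
    [sup_eval] to [ext_int] by monotone convergence. *)
Lemma ext_int_level (f : E -> R) phi : USC f -> is_supmeasure phi ->
  ext_int f phi = ereal_sup (range (fun N => sup_eval (level_seq f N) phi)).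
Proof.
move=> uf sphi; rewrite (ext_int_posrat uf sphi).
apply/eqP; rewrite eq_le; apply/andP; split.
  apply: ub_ereal_sup => _ [n _ <-].
  apply: (@le_trans _ _ (sup_eval (level_seq f n.+1) phi)).
    apply: sup_eval_ge; apply/mapP; exists n => //.
    by rewrite mem_iota add0n ltnSn.
  by apply: ereal_sup_ubound; exists n.+1.
have S0 : 0 <= ereal_sup (range (fun n => (posrat n)%:E * phi [set x | (posrat n <= f x)%R])).
  by rewrite -(ext_int_posrat uf sphi) ext_int_ge0.
apply: ub_ereal_sup => _ [N _ <-]; rewrite sup_eval_le// => _ /mapP[m _ ->] /=.
by apply: ereal_sup_ubound; exists m.
Qed.

Lemma ext_int_level_cvg f phi : USC f -> is_supmeasure phi ->
  sup_eval (level_seq f N) phi @[N --> \oo] --> ext_int f phi.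
Proof.
move=> uf sphi; rewrite (ext_int_level uf sphi); apply: ereal_nondecreasing_cvgn.
exact: sup_eval_level_nd.
Qed.

Lemma ext_int_le_support (f : E -> R) (M : R) (phi : set E -> \bar R) : USC f -> is_supmeasure phi ->
  (0 <= M)%R -> (forall x, f x <= M)%R ->
  ext_int f phi <= M%:E * phi (closure [set x | f x != 0%R]).
Proof.
move=> [_ f0 _ _] sphi M0 fM; have p0 := supmeasure_ge0 sphi.
apply: ext_int_lower => //; first by rewrite mule_ge0// lee_fin.
move=> K c cK c0 Kc.
have [[x Kx]|K0] := pselect (K !=set0); last first.
  rewrite (_ : K = set0) ?(supmeasure0 sphi) ?mul0e ?mule_ge0 ?lee_fin//.
  by apply/seteqP; split => // x Kx; case: K0; exists x.
rewrite muleC; apply: lee_pmul => //; first by rewrite lee_fin ltW.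
  by rewrite lee_fin (le_trans (Kc x Kx)).
apply: (supmeasure_le sphi) => y Ky; apply: subset_closure => /=.
by rewrite gt_eqF// (lt_le_trans c0)// Kc.
Qed.

Context d (Om : measurableType d) (P : probability Om R) (X : Om -> set E -> \bar R).
Context d' (Om' : measurableType d') (P' : probability Om' R)
  (Y : Om' -> set E -> \bar R).
Hypothesis hX : is_random_supmeasure X.
Hypothesis hY : is_random_supmeasure Y.
Hypothesis iY : rsm_integrable P' Y.
Hypothesis aeY : {ae P', forall w, scaled_indicator (Y w)}.
Hypothesis scaledXY : forall n (u : 'I_n -> R) (K : 'I_n -> set E),
  (forall i, compact (K i)) -> (forall i, 0 <= u i)%R ->
  P [set w | forall i, (u i)%:E * X w (K i) <= 1] =
  (expR (- fine (\int[P']_w sup_eval (family_seq u K) (Y w))))%:E.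

Let sX w : is_supmeasure (X w). Proof. by case: hX. Qed.
Let sY w : is_supmeasure (Y w). Proof. by case: hY. Qed.

Lemma measurable_ext_int d0 (Om0 : measurableType d0) (Z : Om0 -> set E -> \bar R) f :
  is_random_supmeasure Z -> USC f -> measurable_fun setT (fun w => ext_int f (Z w)).
Proof.
move=> hZ uf; have sZ w : is_supmeasure (Z w) by case: hZ.
under eq_fun do rewrite (ext_int_level uf (sZ _)).
apply: measurable_ereal_sup_range => N.
by apply: measurable_sup_eval => //; exact: level_seq_admissible.
Qed.

(** The event at level [t] is the event at level 1 for the heights divided by [t], and the
    expectation is homogeneous in the heights. *)
Lemma frechet_sup_eval s : admissible s ->
  frechet_scale P (fun w => sup_eval s (X w)) (fine (\int[P']_w sup_eval s (Y w))).
Proof.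
move=> adm; split.
  by apply: fine_ge0; apply: integral_ge0 => w _; exact: sup_eval_ge0.
move=> t t0; pose x0 : R * set E := (0%R, set0).
have t10 : (0 <= t^-1)%R by rewrite invr_ge0 ltW.
pose u (i : 'I_(size s)) := (t^-1 * (nth x0 s i).1)%R; pose K (i : 'I_(size s)) := (nth x0 s i).2.
have sE : family_seq u K = [seq (t^-1 * p.1, p.2)%R | p <- s].
  rewrite -[X in map _ X](mkseq_nth x0 s) /mkseq -map_comp -val_enum_ord -map_comp.
  by apply: eq_map.
have cs i : compact (K i) by case: adm => cs _; apply: cs; rewrite mem_nth.
have u0 i : (0 <= u i)%R.
  by rewrite mulr_ge0//; case: adm => _ s0; apply: s0; rewrite mem_nth.
rewrite (_ : mkset _ = [set w | forall i, (u i)%:E * X w (K i) <= 1]); last first.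
  apply/seteqP; split => w /=.
    rewrite sup_eval_le ?lee_fin ?ltW// => H i.
    rewrite /u EFinM -muleA muleC lee_pdivrMr// mul1e.
    by apply: H; rewrite mem_nth.
  move=> H; rewrite sup_eval_le ?lee_fin ?ltW// => p ps.
  have ip : (index p s < size s)%N by rewrite index_mem.
  have := H (Ordinal ip); rewrite /u /K /= nth_index//.
  by rewrite EFinM -muleA muleC lee_pdivrMr// mul1e.
rewrite scaledXY// sE; congr (expR (- _))%:E.
under eq_integral do rewrite sup_evalZ//.
rewrite ge0_integralZl_EFin//.
- by rewrite fineM ?(integral_sup_eval_fin hY)// mulrC.
- by move=> w _; exact: sup_eval_ge0.
- exact: measurable_sup_eval.
Qed.

Lemma frechet_indic K : compact K ->
  frechet_scale P (fun w => X w K) (fine (\int[P']_w Y w K)).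
Proof.
move=> cK; have adm : admissible [:: (1%R : R, K)] by split=> p; rewrite inE => /eqP ->.
have := frechet_sup_eval adm.
under eq_fun do rewrite sup_eval1// mul1e.
by under eq_integral do rewrite sup_eval1// mul1e.
Qed.

Let integral_ext_int_fin f : USC f -> \int[P']_w ext_int f (Y w) \is a fin_num.
Proof.
move=> uf; have [[M fM] f0 _ cf] := uf.
have M0 : (0 <= Num.max M 0)%R by rewrite le_max lexx orbT.
have fM' x : (f x <= Num.max M 0)%R by rewrite le_max fM.
have [_ mY] := hY.
rewrite ge0_fin_numE; last by apply: integral_ge0 => w _; exact: ext_int_ge0.
apply: (@le_lt_trans _ _ (\int[P']_w ((Num.max M 0)%:E * Y w (closure [set x | f x != 0%R])))).
  apply: ge0_le_integral => //.
  - by move=> w _; exact: ext_int_ge0.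
  - exact: measurable_ext_int.
  - by apply: measurable_funeM; exact: mY.
  - by move=> w _; exact: ext_int_le_support.
rewrite ge0_integralZl_EFin//; last 2 first.
- by move=> w _; exact: supmeasure_ge0.
- exact: mY.
have K0 : 0 <= \int[P']_w Y w (closure [set x | f x != 0%R]).
  by apply: integral_ge0 => w _; exact: supmeasure_ge0.
have fK : \int[P']_w Y w (closure [set x | f x != 0%R]) \is a fin_num.
  by rewrite ge0_fin_numE// iY.
by rewrite -(fineK fK) -EFinM ltry.
Qed.

(** Both sides are limits along [level_seq f N]: the events decrease, and the expectations converge
    monotonically. *)
Lemma frechet_ext_int f : USC f ->
  frechet_scale P (fun w => ext_int f (X w)) (fine (\int[P']_w ext_int f (Y w))).
Proof.
move=> uf; have adm N := level_seq_admissible N uf.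
split.
  by apply: fine_ge0; apply: integral_ge0 => w _; exact: ext_int_ge0.
move=> t t0.
pose cN N := fine (\int[P']_w sup_eval (level_seq f N) (Y w)).
have ccv : cN N @[N --> \oo] --> fine (\int[P']_w ext_int f (Y w)).
  apply: fine_cvg; rewrite fineK ?integral_ext_int_fin//.
  rewrite (eq_integral (fun w => limn (fun N => sup_eval (level_seq f N) (Y w)))).
    apply: cvg_monotone_convergence => //.
    - by move=> N; exact: measurable_sup_eval.
    - by move=> N w _; exact: sup_eval_ge0.
    - by move=> w _; exact: sup_eval_level_nd.
  by move=> w _; apply/esym/cvg_lim => //; exact: ext_int_level_cvg.
have Pcv : P [set w | sup_eval (level_seq f N) (X w) <= t%:E] @[N --> \oo] -->
    P [set w | ext_int f (X w) <= t%:E].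
  have mN N : measurable [set w | sup_eval (level_seq f N) (X w) <= t%:E].
    have -> : [set w | sup_eval (level_seq f N) (X w) <= t%:E] =
        (fun w => sup_eval (level_seq f N) (X w)) @^-1` [set` `]-oo, t%:E]].
      by apply/seteqP; split => w /=; rewrite in_itv.
    apply: measurable_preimageT; first exact: measurable_sup_eval.
    exact: emeasurable_itv.
  have -> : [set w | ext_int f (X w) <= t%:E] =
      \bigcap_N [set w | sup_eval (level_seq f N) (X w) <= t%:E].
    apply/seteqP; split => w /=; rewrite (ext_int_level uf (sX w)).
      by move=> H N _ /=; apply: le_trans H; apply: ereal_sup_ubound; exists N.
    by move=> H; apply: ub_ereal_sup => _ [N _ <-]; exact: H.
  apply: nonincreasing_cvg_mu => //.
  - by rewrite (le_lt_trans (probability_le1 _ _)) ?ltry.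
  - exact: bigcapT_measurable.
  - move=> a b ab; apply/subsetPset => w /=; apply: le_trans.
    exact: sup_eval_level_nd.
have Ecv : (expR (- (cN N / t)))%:E @[N --> \oo] -->
    (expR (- (fine (\int[P']_w ext_int f (Y w)) / t)))%:E.
  apply: cvg_EFin; first by near=> N.
  apply: continuous_cvg; first exact: continuous_expR.
  by apply: cvgN; apply: cvgM ccv (cvg_cst _).
apply: (cvg_unique _ Pcv) => //.
apply: cvg_trans Ecv; apply: near_eq_cvg; near=> N.
by have [_ ->] := frechet_sup_eval (adm N).
Unshelve. all: by end_near.
Qed.

Lemma CRSM_of_scaled : is_CRSM P X.
Proof.
split.
  move=> n K u cK u0; have adm := family_seq_admissible cK u0.
  exists (fine (\int[P']_w sup_eval (family_seq u K) (Y w))).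
  have := frechet_sup_eval adm; congr (frechet_scale _ _ _).
  by apply/funext => w; rewrite /sup_eval big_map big_enum.
move=> f g uf ug cm; have ufg := USC_add hE uf ug.
exists (fine (\int[P']_w ext_int f (Y w))), (fine (\int[P']_w ext_int g (Y w))).
split; [exact: frechet_ext_int|exact: frechet_ext_int|].
rewrite -fineD ?integral_ext_int_fin//.
rewrite -(ae_integral_ext_int hY aeY uf ug cm (F := fun w => ext_int f (Y w))
  (G := fun w => ext_int g (Y w)) (H := fun w => ext_int (fun x => f x + g x)%R (Y w)))//;
  try exact: measurable_ext_int.
exact: frechet_ext_int.
Qed.

End crsm_of_scaled.

(** * Nested intervals *)

Section discrete_law.
Context d (Om : measurableType d) (R : realType) (P : probability Om R).

Fixpoint all_bits n : seq (seq bool) :=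
  if n is m.+1 then map (cons false) (all_bits m) ++ map (cons true) (all_bits m)
  else [:: [::]].

Lemma mem_all_bits n s : (s \in all_bits n) = (size s == n).
Proof.
elim: n s => [|n IH] [|b s]; rewrite ?inE//= mem_cat; last first.
  rewrite eqSS -IH; apply/orP/idP; first by case=> /mapP[? ? [_ ->]].
  by case: b => sn; [right|left]; apply/mapP; exists s.
by apply/negbTE; rewrite negb_or; apply/andP; split; apply/mapP => -[].
Qed.

Lemma uniq_all_bits n : uniq (all_bits n).
Proof.
elim: n => //= n IH; rewrite cat_uniq !map_inj_uniq ?IH//; try by move=> ? ? [].
by rewrite andbT; apply/hasPn => _ /mapP[s _ ->]; apply/negP => /mapP[].
Qed.

Lemma law_sum (n : nat) (f : Om -> seq bool) (Q : pred (seq bool)) :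
  (forall w, size (f w) = n) -> (forall s, measurable [set w | f w = s]) ->
  fine (P [set w | Q (f w)]) =
  (\sum_(s <- all_bits n | Q s) fine (P [set w | f w = s]))%R.
Proof.
move=> fn mf.
have H l : uniq l -> measurable [set w | (f w \in l) && Q (f w)] /\
    fine (P [set w | (f w \in l) && Q (f w)]) =
    (\sum_(s <- l | Q s) fine (P [set w | f w = s]))%R.
  elim: l => [_|s l IH /= /andP[sl ul]].
    rewrite big_nil (_ : mkset _ = set0) ?measure0//.
    by apply/seteqP; split => w.
  have [mI EI] := IH ul.
  case: (boolP (Q s)) => Qs.
    have -> : [set w | (f w \in s :: l) && Q (f w)] =
        [set w | f w = s] `|` [set w | (f w \in l) && Q (f w)].
      apply/seteqP; split => w /=.
        by rewrite inE => /andP[/orP[/eqP ->|->] ->]; [left|right].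
      by move=> [->|/andP[h ->]]; rewrite inE ?eqxx ?h ?orbT ?Qs.
    split; first exact: measurableU.
    rewrite big_cons Qs -EI measureU//.
      by rewrite fineD// fin_num_measure.
    by apply/seteqP; split => // w /= [-> /andP[]]; rewrite (negbTE sl).
  have -> : [set w | (f w \in s :: l) && Q (f w)] = [set w | (f w \in l) && Q (f w)].
    apply/seteqP; split => w /=; last by rewrite inE => /andP[-> ->]; rewrite orbT.
    by rewrite inE => /andP[/orP[/eqP ->|->]//]; rewrite (negbTE Qs).
  by rewrite big_cons (negbTE Qs).
have [_ <-] := H _ (uniq_all_bits n); congr (fine (P _)).
by apply/seteqP; split => w /=; rewrite mem_all_bits fn eqxx.
Qed.

End discrete_law.

Section nested_intervals.
Context (R : realType) (p : seq bool -> R).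
Hypothesis p0 : forall s, (0 <= p s)%R.
Hypothesis p_split : forall s, p s = (p (false :: s) + p (true :: s))%R.
Hypothesis p_nil : p [::] = 1%R.

(* Bit strings list the most recent bit first; the string [s] of length [n] is
   the value of the first [n] bits exactly on an interval of length [p s]. *)
Fixpoint left_end (s : seq bool) : R :=
  if s is b :: s' then (left_end s' + if b then p (false :: s') else 0)%R else 0%R.

Fixpoint bits (n : nat) (u : R) : seq bool :=
  if n is m.+1 then
    let s := bits m u in (left_end s + p (false :: s) <= u)%R :: s
  else [::].

Lemma size_bits n u : size (bits n u) = n.
Proof. by elim: n => //= n ->. Qed.

Lemma bitsP s u : (0 <= u < 1)%R ->
  bits (size s) u = s <-> (left_end s <= u < left_end s + p s)%R.
Proof.
move=> /andP[u0 u1]; elim: s => [|b s IH] /=; first by rewrite u0 p_nil add0r u1.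
split.
  move=> [+ bs]; rewrite bs; have /IH := bs; have := p_split s.
  have := p0 (true :: s); have := p0 (false :: s).
  case: b => [|] h1 h2 -> /andP[h3 h4];
    case: (leP (left_end s + p (false :: s)) u)%R => // h5 _;
    by apply/andP; split; lra.
move=> H; have bs : bits (size s) u = s.
  apply/IH; move: H; have := p_split s.
  have := p0 (true :: s); have := p0 (false :: s).
  by case: b => ? ? -> /andP[? ?]; apply/andP; split; lra.
rewrite bs; congr cons; move: H.
by case: b => /andP[? ?]; [apply/idP; lra|apply/negbTE; rewrite -ltNge; lra].
Qed.

Lemma left_end_ge0 s : (0 <= left_end s)%R.
Proof. by elim: s => //= b s IH; rewrite addr_ge0//; case: b. Qed.

Lemma left_end_le1 s : (left_end s + p s <= 1)%R.
Proof.
elim: s => [|b s IH] /=; first by rewrite p_nil add0r.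
have := p_split s; have := p0 (true :: s); have := p0 (false :: s).
by case: b; lra.
Qed.

Lemma measurable_bits n s : measurable [set u | bits n u = s].
Proof.
elim: n s => [|n IH] [|b s].
- by rewrite (_ : mkset _ = setT)//; apply/seteqP; split.
- by rewrite (_ : mkset _ = set0)//; apply/seteqP; split.
- by rewrite (_ : mkset _ = set0)//; apply/seteqP; split.
rewrite (_ : mkset _ = [set u | bits n u = s] `&`
    [set u | (left_end s + p (false :: s) <= u)%R = b]).
  apply: measurableI => //.
  have ml : measurable_fun setT (fun u : R => (left_end s + p (false :: s) <= u)%R).
    exact: measurable_fun_ler.
  exact: (@measurable_preimageT _ _ _ _ _ [set b] ml Logic.I).
by apply/seteqP; split => u /=; [move=> [<- <-]|move=> [-> ->]].
Qed.

(** Every consistent family [p] of string probabilities is the law of the digits of a uniform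
    variable, which does the work of Kolmogorov's extension theorem. *)
Lemma unif01_bits s : unif01 [set u | bits (size s) u = s] = (p s)%:E.
Proof.
have l0 := left_end_ge0 s; have l1 := left_end_le1 s; have ps := p0 s.
rewrite -[RHS](_ : unif01 `[left_end s, (left_end s + p s)%R[%classic = _); last first.
  by rewrite unif01_itv ?lerDl//; congr EFin; lra.
rewrite !unif01E; congr (lebesgue_measure _); apply/seteqP; split => u [/= bu];
  rewrite !in_itv/= => u01; split => //.
  exact: (bitsP s u01).1.
by apply/(bitsP s u01).2; move: bu; rewrite in_itv.
Qed.

End nested_intervals.

(** * The exponent measure *)

(** For a Frechet variable of scale [a] this is [k.+1] times the probability of exceeding [k.+1]. *)
Lemma expR_increment_cvg (R : realType) (a : R) : (0 <= a)%R ->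
  (k.+1%:R * (1 - expR (- (a / k.+1%:R))))%R @[k --> \oo] --> a.
Proof.
move=> a0.
have c1 : (a / k.+1%:R)%R @[k --> \oo] --> (0 : R)%R.
  rewrite -[X in _ --> X](mulr0 a); apply: cvgM; first exact: cvg_cst.
  exact: cvg_harmonic.
have c2 : (a * expR (- (a / k.+1%:R)))%R @[k --> \oo] --> a.
  have aE : (a * expR 0)%R = a by rewrite expR0 mulr1.
  rewrite -[X in _ --> X]aE; apply: cvgM; first exact: cvg_cst.
  apply: continuous_cvg; first exact: continuous_expR.
  have c3 := cvgN c1; rewrite oppr0 in c3; exact: c3.
apply: (squeeze_cvgr _ c2 (cvg_cst a)); near=> k.
have k0 : (0 < k.+1%:R :> R)%R by rewrite ltr0n.
set y := (a / k.+1%:R)%R; have aE : a = (k.+1%:R * y)%R by rewrite /y mulrC divfK// gt_eqF.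
apply/andP; split.
  rewrite [X in (X * _ <= _)%R]aE -mulrA; apply: ler_wpM2l (mul_expRN_le y).
  exact: ltW.
by rewrite [leRHS]aE; apply: ler_wpM2l (one_sub_expRN_le y); exact: ltW.
Unshelve. all: by end_near.
Qed.

Section extremal_coefficient.
Context (R : realType) (E : topologicalType) (C : nat -> set E).
Hypothesis hE : hausdorff_space E.
Hypothesis cC : compact_base C.
Context d (Om : measurableType d) (P : probability Om R) (X : Om -> set E -> \bar R).
Hypothesis hX : is_random_supmeasure X.
Hypothesis msX : max_stable P X.

Definition theta (K : set E) : R := (- ln (fine (P [set w | (X w K <= 1)%E])))%R.

Let sX w : is_supmeasure (X w). Proof. by case: hX. Qed.

Lemma frechet_theta K : compact K -> frechet_scale P (fun w => X w K) (theta K).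
Proof.
move=> cK; have [] := @msX 1%N (fun=> K) (fun=> 1%R) (fun=> cK) (fun=> ler01).
move=> a; under eq_fun do rewrite big_ord_recl big_ord0 mul1e max_l ?supmeasure_ge0//.
move=> fa; have := fa.2 1%R ltr01; rewrite divr1 => Pa.
by rewrite /theta Pa/= expRK opprK.
Qed.

Lemma measurable_le_level K (t : \bar R) : compact K -> measurable [set w | X w K <= t].
Proof.
move=> cK; have -> : [set w | X w K <= t] = (fun w => X w K) @^-1` [set` `]-oo, t]].
  by apply/seteqP; split => w /=; rewrite in_itv.
apply: measurable_preimageT; last exact: emeasurable_itv.
by case: hX => _; exact.
Qed.

Lemma theta_ge0 K : compact K -> (0 <= theta K)%R.
Proof. by move=> /frechet_theta[]. Qed.

Lemma theta_prob K (t : R) : compact K -> (0 < t)%R ->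
  P [set w | X w K <= t%:E] = (expR (- (theta K / t)))%:E.
Proof. by move=> /frechet_theta[_]; exact. Qed.

Lemma theta_mono K L : compact K -> compact L -> K `<=` L -> (theta K <= theta L)%R.
Proof.
move=> cK cL KL; rewrite -lerN2 -ler_expR -[in leLHS](divr1 (theta L)) -[in leRHS](divr1 (theta K)).
rewrite -lee_fin -!theta_prob// le_measure ?inE//; try exact: measurable_le_level.
by move=> w /=; apply: le_trans; exact: supmeasure_le.
Qed.

Lemma theta0 : theta set0 = 0%R.
Proof.
rewrite /theta (_ : mkset _ = setT) ?probability_setT ?ln1 ?oppr0//.
by apply/seteqP; split => // w _ /=; rewrite supmeasure0.
Qed.

Lemma theta_eq0 K : compact K -> theta K = 0%R -> P [set w | X w K <= 0] = 1.
Proof.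
move=> cK tK.
have cv : P [set w | X w K <= (m.+1%:R^-1)%:E] @[m --> \oo] --> P [set w | X w K <= 0].
  have -> : [set w | X w K <= 0] = \bigcap_m [set w | X w K <= (m.+1%:R^-1)%:E].
    apply/seteqP; split => w /=.
      by move=> Xw m _ /=; apply: le_trans Xw _; rewrite lee_fin invr_ge0.
    move=> H; apply/lee_addgt0Pr => e e0; rewrite add0e.
    apply: le_trans (H (Num.truncn e^-1) Logic.I) _; rewrite lee_fin.
    by rewrite -[leRHS]invrK lef_pV2 ?posrE ?invr_gt0// ltW// truncnS_gt.
  apply: nonincreasing_cvg_mu.
  - by rewrite (le_lt_trans (probability_le1 _ _)) ?ltry//; exact: measurable_le_level.
  - by move=> m; exact: measurable_le_level.
  - by apply: bigcapT_measurable => m; exact: measurable_le_level.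
  - move=> a b ab; apply/subsetPset => w /= /le_trans; apply.
    by rewrite lee_fin lef_pV2 ?posrE// ler_nat.
rewrite -(cvg_lim (@ereal_hausdorff R) cv).
rewrite (_ : (fun m => _) = cst 1); first exact: lim_cst.
by apply/funext => m; rewrite theta_prob ?invr_gt0// tK mul0r oppr0 expR0.
Qed.

(** At each [w], [X(K k)] decreases to [X(L)], but the union of the events [X(K k) <= 1] is only
    caught between [X(L) <= t] for [t < 1] and [X(L) <= 1]. The Frechet distribution function is
    continuous at 1, so letting [t] tend to 1 closes the gap. *)
Lemma theta_outer (K : nat -> set E) (L : set E) : (forall k, compact (K k)) ->
  compact L -> (forall k, K k.+1 `<=` K k) -> \bigcap_k K k = L ->
  theta (K k) @[k --> \oo] --> theta L.
Proof.
move=> cK cL Kd KL.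
pose e k := fine (P [set w | X w (K k) <= 1]).
have eE k : P [set w | X w (K k) <= 1] = (e k)%:E.
  by rewrite fineK// fin_num_measure//; exact: measurable_le_level.
have eT k : e k = expR (- theta (K k)).
  by apply: EFin_inj; rewrite -eE theta_prob// divr1.
have LK k : L `<=` K k by rewrite -KL => x; exact.
have e_le k : (e k <= expR (- theta L))%R.
  by rewrite eT ler_expR lerN2; apply: theta_mono.
have e_nd : nondecreasing_seq e.
  apply/nondecreasing_seqP => k; rewrite !eT ler_expR lerN2.
  by apply: theta_mono => //; exact: Kd.
have ce : cvgn e.
  by apply: nondecreasing_is_cvgn => //; exists (expR (- theta L)) => _ [k _ <-].
have ub : (limn e <= expR (- theta L))%R by apply: limr_le => //; exact: nearW.
have lb t : (0 < t < 1)%R -> (expR (- (theta L / t)) <= limn e)%R.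
  move=> /andP[t0 t1].
  have cP : P [set w | X w (K k) <= 1] @[k --> \oo] -->
      P (\bigcup_k [set w | X w (K k) <= 1]).
    apply: nondecreasing_cvg_mu.
    - by move=> k; exact: measurable_le_level.
    - by apply: bigcupT_measurable => k; exact: measurable_le_level.
    - apply/nondecreasing_seqP => k; apply/subsetPset => w /=; apply: le_trans.
      by apply: (supmeasure_le (sX w)); exact: Kd.
  have : P (\bigcup_k [set w | X w (K k) <= 1]) = (limn e)%:E.
    apply: (cvg_unique _ cP) => //.
    have : (e k)%:E @[k --> \oo] --> (limn e)%:E.
      by apply: cvg_EFin; [exact: nearW|exact: ce].
    by apply: cvg_trans; apply: near_eq_cvg; apply: nearW => k; apply/esym; exact: eE.
  rewrite -lee_fin -theta_prob// => <-; apply: le_measure; rewrite ?inE.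
  - exact: measurable_le_level.
  - by apply: bigcupT_measurable => k; exact: measurable_le_level.
  move=> w /= XLt.
  have cX : X w (K k) @[k --> \oo] --> X w L.
    by case: (sX w) => _ _ _ /(_ K cK Kd) + _; rewrite KL.
  apply: contrapT => nB.
  have nX k : ~ (X w (K k) <= 1) by move=> h; apply: nB; exists k.
  have : 1 <= X w L.
    rewrite -(cvg_lim (@ereal_hausdorff R) cX); apply: lime_ge.
      by apply/cvg_ex; eexists; exact: cX.
    by apply: nearW => k; rewrite leNgt; apply/negP => /ltW h; apply: (nX k).
  by move=> /le_trans/(_ XLt); rewrite lee_fin leNgt t1.
have le : limn e = expR (- theta L).
  apply/eqP; rewrite eq_le ub/=.
  have c : expR (- (theta L / (1 - (k.+2%:R)^-1)))%R @[k --> \oo] --> expR (- theta L).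
    apply: continuous_cvg; first exact: continuous_expR.
    apply: cvgN; rewrite -[X in _ --> X]divr1; apply: cvgM; first exact: cvg_cst.
    apply: cvgV; first exact: oner_neq0.
    rewrite -[X in _ --> X]subr0; apply: cvgB; first exact: cvg_cst.
    by have := @cvg_harmonic R; rewrite -cvg_shiftS.
  rewrite -(cvg_lim (@Rhausdorff R) c); apply: limr_le.
    by apply/cvg_ex; eexists; exact: c.
  apply: nearW => k; apply: lb.
  have k2 : (0 < k.+2%:R :> R)%R by rewrite ltr0n.
  by rewrite subr_gt0 invf_lt1// ltr1n/= gtrBl invr_gt0.
have -> : theta L = (- ln (limn e))%R by rewrite le expRK opprK.
rewrite (_ : (fun k => theta (K k)) = (fun k => - ln (e k))%R); last first.
  by apply/funext => k; rewrite eT expRK opprK.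
apply: cvgN; apply: continuous_cvg; last exact: ce.
by apply: continuous_ln; rewrite le expR_gt0.
Qed.

End extremal_coefficient.

(** Strings list the most recent bit first, so the recursion prefers the tail; the result is the
    index of the oldest 1. *)
Fixpoint first_one (s : seq bool) : option nat :=
  if s is b :: s' then
    if first_one s' is Some n then Some n else if b then Some (size s') else None
  else None.

Lemma cvg_sum_seq (R : realType) (T : eqType) (l : seq T) (Q : pred T)
    (f : nat -> T -> R) (a : T -> R) :
  (forall x, x \in l -> Q x -> f k x @[k --> \oo] --> a x) ->
  (\sum_(x <- l | Q x) f k x)%R @[k --> \oo] --> (\sum_(x <- l | Q x) a x)%R.
Proof.
elim: l => [|x l IH] H.
  by rewrite big_nil; under eq_fun do rewrite big_nil; exact: cvg_cst.
have Hl : (\sum_(x <- l | Q x) f k x)%R @[k --> \oo] --> (\sum_(x <- l | Q x) a x)%R.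
  by apply: IH => y yl; apply: H; rewrite inE yl orbT.
rewrite big_cons; case: ifPn => Qx.
  under eq_fun do rewrite big_cons Qx.
  by apply: cvgD => //; apply: H => //; rewrite inE eqxx.
by under eq_fun do rewrite big_cons (negbTE Qx).
Qed.

(** * Scaled hitting probabilities and the law of the digits *)

Section patterns.
Context (R : realType) (E : topologicalType) (C : nat -> set E).
Hypothesis hE : hausdorff_space E.
Hypothesis cC : compact_base C.
Context d (Om : measurableType d) (P : probability Om R) (X : Om -> set E -> \bar R).
Hypothesis hX : is_random_supmeasure X.
Hypothesis msX : max_stable P X.
Hypothesis hX0 : {ae P, forall w, X w <> zero_supmeasure}.

Let sX w : is_supmeasure (X w). Proof. by case: hX. Qed.
Local Notation theta := (theta P X).
Local Notation exhaust := (exhaust C).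

Let cCi i : compact (C i). Proof. by case: cC. Qed.
Let cex n : compact (exhaust n). Proof. exact: compact_exhaust. Qed.

Let A k K : set Om := [set w | X w K <= (k.+1%:R)%:E].

Let mA k K : compact K -> measurable (A k K).
Proof. exact: measurable_le_level. Qed.

(* [miss_hit k M H]: the random set [{X > k + 1}] misses [M] and hits all members
   of [H]. *)
Fixpoint miss_hit k (M : set E) (H : seq (set E)) : set Om :=
  if H is h :: H' then miss_hit k M H' `\` A k h else A k M.

Let all_compact (H : seq (set E)) := forall h, List.In h H -> compact h.

Let mmh k M H : compact M -> all_compact H -> measurable (miss_hit k M H).
Proof.
move=> cM; elim: H => [|h H IH] cH /=; first exact: mA.
apply: measurableD; last by apply: mA; apply: cH; left.
by apply: IH => x xH; apply: cH; right.
Qed.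

Lemma miss_hitI k M H h : compact M -> compact h ->
  miss_hit k M H `&` A k h = miss_hit k (M `|` h) H.
Proof.
move=> cM ch; elim: H => [|x H IH] /=.
  by apply/seteqP; split => w; rewrite /A/= (supmeasureU_le hE cC (sX w))// => /andP.
by rewrite -IH; apply/seteqP; split => w [[? ?] ?].
Qed.

Let Q k M H : R := (k.+1%:R * fine (P (miss_hit k M H)))%R.

Let Q_cons k M H h : compact M -> all_compact H -> compact h ->
  Q k M (h :: H) = (Q k M H - Q k (M `|` h) H)%R.
Proof.
move=> cM cH ch; rewrite /Q /= -mulrBr; congr (_ * _)%R.
have m1 := mmh k cM cH; have m2 := mA k ch.
rewrite measureD//; last by rewrite -ge0_fin_numE ?fin_num_measure.
rewrite fineB ?fin_num_measure//; last exact: measurableI.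
by rewrite miss_hitI.
Qed.

(** [k.+1] times a difference of two Frechet probabilities, each handled by [expR_increment_cvg]. *)
Lemma miss_one_cvg M h : compact M -> compact h ->
  Q k M [:: h] @[k --> \oo] --> (theta (M `|` h) - theta M)%R.
Proof.
move=> cM ch; have cMh := compactU cM ch.
have E1 k : Q k M [:: h] = (k.+1%:R * (1 - expR (- (theta (M `|` h) / k.+1%:R))) -
    k.+1%:R * (1 - expR (- (theta M / k.+1%:R))))%R.
  by rewrite Q_cons// /Q /= /A !(theta_prob hX msX)//=; ring.
under eq_fun do rewrite E1.
by apply: cvgB; apply: expR_increment_cvg; exact: (theta_ge0 hX msX).
Qed.

(** Inclusion-exclusion in the form [Q_cons] removes the hit sets one at a time. The last one, [h],
    must stay: with no set to hit, [Q] grows like [k]. *)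
Let Q_cvg M H h : compact M -> all_compact H -> compact h ->
  cvgn (fun k => Q k M (H ++ [:: h])).
Proof.
move=> + + ch; elim: H M => [|x H IH] M cM cH /=.
  by apply/cvg_ex; eexists; exact: miss_one_cvg.
have cx : compact x by apply: cH; left.
have cH' : all_compact H by move=> y yH; apply: cH; right.
have cHh : all_compact (H ++ [:: h]).
  by move=> y yH; have [/cH'//|[<-//|[]]] := List.in_app_or _ _ _ yH.
under eq_fun do rewrite Q_cons//.
by apply: is_cvgB; apply: IH => //; exact: compactU.
Qed.

Fixpoint pattern k (w : Om) n : seq bool :=
  if n is m.+1 then ~~ (X w (C m) <= (k.+1%:R)%:E) :: pattern k w m else [::].

Lemma size_pattern k w n : size (pattern k w n) = n.
Proof. by elim: n => //= n ->. Qed.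

Fixpoint missed (s : seq bool) : set E :=
  if s is b :: s' then (if b then missed s' else missed s' `|` C (size s')) else set0.
Fixpoint hit (s : seq bool) : seq (set E) :=
  if s is b :: s' then (if b then C (size s') :: hit s' else hit s') else [::].

Let c_missed s : compact (missed s).
Proof. by elim: s => [|[] s IH] /=; [exact: compact0| |exact: compactU]. Qed.

Let c_hit s : all_compact (hit s).
Proof.
move=> h; elim: s => [|b s IH] //=; case: b => //=.
by move=> [<-//|]; exact: IH.
Qed.

Lemma pattern_event k s :
  [set w | pattern k w (size s) = s] = miss_hit k (missed s) (hit s).
Proof.
elim: s => [|[] s IH] /=.
- by apply/seteqP; split => // w _; rewrite /A/= (supmeasure0 (sX w)).
- rewrite -IH; apply/seteqP; split => w /=; first by move=> [/negP ? ->].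
  by move=> [-> /negP ->].
- rewrite -miss_hitI// -IH; apply/seteqP; split => w /=.
    by move=> [/negbFE ? ->].
  by move=> [-> Aw]; rewrite Aw.
Qed.

Lemma measurable_pattern k n s : measurable [set w | pattern k w n = s].
Proof.
have [<-|ns] := eqVneq (size s) n; first by rewrite pattern_event; exact: mmh.
rewrite (_ : mkset _ = set0)//; apply/seteqP; split => // w /= ps.
by move: ns; rewrite -ps size_pattern eqxx.
Qed.

(** The exponent measure of the closed sets whose hits among the first [C i] are given by [s]. For a
    string without a 1 the sequence diverges and the value has no meaning. *)
Definition nu (s : seq bool) : R :=
  limn (fun k => (k.+1%:R * fine (P [set w | pattern k w (size s) = s]))%R).

Lemma first_one_None s : first_one s = None -> s = nseq (size s) false.
Proof.
elim: s => //= b s IH; case: (first_one s) IH => // /(_ erefl) sE.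
by case: b => // _; rewrite {1}sE.
Qed.

Lemma first_one_zeros n : first_one (nseq n false) = None.
Proof. by elim: n => //= n ->. Qed.

Lemma hit_zeros n : hit (nseq n false) = [::].
Proof. by elim: n. Qed.

Lemma missed_zeros n : missed (nseq n false) = exhaust n.
Proof. by elim: n => [|n IH] /=; [rewrite exhaust0|rewrite IH size_nseq -exhaustS]. Qed.

Let first_one_hit s n : first_one s = Some n -> exists H, hit s = H ++ [:: C n].
Proof.
elim: s => //= b s IH; case E0 : (first_one s) IH => [m|] IH.
  by move=> mn; have [H ->] := IH mn; case: b; [exists (C (size s) :: H)|exists H].
case: b => // -[<-]; exists [::].
by rewrite (first_one_None E0) hit_zeros size_nseq.
Qed.

Lemma nu_cvg s n : first_one s = Some n ->
  (k.+1%:R * fine (P [set w | pattern k w (size s) = s]))%R @[k --> \oo] --> nu s.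
Proof.
move=> fs; have [H hH] := first_one_hit fs.
have EQ : (fun k => k.+1%:R * fine (P [set w | pattern k w (size s) = s]))%R =
    (fun k => Q k (missed s) (H ++ [:: C n])).
  by apply/funext => k; rewrite pattern_event hH.
suff : cvgn (fun k => Q k (missed s) (H ++ [:: C n])) by rewrite /nu EQ.
apply: Q_cvg => // h hh; apply: (@c_hit s); rewrite hH.
by apply/List.in_or_app; left.
Qed.

Lemma nu_ge0 s n : first_one s = Some n -> (0 <= nu s)%R.
Proof.
move=> /nu_cvg cs; apply: limr_ge; first by apply/cvg_ex; eexists; exact: cs.
by apply: nearW => k; rewrite mulr_ge0 ?ler0n// fine_ge0.
Qed.

Lemma nu_split s n : first_one s = Some n -> nu s = (nu (false :: s) + nu (true :: s))%R.
Proof.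
move=> fs.
have c0 := nu_cvg fs.
have c1 : first_one (false :: s) = Some n by rewrite /= fs.
have c2 : first_one (true :: s) = Some n by rewrite /= fs.
apply: (cvg_unique (@Rhausdorff R) c0).
have c12 : (k.+1%:R * fine (P [set w | pattern k w (size s).+1 = false :: s]) +
    k.+1%:R * fine (P [set w | pattern k w (size s).+1 = true :: s]))%R
    @[k --> \oo] --> (nu (false :: s) + nu (true :: s))%R.
  exact: cvgD (nu_cvg c1) (nu_cvg c2).
apply: cvg_trans c12; apply: near_eq_cvg; apply: nearW => k.
apply/esym.
rewrite -mulrDr -fineD ?fin_num_measure//; try exact: (measurable_pattern k (size s).+1).
rewrite -measureU//; try exact: (measurable_pattern k (size s).+1).
  congr (_ * fine (P _))%R; apply/seteqP; split => w /=.
    by move=> ->; case: (~~ _); [right|left].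
  by move=> [[_ ->]|[_ ->]].
by apply/seteqP; split => // w [/= [-> _]] [].
Qed.

Lemma nu_first n : nu (true :: nseq n false) = (theta (exhaust n.+1) - theta (exhaust n))%R.
Proof.
rewrite /nu; apply: cvg_lim => //; under eq_fun do rewrite pattern_event.
have -> : missed (true :: nseq n false) = exhaust n by rewrite /= missed_zeros.
have -> : hit (true :: nseq n false) = [:: C n] by rewrite /= hit_zeros size_nseq.
by rewrite exhaustS; exact: miss_one_cvg.
Qed.

(** [e n] is the probability of [X(exhaust n) <= 1]. Normalised by its limit it becomes [t], which
    falls from 1 to 0 and drops exactly where [gap] is positive. *)
Let e n : R := expR (- theta (exhaust n)).
Let eps : R := limn e.
Let t n : R := ((e n - eps) / (1 - eps))%R.
Let gap n : R := (theta (exhaust n.+1) - theta (exhaust n))%R.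
(* [gap n] is the mass that the exponent measure gives to the closed sets whose first
   hit among the [C i] is [C n]. The total may be infinite, so each of these pieces
   is rescaled to have mass [t n - t n.+1]; these masses add up to 1. *)
Definition tilt n : R := ((t n - t n.+1) / gap n)%R.

Let gap_ge0 n : (0 <= gap n)%R.
Proof. by rewrite subr_ge0; apply: (theta_mono hX msX) => //; exact: exhaust_nd. Qed.

Let e_dec : nonincreasing_seq e.
Proof.
apply/nonincreasing_seqP => n; rewrite ler_expR lerN2.
by apply: (theta_mono hX msX) => //; exact: exhaust_nd.
Qed.

Let e_cvg : e n @[n --> \oo] --> eps.
Proof.
apply: nonincreasing_is_cvgn => //; exists 0%R => _ [n _ <-]; exact: expR_ge0.
Qed.

Let eps_le n : (eps <= e n)%R.
Proof.
apply: limr_le; first by apply/cvg_ex; exists eps; exact: e_cvg.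
by near=> m; apply: e_dec; near: m; exact: nbhs_infty_ge.
Unshelve. all: by end_near.
Qed.

(** Here the hypothesis that [X] is a.s. not zero enters: otherwise [X] would a.s. vanish on every
    [exhaust n]. It gives [eps < 1], so that [t] can be normalised. *)
Lemma exists_theta_gt0 : exists n, (0 < theta (exhaust n))%R.
Proof.
apply: contrapT => /forallNP H.
have t0 n : theta (exhaust n) = 0%R.
  apply/eqP; rewrite eq_le (theta_ge0 hX msX)// andbT leNgt; apply/negP; exact: H.
pose Z n := [set w | X w (exhaust n) <= 0].
have mZ n : measurable (Z n) by exact: measurable_le_level.
have [N [mN PN XN]] := hX0.
have PZ n : P (~` Z n) = 0.
  by rewrite probability_setC// (theta_eq0 hX msX)// subee.
have : P (N `|` \bigcup_n ~` Z n) = 0.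
  apply: null_set_setU => //.
    by apply: bigcupT_measurable => n; exact: measurableC.
  apply/eqP; rewrite eq_le measure_ge0 andbT.
  apply: (@le_trans _ _ (\sum_(n <oo) P (~` Z n))).
    apply: measure_sigma_subadditive => //.
    - by move=> n; exact: measurableC.
    - by apply: bigcupT_measurable => n; exact: measurableC.
  by rewrite eseries0.
rewrite (_ : _ `|` _ = setT); first by rewrite probability_setT => h; have /eqP := congr1 fine h; rewrite oner_eq0.
apply/seteqP; split => // w _.
have [Xw|Xw] := pselect (X w = zero_supmeasure); first by left; apply: XN.
right; apply: contrapT => nZ; apply: Xw; apply: (supmeasure_eq0 cC (sX w)) => n.
apply/eqP; rewrite eq_le supmeasure_ge0// andbT.
by apply: contrapT => h; apply: nZ; exists n.
Qed.

Let eps_lt1 : (eps < 1)%R.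
Proof.
have [n tn] := exists_theta_gt0.
by rewrite (le_lt_trans (eps_le n))// -expR0 ltr_expR oppr_lt0.
Qed.

Let e1_gt0 : (0 < 1 - eps)%R. Proof. by rewrite subr_gt0. Qed.

Let t_ge0 n : (0 <= t n)%R.
Proof. by rewrite divr_ge0 ?subr_ge0// ltW// -subr_ge0 ltW. Qed.

Let t_dec n : (t n.+1 <= t n)%R.
Proof. by rewrite ler_pM2r ?invr_gt0// lerD2r; exact: e_dec. Qed.

Let t0 : t 0%N = 1%R.
Proof. by rewrite /t /e exhaust0 (theta0 P hX) oppr0 expR0 divff// gt_eqF. Qed.

Let t_cvg : t n @[n --> \oo] --> (0%R : R).
Proof.
rewrite -(mul0r (1 - eps)^-1%R) -(subrr eps); apply: cvgM; last exact: cvg_cst.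
by apply: cvgB; [exact: e_cvg|exact: cvg_cst].
Qed.

Lemma tilt_ge0 n : (0 <= tilt n)%R.
Proof. by rewrite divr_ge0// subr_ge0. Qed.

Let gap0_t n : gap n = 0%R -> t n = t n.+1.
Proof. by move=> /eqP; rewrite subr_eq0 => /eqP g0; rewrite /t /e g0. Qed.

Lemma tilt_gap n : (tilt n * gap n = t n - t n.+1)%R.
Proof.
have [g0|g0] := eqVneq (gap n) 0%R; last by rewrite /tilt divfK.
by rewrite g0 mulr0 (gap0_t g0) subrr.
Qed.

(** A piece that the rescaling kills had no mass to begin with, since [e] drops strictly when
    [theta] grows. Undoing the rescaling later thus loses nothing. *)
Lemma tilt_eq0 n : tilt n = 0%R -> gap n = 0%R.
Proof.
move=> /eqP; rewrite /tilt mulf_eq0 invr_eq0 => /orP[|/eqP//].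
rewrite subr_eq0 => /eqP tt.
have ee : e n = e n.+1.
  have := congr1 (fun x => x * (1 - eps))%R tt; rewrite /t !divfK ?gt_eqF//.
  by move=> /(congr1 (fun x => x + eps)%R); rewrite !subrK.
by rewrite /gap; have /oppr_inj -> := expR_inj ee; rewrite subrr.
Qed.

(** A string of zeros holds the mass [t (size s)] of the pieces not yet reached. From the first 1
    on, the exponent measure decides, rescaled by the factor of its piece. *)
Definition bit_law (s : seq bool) : R :=
  if first_one s is Some n then (tilt n * nu s)%R else t (size s).

Lemma bit_law_ge0 s : (0 <= bit_law s)%R.
Proof.
rewrite /bit_law; case fs : (first_one s) => [n|]; last exact: t_ge0.
by rewrite mulr_ge0 ?tilt_ge0// (nu_ge0 fs).
Qed.

Lemma bit_law_split s : bit_law s = (bit_law (false :: s) + bit_law (true :: s))%R.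
Proof.
rewrite /bit_law /=; case fs : (first_one s) => [n|].
  by rewrite (nu_split fs) mulrDr.
have -> : nu (true :: s) = gap (size s) by rewrite {1}(first_one_None fs) nu_first.
by rewrite tilt_gap; lra.
Qed.

Lemma bit_law_nil : bit_law [::] = 1%R.
Proof. exact: t0. Qed.

Lemma bit_law_zeros_cvg : bit_law (nseq n false) @[n --> \oo] --> (0%R : R).
Proof.
rewrite /bit_law; under eq_fun do rewrite first_one_zeros size_nseq; exact: t_cvg.
Qed.

Local Notation bits := (bits bit_law).

(** Events on [n] digits pass from the patterns of [X] to the uniform variable: once the first 1 is
    fixed at [m], the event is a finite sum of cylinders that share the factor [tilt m]. *)
Lemma bits_pattern_cvg m n (S : pred (seq bool)) :
  (tilt m * (k.+1%:R * fine (P [set w | (first_one (pattern k w n) == Some m) && S (pattern k w n)])))%R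
    @[k --> \oo] -->
  fine (@unif01 R [set u | (first_one (bits n u) == Some m) && S (bits n u)]).
Proof.
pose S' s := (first_one s == Some m) && S s.
rewrite (law_sum (@unif01 R) S' (size_bits bit_law n) (measurable_bits bit_law n)).
have -> : (\sum_(s <- all_bits n | S' s) fine (@unif01 R [set u | bits n u = s]))%R =
    (\sum_(s <- all_bits n | S' s) tilt m * nu s)%R.
  rewrite big_seq_cond [RHS]big_seq_cond; apply: eq_bigr => s.
  rewrite mem_all_bits => /andP[/eqP <- /andP[/eqP fs _]].
  rewrite (unif01_bits bit_law_ge0 bit_law_split bit_law_nil).
  by rewrite /bit_law fs.
under eq_fun => k.
  rewrite (law_sum P S' (fun w => size_pattern k w n) (measurable_pattern k n)) !mulr_sumr.
over.
apply: cvg_sum_seq => s; rewrite mem_all_bits => /eqP <- /andP[/eqP fs _].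
by apply: cvgM; [exact: cvg_cst|exact: nu_cvg fs].
Qed.

End patterns.

(** * The random closed set *)

Definition first_at (m : nat) (f : nat -> bool) : bool :=
  f m && all (fun i => ~~ f i) (iota 0 m).

Lemma first_at_inj (f : nat -> bool) m n : first_at m f -> first_at n f -> m = n.
Proof.
move=> /andP[fm /allP zm] /andP[fn /allP zn]; case: (ltngtP m n) => // mn.
- by have := zn m; rewrite mem_iota leq0n add0n mn fm => /(_ isT).
- by have := zm n; rewrite mem_iota leq0n add0n mn fn => /(_ isT).
Qed.

Lemma first_at_exists (f : nat -> bool) n : f n -> exists2 m, (m <= n)%N & first_at m f.
Proof.
move=> fn; have ex : exists n, f n by exists n.
exists (ex_minn ex); case: ex_minnP => m fm mmin; first exact: mmin.
rewrite /first_at fm; apply/allP => i; rewrite mem_iota leq0n add0n /= => im.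
by apply/negP => /mmin; rewrite leqNgt im.
Qed.

Lemma first_one_mkseq (f : nat -> bool) n m :
  (first_one (rev (mkseq f n)) == Some m) = (m < n)%N && first_at m f.
Proof.
elim: n m => [|n IH] m //; rewrite mkseqS rev_rcons /= size_rev size_mkseq.
case fo : (first_one _) IH => [p|] IH.
  rewrite IH; case: (ltngtP m n) => [mn|mn|->]; first by rewrite ltnS ltnW.
    by rewrite ltnS leqNgt mn.
  rewrite ltnSn /=; apply/esym/negbTE/negP => fan.
  have := IH p; rewrite eqxx => /esym/andP[pn fap].
  by move: pn; rewrite (first_at_inj fap fan) ltnn.
have zf i : (i < n)%N -> f i = false.
  move=> i_n; have := first_one_None fo; rewrite size_rev size_mkseq.
  move=> /(congr1 rev); rewrite revK rev_nseq => /(congr1 (fun s => nth false s i)).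
  by rewrite nth_mkseq// nth_nseq i_n.
have -> : (m < n.+1)%N && first_at m f = (m == n) && f n.
  apply/idP/idP => [/andP[mn /andP[fm _]]|/andP[/eqP -> fn]].
    move: mn; rewrite ltnS leq_eqVlt => /orP[/eqP mn|/zf]; last by rewrite fm.
    by rewrite -mn eqxx fm.
  rewrite ltnSn /first_at fn /=; apply/allP => i; rewrite mem_iota leq0n add0n /= => i_n.
  by rewrite zf.
by case: (f n); rewrite ?andbT ?andbF//= eq_sym.
Qed.

Lemma measurable_countable_image d (Om : measurableType d) (T : countType)
    (f : Om -> T) (Q : T -> Prop) :
  (forall s, measurable [set w | f w = s]) -> measurable [set w | Q (f w)].
Proof.
move=> mf; rewrite (_ : mkset _ = \bigcup_s [set w | Q s /\ f w = s]).
  apply: countable_bigcupT_measurable; first exact: countableP.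
  move=> s; have [Qs|Qs] := pselect (Q s).
    by rewrite (_ : mkset _ = [set w | f w = s])//; apply/seteqP; split => w //= [].
  by rewrite (_ : mkset _ = set0)//; apply/seteqP; split => w //= [].
by apply/seteqP; split => w /=; [move=> Qf; exists (f w)|move=> [s _ [+ ->]]].
Qed.

Section random_closed_set.
Context (R : realType) (E : topologicalType) (C : nat -> set E).
Hypothesis hE : hausdorff_space E.
Hypothesis cC : compact_base C.
Context d (Om : measurableType d) (P : probability Om R) (X : Om -> set E -> \bar R).
Hypothesis hX : is_random_supmeasure X.
Hypothesis msX : max_stable P X.
Hypothesis hX0 : {ae P, forall w, X w <> zero_supmeasure}.

Let sX w : is_supmeasure (X w). Proof. by case: hX. Qed.
Local Notation theta := (theta P X).
Local Notation exhaust := (exhaust C).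
Local Notation tilt := (tilt C P X).
Local Notation bit_law := (bit_law C P X).
Local Notation bits := (bits bit_law).

Let cCi i : compact (C i). Proof. by case: cC. Qed.
Let cex n : compact (exhaust n). Proof. exact: compact_exhaust. Qed.
Let ccov J : compact (cover_set C J). Proof. exact: compact_cover_set. Qed.

Definition digit (u : R) (i : nat) : bool := head false (bits i.+1 u).

Lemma bits_digit n u : bits n u = rev (mkseq (digit u) n).
Proof. by elim: n => // n IH; rewrite mkseqS rev_rcons -IH. Qed.

Lemma measurable_digit i b : measurable [set u | digit u i = b].
Proof.
exact: (measurable_countable_image (fun s => head false s = b) (measurable_bits bit_law i.+1)).
Qed.

Lemma measurable_digits (Q : (nat -> bool) -> Prop) n :
  (forall f g, (forall i, (i < n)%N -> f i = g i) -> Q f -> Q g) ->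
  measurable [set u | Q (digit u)].
Proof.
move=> Qn.
rewrite (_ : mkset _ = [set u | Q (nth false (rev (bits n u)))]).
  exact: (measurable_countable_image (fun s => Q (nth false (rev s))) (measurable_bits bit_law n)).
have D u i : (i < n)%N -> nth false (rev (bits n u)) i = digit u i.
  by move=> i_n; rewrite bits_digit revK nth_mkseq.
by apply/seteqP; split => u /=; apply: Qn => i /D.
Qed.

Let first_digits m (J : seq nat) :=
  [set u | first_at m (digit u) && all (fun j => ~~ digit u j) J].

Lemma measurable_first_digits m J : measurable (first_digits m J).
Proof.
apply: (@measurable_digits (fun f => first_at m f && all (fun j => ~~ f j) J)
   (maxn m.+1 (\max_(j <- J) j.+1))) => f g fg /andP[/andP[fm /allP f0] /allP fJ].
rewrite /first_at -!fg; last by rewrite leq_max ltnSn.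
rewrite fm /=; apply/andP; split; apply/allP => i.
  rewrite mem_iota leq0n add0n /= => im; rewrite -fg ?f0 ?mem_iota//.
  by rewrite leq_max (ltn_trans im).
move=> iJ; rewrite -fg ?fJ//.
by rewrite leq_max (@leq_bigmax_seq _ _ xpredT succn)// orbT.
Qed.

Lemma pattern_mkseq k w n :
  pattern C X k w n = rev (mkseq (fun i => ~~ (X w (C i) <= (k.+1%:R)%:E)) n).
Proof. by elim: n => // n IH; rewrite mkseqS rev_rcons -IH. Qed.

(** For the patterns of [X] the event says that the union of [cover_set C J] and [exhaust m] is
    missed while [C m] is hit, because a sup-measure exceeds a level on a finite union iff it does
    so on a member. [miss_one_cvg] gives the limit. *)
Lemma unif01_first_digits m J :
  fine (@unif01 R (first_digits m J)) =
  (tilt m * (theta (cover_set C J `|` exhaust m.+1) - theta (cover_set C J `|` exhaust m)))%R.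
Proof.
pose n := maxn m.+1 (\max_(j <- J) j.+1).
have mn : (m < n)%N by rewrite leq_max ltnSn.
have Jn j : j \in J -> (j < n)%N.
  by move=> jJ; rewrite leq_max (@leq_bigmax_seq _ _ xpredT succn)// orbT.
pose S s := all (fun j => ~~ nth false (rev s) j) J.
have SE f : S (rev (mkseq f n)) = all (fun j => ~~ f j) J.
  rewrite /S revK; apply: eq_in_all => j /Jn jn; by rewrite nth_mkseq.
pose M := cover_set C J `|` exhaust m.
have cM : compact M by exact: compactU.
have VE k : [set w | (first_one (pattern C X k w n) == Some m) && S (pattern C X k w n)] =
    miss_hit X k M [:: C m].
  apply/seteqP; split => w /=; rewrite pattern_mkseq SE first_one_mkseq mn /=.
    move=> /andP[/andP[Cm /allP exm] /allP CJ]; split; last exact/negP.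
    have k0 : 0 <= (k.+1%:R : R)%:E by rewrite lee_fin ler0n.
    rewrite /mkset (supmeasureU_le hE cC (sX w))//; apply/andP; split.
      by apply/(supmeasure_cover_set_le hE cC (sX w) _ k0) => j /CJ; rewrite negbK.
    by apply/(supmeasure_cover_set_le hE cC (sX w) _ k0) => j /exm; rewrite negbK.
  move=> [+ /negP Cm]; rewrite /mkset (supmeasureU_le hE cC (sX w))// => /andP[].
  have k0 : 0 <= (k.+1%:R : R)%:E by rewrite lee_fin ler0n.
  move=> /(supmeasure_cover_set_le hE cC (sX w) _ k0) CJ.
  move=> /(supmeasure_cover_set_le hE cC (sX w) _ k0) exm.
  rewrite /first_at Cm /=; apply/andP; split; apply/allP => j.
    by move=> /exm; rewrite negbK.
  by move=> /CJ; rewrite negbK.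
have UE : first_digits m J = [set u | (first_one (bits n u) == Some m) && S (bits n u)].
  by apply/seteqP; split => u /=; rewrite bits_digit SE first_one_mkseq mn.
rewrite UE.
apply: (cvg_unique (@Rhausdorff R) (@bits_pattern_cvg _ _ _ hE cC _ _ _ _ hX msX hX0 m n S)).
rewrite exhaustS setUA.
have cV : (tilt m * (k.+1%:R * fine (P (miss_hit X k M [:: C m]))))%R @[k --> \oo] -->
    (tilt m * (theta (M `|` C m) - theta M))%R.
  by apply: cvgM; [exact: cvg_cst|exact: (miss_one_cvg hE cC hX msX cM)].
by apply: cvg_trans cV; apply: near_eq_cvg; apply: nearW => k; rewrite -VE.
Qed.

(** [theta] is alternating of order two: to hit [C m] and miss [K] besides [exhaust m] is a smaller
    event. Hence this increment vanishes whenever the gap at [m] does. *)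
Lemma theta_increment_le K m : compact K ->
  (theta (K `|` exhaust m.+1) - theta (K `|` exhaust m) <=
   theta (exhaust m.+1) - theta (exhaust m))%R.
Proof.
move=> cK; have cKm : compact (K `|` exhaust m) by exact: compactU.
have c1 := miss_one_cvg hE cC hX msX cKm (@cCi m).
have c2 := miss_one_cvg hE cC hX msX (@cex m) (@cCi m).
rewrite exhaustS setUA.
apply: (ler_cvg_to c1 c2); apply: nearW => k.
have mV M : compact M -> measurable (miss_hit X k M [:: C m]).
  by move=> cM; apply: measurableD; exact: (measurable_le_level hX).
apply: ler_wpM2l; first exact: ler0n.
apply: fine_le; try (by apply: fin_num_measure; exact: mV).
apply: le_measure; rewrite ?inE; try exact: mV.
move=> w [+ nC]; rewrite /mkset => h; split => //; apply: le_trans h.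
by apply: supmeasure_le => //; exact: subsetUr.
Qed.

Lemma theta_increment_ge0 K m : compact K ->
  (0 <= theta (K `|` exhaust m.+1) - theta (K `|` exhaust m))%R.
Proof.
move=> cK; rewrite subr_ge0; apply: (theta_mono hX msX); try exact: compactU.
by apply: setUS; exact: exhaust_nd.
Qed.

Definition null_digits : set R := \bigcup_n [set u | bit_law (bits n u) = 0%R].

Lemma measurable_null_digits : measurable null_digits.
Proof.
apply: bigcupT_measurable => n.
exact: (measurable_countable_image (fun s => bit_law s = 0%R) (measurable_bits bit_law n)).
Qed.

Lemma unif01_null_digits : @unif01 R null_digits = 0.
Proof.
have mn n : measurable [set u | bit_law (bits n u) = 0%R].
  exact: (measurable_countable_image (fun s => bit_law s = 0%R) (measurable_bits bit_law n)).
have Pn n : @unif01 R [set u | bit_law (bits n u) = 0%R] = 0.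
  rewrite -[LHS]fineK; last exact: fin_num_measure.
  have := law_sum (@unif01 R) (fun s => bit_law s == 0%R) (size_bits bit_law n)
    (measurable_bits bit_law n).
  rewrite (_ : [set w | bit_law (bits n w) == 0%R] = [set u | bit_law (bits n u) = 0%R]); last first.
    by apply/seteqP; split => u /= /eqP.
  move=> ->; congr EFin; rewrite big_seq_cond big1// => s.
  rewrite mem_all_bits => /andP[/eqP <- /eqP s0].
  transitivity (fine (bit_law s)%:E); last by rewrite s0.
  congr fine; exact: (unif01_bits (bit_law_ge0 hE cC hX msX hX0)
    (bit_law_split hE cC hX msX) (bit_law_nil cC hX msX hX0)).
apply/eqP; rewrite eq_le measure_ge0 andbT.
apply: (@le_trans _ _ (\sum_(n <oo) @unif01 R [set u | bit_law (bits n u) = 0%R])).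
  by apply: measure_sigma_subadditive => //; exact: measurable_null_digits.
by rewrite eseries0.
Qed.

(* Off [null_digits], the digits seen so far form a pattern actually realised by
   some sample [X w], hence obey the laws of a hitting function. *)
Lemma digit_cover u m J J' : ~ null_digits u -> first_at m (digit u) ->
  cover_set C J' `<=` cover_set C J -> all (fun j => ~~ digit u j) J ->
  all (fun j => ~~ digit u j) J'.
Proof.
move=> nu0 fu JJ /allP uJ.
pose n := maxn m.+1 (\max_(j <- J ++ J') j.+1).
have mn : (m < n)%N by rewrite leq_max ltnSn.
have Jn j : j \in J ++ J' -> (j < n)%N.
  by move=> jJ; rewrite leq_max (@leq_bigmax_seq _ _ xpredT succn)// orbT.
have fs : first_one (bits n u) = Some m.
  by apply/eqP; rewrite bits_digit first_one_mkseq mn.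
have nun : nu C P X (bits n u) <> 0%R.
  move=> h; apply: nu0; exists n => //=.
  by rewrite /bit_law fs h mulr0.
have [k [w wn]] : exists k w, pattern C X k w n = bits n u.
  apply: contrapT => nkw; apply: nun.
  apply: (cvg_unique (@Rhausdorff R) (nu_cvg hE cC hX msX fs)).
  have c0 : (fun=> 0%R : R) @ \oo --> (0%R : R) by exact: cvg_cst.
  apply: cvg_trans c0; apply: near_eq_cvg; apply: nearW => k.
  apply/esym; rewrite (_ : [set w | _] = set0); first by rewrite measure0 mulr0.
  apply/seteqP; split => // w /=; rewrite size_bits => wn.
  by apply: nkw; exists k, w.
have D j : (j < n)%N -> digit u j = ~~ (X w (C j) <= (k.+1%:R)%:E).
  move=> jn; have := congr1 (fun s => nth false (rev s) j) wn.
  by rewrite pattern_mkseq bits_digit !revK !nth_mkseq.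
have k0 : 0 <= (k.+1%:R : R)%:E by rewrite lee_fin ler0n.
have : X w (cover_set C J) <= (k.+1%:R)%:E.
  apply/(supmeasure_cover_set_le hE cC (sX w) _ k0) => j jJ.
  by have := uJ j jJ; rewrite D ?negbK// Jn// mem_cat jJ.
move=> /(le_trans (supmeasure_le (sX w) JJ)).
move=> /(supmeasure_cover_set_le hE cC (sX w) _ k0) H.
by apply/allP => j jJ; rewrite D ?negbK ?H// Jn// mem_cat jJ orbT.
Qed.

(** The complement of the random closed set; removing interiors only keeps that set closed. *)
Definition zero_set (u : R) : set E := \bigcup_(i in [set i | ~~ digit u i]) (C i)^°.

(** For compact [K] this is inclusion in [zero_set]. The form with finite lists is a countable union
    of events on finitely many digits, hence measurable. *)
Definition misses (K : set E) (u : R) : Prop :=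
  exists2 J, K `<=` cover_int C J & all (fun j => ~~ digit u j) J.

Lemma missesP K u : compact K -> misses K u <-> K `<=` zero_set u.
Proof.
move=> cK; split.
  by move=> [J KJ /allP uJ] x /KJ[j Jj Cx]; exists j => //; exact: uJ.
by move=> /(compact_cover_int cK)[J KJ uJ]; exists J => //; apply/allP.
Qed.

Lemma measurable_misses K : measurable [set u | misses K u].
Proof.
rewrite (_ : mkset _ = \bigcup_J [set u | K `<=` cover_int C J /\ all (fun j => ~~ digit u j) J]).
  apply: countable_bigcupT_measurable; first exact: countableP.
  move=> J; have [KJ|KJ] := pselect (K `<=` cover_int C J); last first.
    by rewrite (_ : mkset _ = set0)//; apply/seteqP; split => w //= [].
  rewrite (_ : mkset _ = [set u | all (fun j => ~~ digit u j) J]); last first.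
    by apply/seteqP; split => w //= [].
  apply: (@measurable_digits (fun f => all (fun j => ~~ f j) J) (\max_(j <- J) j.+1)).
  move=> f g fg /allP fJ; apply/allP => i iJ; rewrite -fg ?fJ//.
  by rewrite (@leq_bigmax_seq _ _ xpredT succn).
by apply/seteqP; split => u /=; [move=> [J KJ uJ]; exists J|move=> [J _ [KJ uJ]]; exists J].
Qed.

End random_closed_set.

(** * The scaled indicator process and its mean *)

Section scaled_indicator_process.
Context (R : realType) (E : topologicalType) (C : nat -> set E).
Hypothesis hE : hausdorff_space E.
Hypothesis cC : compact_base C.
Context d (Om : measurableType d) (P : probability Om R) (X : Om -> set E -> \bar R).
Hypothesis hX : is_random_supmeasure X.
Hypothesis msX : max_stable P X.
Hypothesis hX0 : {ae P, forall w, X w <> zero_supmeasure}.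

Local Notation theta := (theta P X).
Local Notation exhaust := (exhaust C).
Local Notation tilt := (tilt C P X).
Local Notation digit := (digit C P X).
Local Notation misses := (misses C P X).
Local Notation null_digits := (null_digits C P X).

Let cex n : compact (exhaust n). Proof. exact: compact_exhaust. Qed.
Let ccov J : compact (cover_set C J). Proof. exact: compact_cover_set. Qed.

Let G m J := [set u | first_at m (digit u) && all (fun j => ~~ digit u j) J].
Let Z m K := [set u | first_at m (digit u) /\ misses K u].

Let mN : measurable null_digits. Proof. exact: measurable_null_digits. Qed.
Let mG m J : measurable (G m J). Proof. exact: measurable_first_digits. Qed.
Let mF m : measurable [set u | first_at m (digit u)].
Proof.
have := mG m [::]; rewrite (_ : G m [::] = [set u | first_at m (digit u)])//.
by apply/seteqP; split => u /=; rewrite /G/= andbT.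
Qed.
Let mZ m K : measurable (Z m K).
Proof. by apply: (measurableI _ _ (mF m)); apply: measurable_misses. Qed.

Let off_null S : measurable S -> @unif01 R (S `\` null_digits) = @unif01 R S.
Proof.
move=> mS; rewrite measureD//=; last by rewrite -ge0_fin_numE// fin_num_measure.
rewrite [X in _ - X](_ : _ = 0) ?sube0//; apply/eqP; rewrite eq_le measure_ge0 andbT.
rewrite -(unif01_null_digits hE cC hX msX hX0).
by apply: le_measure; rewrite ?inE//; exact: measurableI.
Qed.

(** [unif01_first_digits] is applied along finite covers that decrease to [K]. The right side
    converges by [theta_outer]; on the left the events increase, off a null set, to [Z m K]. *)
Lemma unif01_first_misses m K : compact K ->
  fine (@unif01 R (Z m K)) =
  (tilt m * (theta (K `|` exhaust m.+1) - theta (K `|` exhaust m)))%R.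
Proof.
move=> cK; have [J [KJ Jd JU]] := cover_int_sequence cC cK.
have capJ n : \bigcap_k (cover_set C (J k) `|` exhaust n) = K `|` exhaust n.
  apply/seteqP; split => x.
    move=> h; have [?|nx] := pselect (exhaust n x); [by right|left].
    apply: contrapT => nKx.
    have [|y Ky|k kx] := JU (~` [set x]).
    - by apply: closed_openC; apply: compact_closed => //; exact: compact_set1.
    - by move=> yx; apply: nKx; rewrite -yx.
    - by have [/kx /(_ erefl)|] := h k Logic.I.
  move=> [Kx|ex] k _; [left|by right].
  by apply: cover_int_sub; exact: KJ.
have cvt n : theta (cover_set C (J k) `|` exhaust n) @[k --> \oo] --> theta (K `|` exhaust n).
  apply: (theta_outer hX msX) => //.
  - by move=> k; exact: compactU.
  - exact: compactU.
  - by move=> k; apply: setSU; exact: Jd.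
have c1 : fine (@unif01 R (G m (J k))) @[k --> \oo] -->
    (tilt m * (theta (K `|` exhaust m.+1) - theta (K `|` exhaust m)))%R.
  under eq_fun do rewrite (unif01_first_digits hE cC hX msX hX0).
  by apply: cvgM; [exact: cvg_cst|exact: cvgB].
(* Monotonicity and the identification of the limit both rest on [digit_cover]: off the null set,
   zero digits pass from a cover to any smaller one. *)
have nd : nondecreasing_seq (fun k => G m (J k) `\` null_digits).
  apply/nondecreasing_seqP => k; apply/subsetPset => u [/= /andP[fu uJ] nu0].
  split => //; rewrite /G/= fu /=.
  exact: (digit_cover hE cC hX msX nu0 fu (Jd k) uJ).
have UZ : \bigcup_k (G m (J k) `\` null_digits) = Z m K `\` null_digits.
  apply/seteqP; split => u.
    by move=> [k _ [/= /andP[fu uJ] nu0]]; split => //; split => //; exists (J k).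
  move=> [[fu [J' KJ' uJ']] nu0].
  have [k kJ'] := JU _ (@open_cover_int _ C J') KJ'.
  exists k => //; split => //; rewrite /G/= fu /=.
  apply: (digit_cover hE cC hX msX nu0 fu _ uJ').
  by apply: subset_trans kJ' _; exact: cover_int_sub.
have c2 : @unif01 R (G m (J k)) @[k --> \oo] --> @unif01 R (Z m K).
  have cv := nondecreasing_cvg_mu (mu := @unif01 R) (fun k => measurableD (mG m (J k)) mN).
  rewrite UZ in cv; have {}cv := cv (measurableD (mZ m K) mN) nd.
  rewrite -(off_null (mZ m K)); apply: cvg_trans cv.
  by apply: near_eq_cvg; apply: nearW => k; exact: off_null.
apply: (cvg_unique (@Rhausdorff R) _ c1).
by apply: fine_cvg; rewrite fineK//; exact: fin_num_measure.
Qed.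

Definition first_digit (u : R) : nat := xget 0%N [set m | first_at m (digit u)].
(** The inverse of [tilt] restores the mass of the exponent measure. Where [tilt m] is 0, the first
    digit 1 is a.s. not at [m], and 1 is a positive placeholder. *)
Definition weight (m : nat) : R := if tilt m == 0%R then 1%R else (tilt m)^-1%R.
Definition indicator_process (u : R) (A : set E) : \bar R :=
  if `[< ~` zero_set C P X u `&` A !=set0 >] then (weight (first_digit u))%:E else 0.

Lemma first_digitE u m : first_at m (digit u) -> first_digit u = m.
Proof.
move=> fu; rewrite /first_digit; apply: xget_unique => // k fk.
exact: first_at_inj fk fu.
Qed.

Lemma weight_gt0 m : (0 < weight m)%R.
Proof.
rewrite /weight; case: ifPn => // t0; rewrite invr_gt0 lt_neqAle eq_sym t0.
exact: (tilt_ge0 cC hX msX hX0).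
Qed.

Let H m K := [set u | first_at m (digit u)] `\` Z m K.
Let mH m K : measurable (H m K). Proof. exact: measurableD. Qed.

Lemma indicator_process_misses u K : misses K u -> indicator_process u K = 0.
Proof.
move=> [J KJ /allP uJ]; rewrite /indicator_process; case: asboolP => // -[x [nx /KJ[j Jj Cx]]].
by case: nx; exists j => //=; exact: uJ.
Qed.

Lemma indicator_process_hits u K : compact K -> ~ misses K u ->
  indicator_process u K = (weight (first_digit u))%:E.
Proof.
move=> cK nK; rewrite /indicator_process; case: asboolP => // h; case: nK.
apply/(missesP C P X u cK) => x Kx; apply: contrapT => nx; apply: h; by exists x.
Qed.

(** If the first [n] digits are 0 then [K] is missed, so only first hits below [n] matter. This
    makes the mean a finite sum. *)
Lemma indicator_process_sum u K n : compact K -> K `<=` cover_int C (iota 0 n) ->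
  indicator_process u K = \sum_(m <- iota 0 n) (weight m)%:E * (\1_(H m K) u)%:E.
Proof.
move=> cK Kn; have [mK|mK] := pselect (misses K u).
  rewrite indicator_process_misses// big1// => m _.
  by rewrite indicE memNset ?mule0// => -[fu []].
rewrite indicator_process_hits//.
have [m mn fu] : exists2 m, (m < n)%N & first_at m (digit u).
  apply: contrapT => h; apply: mK; exists (iota 0 n) => //; apply/allP => i.
  rewrite mem_iota leq0n add0n /= => i_n; apply/negP => /first_at_exists[m mi fu].
  by apply: h; exists m => //; exact: leq_ltn_trans i_n.
rewrite (first_digitE fu) (bigD1_seq m) ?iota_uniq ?mem_iota//=.
rewrite indicE mem_set ?mule1; last by split => // -[].
rewrite big1 ?adde0// => i im; rewrite indicE memNset ?mule0// => -[fi _].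
by move: im; rewrite (first_at_inj fi fu) eqxx.
Qed.

Lemma measurable_indicator_process K : compact K ->
  measurable_fun setT (fun u => indicator_process u K).
Proof.
move=> cK; have [n Kn] := compact_sub_exhaust_int cC cK.
under eq_fun do rewrite (indicator_process_sum _ cK Kn).
apply: emeasurable_sum => m; apply: measurable_funeM.
apply: measurableT_comp => //; exact: measurable_indic.
Qed.

Lemma indicator_process_random : is_random_supmeasure indicator_process.
Proof.
split; last exact: measurable_indicator_process.
move=> u; apply: (is_supmeasure_scaled_indicator hE).
  by apply: ltW; exact: weight_gt0.
apply: open_closedC; apply: bigcup_open => i _; exact: open_interior.
Qed.

Let unif01_H m K : compact K -> @unif01 R (H m K) =
  (tilt m * ((theta (exhaust m.+1) - theta (exhaust m)) -
    (theta (K `|` exhaust m.+1) - theta (K `|` exhaust m))))%:E.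
Proof.
move=> cK; rewrite mulrBr -(unif01_first_misses m cK).
have FE : [set u | first_at m (digit u)] = G m [::].
  by apply/seteqP; split => u /=; rewrite /G/= andbT.
have F0 : fine (@unif01 R [set u | first_at m (digit u)]) =
    (tilt m * (theta (exhaust m.+1) - theta (exhaust m)))%R.
  rewrite FE (unif01_first_digits hE cC hX msX hX0) (_ : cover_set C [::] = set0) ?set0U//.
  by apply/seteqP; split => // x [j].
rewrite -F0 EFinB !fineK; try exact: fin_num_measure.
rewrite /H measureD//=; last by rewrite -ge0_fin_numE// fin_num_measure.
congr (_ - unif01 _); apply/seteqP; split => u; [by case|by move=> [? ?]; split].
Qed.

(** [weight m] cancels [tilt m], and the sum over [m < n] telescopes. What remains besides [theta K]
    cancels, because [exhaust n] contains [K]. *)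
Lemma integral_indicator_process K : compact K ->
  \int[@unif01 R]_u indicator_process u K = (theta K)%:E.
Proof.
move=> cK; have [n Kn] := compact_sub_exhaust_int cC cK.
have mind m : measurable_fun setT (fun u : R => (\1_(H m K) u)%:E).
  by apply: measurableT_comp => //; exact: measurable_indic.
under eq_integral do rewrite (indicator_process_sum _ cK Kn).
rewrite ge0_integral_sum//; last 2 first.
  by move=> m; apply: measurable_funeM.
  by move=> m u _; rewrite mule_ge0// lee_fin ?indicE ?ltW ?weight_gt0.
pose D m := ((theta (exhaust m.+1) - theta (exhaust m)) -
    (theta (K `|` exhaust m.+1) - theta (K `|` exhaust m)))%R.
have Em m : \int[@unif01 R]_u ((weight m)%:E * (\1_(H m K) u)%:E) = (D m)%:E.
  rewrite ge0_integralZl_EFin//; last by rewrite ltW// weight_gt0.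
  rewrite integral_indic// setIT.
  transitivity ((weight m)%:E * (tilt m * D m)%:E).
    by congr (_ * _); exact: unif01_H.
  rewrite -EFinM /weight; congr EFin.
  (* With [tilt m] equal to 0 the gap is 0, and the increment with [K] lies between 0 and the gap,
     so both parts of [D m] vanish. *)
  case: ifPn => [/eqP t0|t0]; last by rewrite mulKf.
  rewrite t0 mul0r mulr0; apply/esym/eqP; rewrite /D.
  have := theta_increment_ge0 cC hX msX m cK; have := theta_increment_le hE cC hX msX m cK.
  have g0 : (theta (exhaust m.+1) - theta (exhaust m) = 0)%R.
    exact: (tilt_eq0 cC hX msX hX0 t0).
  by rewrite g0 => h1 h2; rewrite sub0r oppr_eq0 eq_le h1 h2.
under eq_bigr do rewrite Em.
rewrite sumEFin; congr EFin.
have -> : (\sum_(m <- iota 0 n) D m)%R = (theta (exhaust n) - theta (K `|` exhaust n) + theta K)%R.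
  elim: n {Kn} => [|n IH].
    by rewrite big_nil exhaust0 setU0 (theta0 P hX); lra.
  by rewrite -addn1 iotaD big_cat /= IH big_seq1 add0n addn1 /D; lra.
rewrite setUidr ?subrr ?add0r//.
by apply: subset_trans Kn _; exact: cover_int_sub.
Qed.

(** The event lies in the cylinder of [n] zeros for each [n], and the probabilities of these
    cylinders tend to 0. *)
Lemma all_zero_digits_null : @unif01 R [set u | forall i, ~~ digit u i] = 0.
Proof.
have mA : measurable [set u | forall i, ~~ digit u i].
  rewrite (_ : mkset _ = \bigcap_i [set u | digit u i = false]).
    by apply: bigcapT_measurable => i; exact: measurable_digit.
  by apply/seteqP; split => u /= h i; [move=> _ /=; exact/negbTE|apply/negbT; exact: h].
have le n : (fine (@unif01 R [set u | forall i, ~~ digit u i]) <=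
    bit_law C P X (nseq n false))%R.
  rewrite -lee_fin fineK; last exact: fin_num_measure.
  rewrite -(unif01_bits (bit_law_ge0 hE cC hX msX hX0)
    (bit_law_split hE cC hX msX) (bit_law_nil cC hX msX hX0)).
  apply: le_measure; rewrite ?inE//; first exact: measurable_bits.
  move=> u /= h; rewrite size_nseq bits_digit.
  rewrite (_ : mkseq _ _ = nseq n false) ?rev_nseq//.
  apply: (@eq_from_nth _ false); rewrite size_mkseq ?size_nseq// => i i_n.
  by rewrite nth_mkseq// nth_nseq i_n; exact/negbTE.
apply/eqP; rewrite eq_le measure_ge0 andbT -[leLHS]fineK; last exact: fin_num_measure.
rewrite lee_fin.
have c0 : (fun=> fine (@unif01 R [set u | forall i, ~~ digit u i])) @ \oo -->
   fine (@unif01 R [set u | forall i, ~~ digit u i]) by exact: cvg_cst.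
apply: (ler_cvg_to c0 (bit_law_zeros_cvg cC hX msX)); exact: nearW.
Qed.

(** The point is that the closed set is not empty. Almost surely there is a first digit 1, at some
    [m]; by [digit_cover] for the list [[:: m]] the set [C m] cannot be missed. *)
Lemma indicator_process_ae : {ae @unif01 R, forall u, scaled_indicator (indicator_process u)}.
Proof.
have mA : measurable [set u | forall i, ~~ digit u i].
  rewrite (_ : mkset _ = \bigcap_i [set u | digit u i = false]).
    by apply: bigcapT_measurable => i; exact: measurable_digit.
  by apply/seteqP; split => u /= h i; [move=> _ /=; exact/negbTE|apply/negbT; exact: h].
exists (null_digits `|` [set u | forall i, ~~ digit u i]); split.
- exact: measurableU.
- apply: null_set_setU => //; last exact: all_zero_digits_null.
  exact: (unif01_null_digits hE cC hX msX hX0).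
move=> u /= nu; apply: contrapT => h; apply: nu.
have nu0 : ~ null_digits u by move=> ?; apply: h; left.
have [i ui] : exists i, digit u i.
  by apply: contrapT => /forallNP H0; apply: h; right => i; exact/negP.
have [m mi fu] := first_at_exists ui.
exists (weight (first_digit u)), (~` zero_set C P X u); split => //.
- exact: weight_gt0.
- by apply: open_closedC; apply: bigcup_open => j _; exact: open_interior.
have cCm : compact (C m) by case: cC.
suff : ~ misses (C m) u.
  move=> nm; apply: contrapT => n0; apply: nm; apply/(missesP C P X u cCm) => x _.
  by apply: contrapT => nx; apply: n0; exists x.
move=> [J CJ uJ].
have : all (fun j => ~~ digit u j) [:: m].
  apply: (digit_cover hE cC hX msX nu0 fu _ uJ) => x [j /=]; rewrite inE => /eqP -> Cx.
  by apply: cover_int_sub; exact: CJ.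
by case/andP: fu => um _ /=; rewrite um.
Qed.

End scaled_indicator_process.

(** * The representation *)

(** Events generated by functions of [U] are preimages under [U], the form that
    [mutually_independent_iid_unif] takes. *)
Lemma gen_sigma_factor d (Om : measurableType d) d' (T : measurableType d') (R : realType)
    (U : Om -> T) (fs : set (Om -> \bar R)) :
  (forall f, fs f -> exists2 g : T -> \bar R, measurable_fun setT g & f = g \o U) ->
  forall A, gen_sigma fs A -> exists2 S, measurable S & A = U @^-1` S.
Proof.
move=> fsU A fsA.
have : preimage_set_system setT U measurable A.
  move: fsA; apply: smallest_sub.
    exact/sigma_algebra_preimage/sigma_algebra_measurable.
  move=> _ [f [B [/fsU[g mg ->] mB ->]]]; exists (g @^-1` B).
    exact: measurable_preimageT.
  by rewrite setTI.
by move=> [S mS <-]; exists S; rewrite ?setTI.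
Qed.

Definition exp_quantile (R : realType) (v : R) : R := (- ln (1 - v))%R.

Lemma measurable_exp_quantile (R : realType) : measurable_fun setT (@exp_quantile R).
Proof.
apply: measurableT_comp => //; apply: (measurableT_comp (@measurable_ln R)).
exact: measurable_funB.
Qed.

Lemma unif01_exp_quantile (R : realType) (t : R) :
  @unif01 R [set v | (exp_quantile v <= t)%R] =
  (if (0 <= t)%R then 1 - expR (- t) else 0)%:E.
Proof.
have -> : @unif01 R [set v | (exp_quantile v <= t)%R] =
    @unif01 R `]-oo, (1 - expR (- t))%R]%classic.
  rewrite !unif01E; congr (lebesgue_measure _); apply/seteqP.
  suff H v : (v < 1)%R -> (exp_quantile v <= t)%R = (v <= 1 - expR (- t))%R.
    have v1 v : `[0%R, 1%R[%classic v -> (v < 1)%R by rewrite /= in_itv => /andP[].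
    by split => v [+ v01]; rewrite /= ?in_itv/= => vt; split => //=; move: vt;
      rewrite ?in_itv/= H//; exact: v1.
  move=> v1; rewrite /exp_quantile lerNl.
  by rewrite -ler_expR lnK ?posrE ?subr_gt0//; apply/idP/idP => ?; lra.
rewrite unif01_ray; congr EFin.
have e0 := expR_gt0 (- t); rewrite min_l; last by lra.
case: ifPn => [t0|]; last rewrite -ltNge => t0.
  have : (expR (- t) <= 1)%R by rewrite -expR0 ler_expR oppr_le0.
  by move=> ?; rewrite max_r//; lra.
have : (1 < expR (- t))%R by rewrite -expR0 ltr_expR oppr_gt0.
by move=> ?; rewrite max_l//; lra.
Qed.

Section representation.
Context (R : realType) (E : topologicalType) (Z : R -> set E -> \bar R).
Hypothesis rZ : is_random_supmeasure Z.

(** The positions [i.*2] here and [i.*2.+1] for the copies are those of [enc_sum]. *)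
Definition unif_exponential (i : nat) (u : R) : R := exp_quantile (iid_unif i.*2 u).
Definition unif_copy (i : nat) (u : R) : set E -> \bar R := Z (iid_unif i.*2.+1 u).

Lemma unif_exponential_std i : std_exponential (@unif01 R) (unif_exponential i).
Proof.
have mq := @measurable_exp_quantile R; split.
  exact: (measurableT_comp mq (@measurable_iid_unif R i.*2)).
move=> t; rewrite -unif01_exp_quantile.
apply: (@unif01_iid_unif R i.*2 [set v | (exp_quantile v <= t)%R]).
exact: (measurable_set_le mq).
Qed.

Lemma unif_copy_random i : is_random_supmeasure (unif_copy i).
Proof.
split=> [u|K cK]; first by case: rZ => sZ _; exact: sZ.
apply: (measurableT_comp (f := fun v => Z v K)); last exact: measurable_iid_unif.
by case: rZ => _; exact.
Qed.

Lemma unif_copy_prob i n (K : 'I_n -> set E) t : (forall i, compact (K i)) ->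
  @unif01 R [set u | forall j, unif_copy i u (K j) <= t j] =
  @unif01 R [set u | forall j, Z u (K j) <= t j].
Proof.
move=> cK; apply: (@unif01_iid_unif R i.*2.+1 [set v | forall j, Z v (K j) <= t j]).
rewrite (_ : mkset _ = \bigcap_(j in [set: 'I_n]) [set v | Z v (K j) <= t j]).
  apply: fin_bigcap_measurable => // j _; exact: measurable_le_level.
by apply/seteqP; split => v /= h j; [move=> _; exact: h|exact: h].
Qed.

Lemma unif_copy_fdd i : fdd_eq (@unif01 R) (unif_copy i) (@unif01 R) (unif_copy 0).
Proof.
move=> n K t cK; exact: etrans (unif_copy_prob i t cK) (esym (unif_copy_prob 0 t cK)).
Qed.

Lemma integral_unif_copy K : compact K ->
  \int[@unif01 R]_u unif_copy 0 u K = \int[@unif01 R]_u Z u K.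
Proof.
move=> cK; have mZ : measurable_fun setT (Z ^~ K) by case: rZ => _; exact.
have mi := @measurable_iid_unif R 1.
have Z0 v : 0 <= Z v K by apply: supmeasure_ge0; case: rZ => sZ _; exact: sZ.
rewrite -(@ge0_integral_image_measure _ _ _ _ _ (@unif01 R) _ mi _ mZ Z0).
by apply: eq_measure_integral => A mA _; exact: (@unif01_iid_unif R 1 A mA).
Qed.

Lemma unif_copy_ae (Q : (set E -> \bar R) -> Prop) :
  {ae @unif01 R, forall u, Q (Z u)} -> {ae @unif01 R, forall u, Q (unif_copy 0 u)}.
Proof.
move=> [N [mN PN QN]]; exists (iid_unif 1 @^-1` N); split.
- by apply: (measurable_preimageT (@measurable_iid_unif R 1)).
- by rewrite -PN; exact: (@unif01_iid_unif R 1 N mN).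
- by move=> u /= nQ; apply: QN.
Qed.

Lemma unif_copy_indep : mutually_independent (@unif01 R)
  (fun k : nat + nat => match k with
     | inl i => gen_sigma [set (fun w => (unif_exponential i w)%:E)]
     | inr i => gen_sigma [set (fun w => unif_copy i w K) | K in compact]
     end).
Proof.
apply: mutually_independent_iid_unif => -[i|i] A; apply: gen_sigma_factor.
  move=> _ ->; exists (fun v => (exp_quantile v)%:E) => //.
  by apply/measurable_EFinP; exact: measurable_exp_quantile.
by move=> _ [K cK <-]; exists (Z ^~ K) => //; case: rZ => _; exact.
Qed.

End representation.

Section scaled_probability.
Context (R : realType) (E : topologicalType).
Context d (Om : measurableType d) (P : probability Om R) (X : Om -> set E -> \bar R).
Hypothesis hX : is_random_supmeasure X.
Context d' (Om' : measurableType d') (P' : probability Om' R).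
Variables (T : nat -> Om' -> R) (Y : nat -> Om' -> set E -> \bar R).

Let scaled := forall n (u : 'I_n -> R) (K : 'I_n -> set E),
  (forall i, compact (K i)) -> (forall i, 0 <= u i)%R ->
  P [set w | forall i, (u i)%:E * X w (K i) <= 1] =
  (expR (- fine (\int[P']_w sup_eval (family_seq u K) (Y 0%N w))))%:E.

(** [fdd_eq] compares at levels, so multipliers are turned into levels, with [+oo] for a zero
    multiplier; then [lepage_scaled] applies. *)
Lemma scaled_probability_of_lepage : lepage_rep P X P' T Y -> scaled.
Proof.
move=> [expT [rY lawY] indF [iY aeY] fddX] n u K cK u0.
rewrite -(lepage_scaled expT rY lawY indF iY cK u0).
pose t i : \bar R := if u i == 0%R then +oo else (u i)^-1%:E.
have tP i (x : \bar R) : ((u i)%:E * x <= 1) = (x <= t i).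
  rewrite /t; case: eqP => [->|/eqP ui]; first by rewrite mul0e lee01 leey.
  have ui0 : (0 < u i)%R by rewrite lt_neqAle eq_sym ui u0.
  by rewrite -[in LHS](muleC x) -lee_pdivlMr// mul1e.
transitivity (P [set w | forall i, X w (K i) <= t i]).
  by congr (P _); apply/seteqP; split => w /= h i; have := h i; rewrite tP.
rewrite fddX//; congr (P' _).
by apply/seteqP; split => w /= h i; have := h i; rewrite tP.
Qed.

(** The series is known to be non-negative only off the event that some [T i] is at most 0; this is
    why [cdf_eq_of_scaled] admits null sets. *)
Lemma lepage_fdd : (forall i, std_exponential P' (T i)) ->
  (forall i, is_random_supmeasure (Y i)) ->
  (forall n (u : 'I_n -> R) (K : 'I_n -> set E),
    (forall i, compact (K i)) -> (forall i, 0 <= u i)%R ->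
    P [set w | forall i, (u i)%:E * X w (K i) <= 1] =
    P' [set w | forall i, (u i)%:E * lepage_sup T Y w (K i) <= 1]) ->
  fdd_eq P X P' (lepage_sup T Y).
Proof.
move=> expT rY H n K t cK.
apply: (@cdf_eq_of_scaled _ _ _ _ _ _ P P' (fun w i => X w (K i))
  (fun w i => lepage_sup T Y w (K i)) _ _ set0 _ measurable0 (measurable_lepage_null expT)).
- by move=> i; case: hX => _; exact.
- by move=> i; exact: measurable_lepage_sup.
- exact: measure0.
- exact: lepage_null.
- by move=> w i _; apply: supmeasure_ge0; case: hX => sX _; exact: sX.
- by move=> w i; exact: lepage_sup_ge0.
- by move=> u u0; exact: H.
Qed.

End scaled_probability.

Theorem mainTheorem9 (R : realType) (E : topologicalType)
    (hE_haus : hausdorff_space E)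
    (hE_lc : locally_compact [set: E])
    (hE_sc : @second_countable E)
    (d : measure_display) (Om : measurableType d) (P : probability Om R)
    (X : Om -> set E -> \bar R)
    (hX : is_random_supmeasure X)
    (hX0 : {ae P, forall w, X w <> zero_supmeasure}) :
  (is_CRSM P X <->
     exists (d' : measure_display) (Om' : measurableType d')
            (P' : probability Om' R) (Ex : nat -> Om' -> R)
            (Y : nat -> Om' -> set E -> \bar R),
       lepage_rep P X P' Ex Y)
  /\
  (forall (d' : measure_display) (Om' : measurableType d')
          (P' : probability Om' R) (Ex : nat -> Om' -> R)
          (Y : nat -> Om' -> set E -> \bar R),
     lepage_rep P X P' Ex Y ->
     forall K : set E, compact K ->
       exists a : R, \int[P']_w Y 0%N w K = a%:E /\
                     tail_dep P X (\1_K : E -> R) a).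
Proof.
have [C cC] := exists_compact_base hE_haus hE_lc hE_sc.
have sX w : is_supmeasure (X w) by case: hX => sX _; exact: sX.
split; [split|].
- move=> crsm; have msX := crsm.1.
  pose Z := indicator_process C P X.
  have rZ : is_random_supmeasure Z by exact: indicator_process_random.
  have intY K : compact K -> \int[@unif01 R]_u unif_copy Z 0 u K = (theta P X K)%:E.
    move=> cK; rewrite integral_unif_copy//; exact: integral_indicator_process.
  have rY := unif_copy_random rZ.
  have iY : rsm_integrable (@unif01 R) (unif_copy Z 0).
    by move=> K cK; rewrite intY// ltry.
  have aeY : {ae @unif01 R, forall u, scaled_indicator (unif_copy Z 0 u)}.
    apply: (unif_copy_ae (Q := scaled_indicator)); exact: indicator_process_ae.
  have expT := @unif_exponential_std R.
  have indF := unif_copy_indep rZ.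
  suff fddX : fdd_eq P X (@unif01 R) (lepage_sup (@unif_exponential R) (unif_copy Z)).
    have rep : lepage_rep P X (@unif01 R) (@unif_exponential R) (unif_copy Z).
      exact: And5 expT (conj rY (unif_copy_fdd rZ)) indF (conj iY aeY) fddX.
    exact: ex_intro _ _ (ex_intro _ _ (ex_intro _ _ (ex_intro _ _ (ex_intro _ _ rep)))).
  apply: (lepage_fdd hX expT rY) => n u K cK u0.
  rewrite (lepage_scaled expT rY (unif_copy_fdd rZ) indF iY cK u0).
  (* [Y] was built so that [E Y(L) = theta L], as [CRSM_sup_eval] asks. At level 1 that lemma gives
     [exp (- E max_i u_i Y(K_i))] for [X], the value already found for the series. *)
  have frX L : compact L ->
      frechet_scale P (X ^~ L) (fine (\int[@unif01 R]_w unif_copy Z 0 w L)).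
    by move=> cL; rewrite intY//=; exact: frechet_theta.
  have [_ /(_ 1%R ltr01)] := CRSM_sup_eval hE_haus cC hX (rY 0%N) aeY crsm iY frX
    (family_seq_admissible cK u0).
  rewrite divr1 => <-; congr (P _); apply/seteqP; split => w /= h.
    by rewrite sup_eval_le ?lee01// family_seqP.
  by move: h; rewrite sup_eval_le ?lee01// family_seqP.
- move=> [d' [Om' [P' [Ex [Y rep]]]]].
  have scaledXY := scaled_probability_of_lepage rep.
  by case: rep => _ [rY _] _ [iY aeY] _; exact: (CRSM_of_scaled hE_haus hX (rY 0%N) iY aeY).
- move=> d' Om' P' Ex Y rep K cK.
  have scaledXY := scaled_probability_of_lepage rep.
  case: rep => _ [rY _] _ [iY _] _.
  exists (fine (\int[P']_w Y 0%N w K)); split.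
    rewrite fineK// ge0_fin_numE ?iY//; apply: integral_ge0 => w _.
    by apply: supmeasure_ge0; case: (rY 0%N) => sY _; exact: sY.
  rewrite /tail_dep; under eq_fun do rewrite (ext_int_indic hE_haus cC)//.
  exact: (frechet_indic hX (rY 0%N) iY scaledXY).
Qed.
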